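(* Let $d=2$ and let $\alpha:\mathbb R^2\to U(m)$ be an equivariantly null-homotopic family of matching matrices. Then there exists a sequence $(\alpha_n)_{n\in\mathbb N}$ of families of matching matrices $\alpha_n:\mathbb R^2\to U(m)$ (with the same $\varepsilon$) such that $\sup_{\mathbf k\in\mathbb R^2}\|\alpha_n(\mathbf k)-\alpha(\mathbf k)\|\to0$ as $n\to\infty$ and each $\alpha_n$ is in generic form.
   Context: Fix $m\ge1$; $\varepsilon$ is either the identity $\mathbf 1$ (bosonic) or, for $m$ even, $J=\begin{pmatrix}0&\mathbf 1\\-\mathbf 1&0\end{pmatrix}$ (fermionic). A family of matching matrices is a continuous, $\mathbb Z^2$-periodic map $\alpha:\mathbb R^2\to U(m)$ with $\varepsilon\alpha(\mathbf k)=\alpha(-\mathbf k)^t\varepsilon$; it is equivariantly null-homotopic if there is a map $(t,\mathbf k)\mapsto\alpha_t(\mathbf k)$, continuous in $t\in[0,1]$, with each $\alpha_t$ matching, $\alpha_0=\alpha$, $\alpha_1\equiv\mathbf 1$. High-symmetry points are $\mathbf k_\sharp\in\mathbb R^2$ with $\mathbf k_\sharp\equiv-\mathbf k_\sharp\bmod\mathbb Z^2$ (i.e. $2\mathbf k_\sharp\in\mathbb Z^2$). An equivariantly null-homotopic family $\alpha$ is in generic form if: in the case $\varepsilon=\mathbf 1$, $\alpha(\mathbf k)$ has completely non-degenerate (simple) spectrum for all $\mathbf k$; in the case $\varepsilon=J$, the spectrum of $\alpha(\mathbf k)$ is completely non-degenerate for all $\mathbf k$ that are not high-symmetry points, every eigenvalue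 of $\alpha(\mathbf k_\sharp)$ at each high-symmetry point is exactly doubly degenerate, and there exist constants $A,R>0$ such that for all $\mathbf k$ in the open balls of radius $R$ around the high-symmetry points the spectrum of $\alpha(\mathbf k)$ consists of clusters of two eigenvalues lying at distance at least $A$ from each other. *)

(* Defs.v *)
From Stdlib Require Import Reals Lra Lia ZArith Arith.
Open Scope R_scope.

Definition C : Type := (R * R)%type.
Definition C0 : C := (0, 0).
Definition C1 : C := (1, 0).
Definition Cadd (z w : C) : C := (fst z + fst w, snd z + snd w).
Definition Copp (z : C) : C := (- fst z, - snd z).
Definition Csub (z w : C) : C := Cadd z (Copp w).
Definition Cmul (z w : C) : C :=
  (fst z * fst w - snd z * snd w, fst z * snd w + snd z * fst w).
Definition Cconj (z : C) : C := (fst z, - snd z).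
Definition Cnorm (z : C) : R := sqrt (fst z ^ 2 + snd z ^ 2).

Fixpoint Csum (n : nat) (f : nat -> C) : C :=
  match n with
  | O => C0
  | S n' => Cadd (Csum n' f) (f n')
  end.
Fixpoint Rsum (n : nat) (f : nat -> R) : R :=
  match n with
  | O => 0
  | S n' => Rsum n' f + f n'
  end.

(** * Vectors and matrices; only indices < m are meaningful *)
Definition Vec : Type := nat -> C.
Definition Mat : Type := nat -> nat -> C.

Definition meq (m : nat) (A B : Mat) : Prop :=
  forall i j, (i < m)%nat -> (j < m)%nat -> A i j = B i j.
Definition mmul (m : nat) (A B : Mat) : Mat :=
  fun i j => Csum m (fun k => Cmul (A i k) (B k j)).
Definition msub (A B : Mat) : Mat := fun i j => Csub (A i j) (B i j).
Definition madj (A : Mat) : Mat := fun i j => Cconj (A j i).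
Definition mtr (A : Mat) : Mat := fun i j => A j i.
Definition mId : Mat := fun i j => if Nat.eqb i j then C1 else C0.
Definition mapply (m : nat) (A : Mat) (v : Vec) : Vec :=
  fun i => Csum m (fun k => Cmul (A i k) (v k)).
Definition inner (m : nat) (u v : Vec) : C :=
  Csum m (fun i => Cmul (Cconj (u i)) (v i)).
Definition vnorm (m : nat) (v : Vec) : R :=
  sqrt (Rsum m (fun i => Cnorm (v i) ^ 2)).

(** J = [[0, 1], [-1, 0]] in blocks of size m/2 *)
Definition Jmat (m : nat) : Mat :=
  fun i j =>
    let h := Nat.div m 2 in
    if andb (Nat.ltb i h) (Nat.eqb j (i + h)) then C1
    else if andb (Nat.ltb j h) (Nat.eqb i (j + h)) then Copp C1
    else C0.

Definition unitary (m : nat) (U : Mat) : Prop := meq m (mmul m (madj U) U) mId.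

Inductive sym := Bosonic | Fermionic.
Definition eps (s : sym) (m : nat) : Mat :=
  match s with Bosonic => mId | Fermionic => Jmat m end.

Definition R2 : Type := (R * R)%type.
Definition dist2 (k l : R2) : R :=
  sqrt ((fst k - fst l) ^ 2 + (snd k - snd l) ^ 2).
Definition neg2 (k : R2) : R2 := (- fst k, - snd k).

Definition high_sym (k : R2) : Prop :=
  exists a b : Z, 2 * fst k = IZR a /\ 2 * snd k = IZR b.

Definition fam_continuous (m : nat) (al : R2 -> Mat) : Prop :=
  forall k e, 0 < e -> exists d, 0 < d /\ forall k', dist2 k k' < d ->
    forall i j, (i < m)%nat -> (j < m)%nat -> Cnorm (Csub (al k' i j) (al k i j)) < e.

Definition matching_family (s : sym) (m : nat) (al : R2 -> Mat) : Prop :=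
  fam_continuous m al /\
  (forall k, meq m (al (fst k + 1, snd k)) (al k) /\
             meq m (al (fst k, snd k + 1)) (al k)) /\
  (forall k, unitary m (al k)) /\
  (forall k, meq m (mmul m (eps s m) (al k)) (mmul m (mtr (al (neg2 k))) (eps s m))).

Definition equiv_null_homotopic (s : sym) (m : nat) (al : R2 -> Mat) : Prop :=
  exists H : R -> R2 -> Mat,
    (forall t k e, 0 <= t <= 1 -> 0 < e -> exists d, 0 < d /\
       forall t' k', 0 <= t' <= 1 -> Rabs (t' - t) < d -> dist2 k k' < d ->
       forall i j, (i < m)%nat -> (j < m)%nat ->
         Cnorm (Csub (H t' k' i j) (H t k i j)) < e) /\
    (forall t, 0 <= t <= 1 -> matching_family s m (H t)) /\
    (forall k, meq m (H 0 k) (al k)) /\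
    (forall k, meq m (H 1 k) mId).

(** * Spectrum with multiplicities.
    [is_spectrum m A lam]: lam 0, ..., lam (m-1) are the eigenvalues of A
    counted with multiplicity, witnessed by an orthonormal eigenbasis
    (all matrices considered here are unitary, hence unitarily diagonalizable). *)
Definition is_spectrum (m : nat) (A : Mat) (lam : nat -> C) : Prop :=
  exists v : nat -> Vec,
    (forall i j, (i < m)%nat -> (j < m)%nat ->
       inner m (v i) (v j) = if Nat.eqb i j then C1 else C0) /\
    (forall i r, (i < m)%nat -> (r < m)%nat ->
       mapply m A (v i) r = Cmul (lam i) (v i r)).

Definition simple_spectrum (m : nat) (A : Mat) : Prop :=
  exists lam, is_spectrum m A lam /\
    forall i j, (i < m)%nat -> (j < m)%nat -> lam i = lam j -> i = j.

Definition doubly_degenerate (m : nat) (A : Mat) : Prop :=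
  exists lam, is_spectrum m A lam /\
    forall i, (i < m)%nat -> exists j, (j < m)%nat /\ j <> i /\ lam j = lam i /\
      forall l, (l < m)%nat -> lam l = lam i -> l = i \/ l = j.

Definition paired_clusters (m : nat) (A : Mat) (a : R) : Prop :=
  exists lam, is_spectrum m A lam /\
    forall i j, (i < m)%nat -> (j < m)%nat -> Nat.div i 2 <> Nat.div j 2 ->
      a <= Cnorm (Csub (lam i) (lam j)).

Definition generic_form (s : sym) (m : nat) (al : R2 -> Mat) : Prop :=
  equiv_null_homotopic s m al /\
  match s with
  | Bosonic => forall k, simple_spectrum m (al k)
  | Fermionic =>
      (forall k, ~ high_sym k -> simple_spectrum m (al k)) /\
      (forall k, high_sym k -> doubly_degenerate m (al k)) /\
      (exists a r, 0 < a /\ 0 < r /\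
         forall k ks, high_sym ks -> dist2 k ks < r -> paired_clusters m (al k) a)
  end.

Definition unif_conv (m : nat) (als : nat -> R2 -> Mat) (al : R2 -> Mat) : Prop :=
  forall e, 0 < e -> exists N, forall n, (N <= n)%nat -> forall k (v : Vec),
    vnorm m (mapply m (msub (als n k) (al k)) v) <= e * vnorm m v.

(* Main.v *)
(* The degenerate Hermitian matrices have codimension three: each of them has the form S^* B S, where
   S and B depend on three real parameters fewer than a Hermitian matrix. Together with the two
   parameters of a Lipschitz family this leaves codimension one, and a pigeonhole count on a fine
   grid yields an arbitrarily small constant matrix whose subtraction moves the whole family off the
   degenerate set. Where -mu is not an eigenvalue, the Cayley transform centred at mu turns unitary
   matrices into Hermitian ones.

   Away from the high-symmetry points a small cell of the torus is disjoint from its image under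
   k |-> -k, so the family can be corrected cell by cell, together with the mirror image; each
   correction is glued in by the Moebius interpolation between nearby unitary matrices, which
   commutes with the matching symmetry, and is so small that the cells treated before stay
   non-degenerate. Near the high-symmetry points an explicit model is glued in first: a constant
   symmetric matrix with simple spectrum in the bosonic case, and in the fermionic case a family
   whose Kramers pairs d, d split into d u(|k|), d u(-|k|), where u x = (1 + i x) / (1 - i x).
   Moebius interpolation followed by the given homotopy shows that a family close to a
   null-homotopic one is null-homotopic. *)

Require Import Defs.
From Stdlib Require Import Reals Arith.
From mathcomp Require all_boot all_order all_algebra.
From mathcomp Require boolp classical_sets functions reals topology normedtype.
From mathcomp Require complex Rstruct.
From mathcomp Require zify ring lra.
Open Scope R_scope.

(** Lipschitz continuity is what makes the parameter count valid: a merely continuous map of a cube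
    can fill a space of higher dimension. Hence the family is first replaced, inside a Cayley chart,
    by a Lipschitz one, and dimension enters only as the number of cells of a grid. Non-degeneracy
    is expressed by a discriminant built from traces of powers: it is continuous, so on compact sets
    it survives small changes, and no eigenvalue has to be followed.

    The symmetry is the obstacle. A constant shift in a chart does not respect it, and a single
    chart need not cover the family. Away from the fixed points of [k |-> -k] on the torus the
    constraint relates two different points, so a cell can be changed freely and its mirror image is
    then determined. At a fixed point the constraint falls on one matrix: it must be symmetric, or,
    for [J], its eigenvalues form Kramers pairs that no admissible change can separate. There the
    count for general Hermitian matrices says nothing; hence the explicit models, and cells that
    keep clear of the high-symmetry points. *)

Module GenericPosition.

Import all_boot all_order all_algebra.
Import boolp classical_sets functions reals topology normedtype.
Import complex Rstruct zify ring lra.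
Set Implicit Arguments.
Unset Strict Implicit.
Unset Printing Implicit Defensive.
Import Order.TTheory GRing.Theory Num.Theory Normc.
Local Open Scope ring_scope.
Local Open Scope sesquilinear_scope.
Local Notation Re := (@complex.Re _).
Local Notation Im := (@complex.Im _).

(** * Entrywise estimates for complex matrices *)

Section Norm.
Variable R : realType.
Local Notation C := R[i].
Implicit Types (x y z : C) (a b e : R).

Lemma normc_ge0 z : 0 <= normc z.
Proof. by case: z => a b; exact: sqrtr_ge0. Qed.

Lemma normcB x y : normc (x - y) = normc (y - x).
Proof. by rewrite -normcN opprB. Qed.

Lemma normc_triangle x y z : normc (x - z) <= normc (x - y) + normc (y - z).
Proof. by rewrite -[x - z](subrKA y); exact: le_normcD. Qed.

Lemma normcE0 z : (normc z == 0) = (z == 0).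
Proof. by apply/eqP/eqP => [/eq0_normc//|->]; rewrite normc0. Qed.

Lemma normc_gt0 z : (0 < normc z) = (z != 0).
Proof. by rewrite lt_neqAle normc_ge0 andbT eq_sym normcE0. Qed.

Lemma normc_conj z : normc z^* = normc z.
Proof. by case: z => a b /=; rewrite sqrrN. Qed.

Lemma normc_real a : normc a%:C%C = `|a|.
Proof. by rewrite /= expr0n addr0 sqrtr_sqr. Qed.

Lemma normc_i : normc ('i%C : C) = 1.
Proof. by rewrite /= expr0n add0r expr1n sqrtr1. Qed.

Lemma normc_nat n : normc (n%:R : C) = n%:R.
Proof.
rewrite -(rmorph_nat (real_complex R)) normc_real ger0_norm //.
Qed.

Lemma normc_sum I (r : seq I) (P : pred I) (F : I -> C) :
  normc (\sum_(i <- r | P i) F i) <= \sum_(i <- r | P i) normc (F i).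
Proof.
elim/big_ind2: _ => [|x a y b xa yb|//]; first by rewrite normc0.
by rewrite (le_trans (le_normcD _ _)) ?lerD.
Qed.

Lemma le_normc_Re z : `|Re z| <= normc z.
Proof. by case: z => a b /=; rewrite -sqrtr_sqr ler_wsqrtr // lerDl sqr_ge0. Qed.

Lemma le_normc_Im z : `|Im z| <= normc z.
Proof. by case: z => a b /=; rewrite -sqrtr_sqr ler_wsqrtr // lerDr sqr_ge0. Qed.

Lemma le_normc_ReIm z : normc z <= `|Re z| + `|Im z|.
Proof.
rewrite {1}[z]complexE (le_trans (le_normcD _ _)) // normcM normc_i mul1r.
by rewrite !normc_real.
Qed.

Lemma normc_sqr z : (normc z ^+ 2)%:C%C = z * z^*.
Proof.
case: z => a b /=; rewrite sqr_sqrtr ?addr_ge0 ?sqr_ge0 //.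
by apply/eqP; rewrite eq_complex /=; apply/andP; split; apply/eqP; ring.
Qed.

Lemma normc1_conj z : normc z = 1 -> z * z^* = 1.
Proof. by move=> z1; rewrite -normc_sqr z1 expr1n. Qed.

End Norm.

Section MaxNorm.
Variable R : realType.
Local Notation C := R[i].
Implicit Types (e a b : R).

(** The maximum norm as a predicate: no maximum has to be formed and empty matrices need no
    exception. The price is the factor [n] in [mleM]. *)
Definition mle m n e (A : 'M[C]_(m, n)) := forall i j, normc (A i j) <= e.

Lemma mle_le m n e e' (A : 'M[C]_(m, n)) : e <= e' -> mle e A -> mle e' A.
Proof. by move=> ee' hA i j; apply: le_trans ee'. Qed.

Lemma mleD m n a b (A B : 'M[C]_(m, n)) : mle a A -> mle b B -> mle (a + b) (A + B).
Proof. by move=> hA hB i j; rewrite mxE (le_trans (le_normcD _ _)) // lerD. Qed.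

Lemma mleN m n a (A : 'M[C]_(m, n)) : mle a A -> mle a (- A).
Proof. by move=> hA i j; rewrite mxE normcN. Qed.

Lemma mleB m n a b (A B : 'M[C]_(m, n)) : mle a A -> mle b B -> mle (a + b) (A - B).
Proof. by move=> hA hB; apply: mleD => //; apply: mleN. Qed.

Lemma mleBC m n a (A B : 'M[C]_(m, n)) : mle a (A - B) -> mle a (B - A).
Proof. by move=> h; rewrite -opprB; apply: mleN. Qed.

Lemma mle_triangle m n a b (A B D : 'M[C]_(m, n)) :
  mle a (A - B) -> mle b (B - D) -> mle (a + b) (A - D).
Proof. by move=> hA hB; rewrite -[A - D](subrKA B); apply: mleD. Qed.

Lemma mleZ m n a (A : 'M[C]_(m, n)) (z : C) : mle a A -> mle (normc z * a) (z *: A).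
Proof. by move=> hA i j; rewrite mxE normcM ler_wpM2l ?normc_ge0. Qed.

Lemma mleM m n p a b (A : 'M[C]_(m, n)) (B : 'M[C]_(n, p)) :
  mle a A -> mle b B -> mle (n%:R * (a * b)) (A *m B).
Proof.
move=> hA hB i j; rewrite mxE (le_trans (normc_sum _ _ _)) //.
apply: (@le_trans _ _ (\sum_(k < n) a * b)); last first.
  by rewrite sumr_const card_ord mulr_natl.
apply: ler_sum => k _; rewrite normcM ler_pM ?normc_ge0 //.
Qed.

Lemma mle_tr m n a (A : 'M[C]_(m, n)) : mle a A -> mle a A^T.
Proof. by move=> hA i j; rewrite mxE. Qed.

Lemma mle_adj m n a (A : 'M[C]_(m, n)) : mle a A -> mle a (A^t*).
Proof. by move=> hA i j; rewrite !mxE normc_conj. Qed.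

(* The largest entry of a fixed vector of [E] would be smaller than itself. *)
Lemma small_unitmx m a (E : 'M[C]_m) : mle a E -> m%:R * a < 1 -> 1%:M + E \in unitmx.
Proof.
case: m E => [|m] E hE ha; first by rewrite unitmxE det_mx00 unitr1.
rewrite -row_free_unit -kermx_eq0; apply/eqP/row_matrixP => i; rewrite row0.
set v := row i _; have: v *m (1%:M + E) = 0 by rewrite -row_mul mulmx_ker row0.
rewrite mulmxDr mulmx1 => /eqP; rewrite addr_eq0 => /eqP vE.
pose j0 := [arg max_(j > ord0) normc (v 0 j)]%O.
have hj0 j : normc (v 0 j) <= normc (v 0 j0).
  by rewrite /j0; case: arg_maxP => // k _ /(_ j); apply.
have: mle (m.+1%:R * (normc (v 0 j0) * a)) (v *m E).
  by apply: mleM => // i' j; rewrite ord1.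
move=> /mleN; rewrite -vE => /(_ 0 j0); rewrite mulrCA => h.
have v0 : normc (v 0 j0) = 0.
  apply/eqP; rewrite eq_le normc_ge0 andbT leNgt; apply/negP => p.
  by move: (h); rewrite leNgt gtr_pMr // ha.
apply/rowP => j; rewrite [RHS]mxE; apply: eq0_normc; apply/eqP.
by rewrite eq_le normc_ge0 -[leRHS]v0 hj0.
Qed.

Lemma unitarymx_mle m n (U : 'M[C]_(m, n)) : U \is unitarymx -> mle 1 U.
Proof.
move=> /unitarymxP hU i j; have /matrixP/(_ i i) := hU; rewrite !mxE eqxx.
under eq_bigr => k _ do rewrite !mxE -normc_sqr.
rewrite -(rmorph_sum (real_complex R)) => -[] s1.
rewrite -(ler_pXn2r (n := 2)) ?nnegrE ?normc_ge0 // expr1n -s1 (bigD1 j) //=.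
by rewrite lerDl sumr_ge0 // => k _; rewrite exprn_ge0 ?normc_ge0.
Qed.

End MaxNorm.

(** * Discriminant and simple spectrum *)

Section Discriminant.
Variable R : realType.
Local Notation C := R[i].

(* For diagonalizable [A] this is the squared Vandermonde determinant of the eigenvalues. *)
Definition disc m (A : 'M[C]_m) : C := \det (\matrix_(i < m, j < m) \tr (A ^+ (i + j))).

Lemma unitarymx_adjK m (V : 'M[C]_m) : V \is unitarymx -> V^t* *m V = 1%:M.
Proof. by move=> hV; apply: mulmx1C; apply/unitarymxP. Qed.

Lemma exp_conjmx m (V D : 'M[C]_m) n :
  V \is unitarymx -> (V *m D *m V^t*) ^+ n = V *m D ^+ n *m V^t*.
Proof.
move=> hV; elim: n => [|n IH]; first by rewrite !expr0 mulmx1; apply/esym/unitarymxP.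
by rewrite !exprS IH -!mulmxE !mulmxA -[X in X *m _ *m _]mulmxA unitarymx_adjK // mulmx1.
Qed.

Lemma diag_mxX m (d : 'rV[C]_m) n : diag_mx d ^+ n = diag_mx (\row_j d 0 j ^+ n).
Proof.
elim: n => [|n IH].
  rewrite expr0 -[LHS]/(1%:M) -diag_const_mx; congr diag_mx; apply/rowP => j.
  by rewrite !mxE expr0.
rewrite exprS IH -mulmxE mulmx_diag; congr diag_mx; apply/rowP => j.
by rewrite !mxE exprS.
Qed.

Lemma disc_diag m (V : 'M[C]_m) (d : 'rV[C]_m) : V \is unitarymx ->
  disc (V *m diag_mx d *m V^t*) =
  (\prod_(i < m) \prod_(j < m | (i < j)%N) (d 0 j - d 0 i)) ^+ 2.
Proof.
move=> hV; rewrite -det_Vandermonde expr2 -{2}det_tr -det_mulmx /disc.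
congr (\det _); apply/matrixP => i j; rewrite !mxE exp_conjmx // diag_mxX.
rewrite -mulmxA mxtrace_mulC -mulmxA unitarymx_adjK // mulmx1 mxtrace_diag.
by apply: eq_bigr => k _; rewrite !mxE exprD.
Qed.

(** A Vandermonde determinant vanishes exactly when two nodes agree. Simplicity of the spectrum thus
    becomes a continuous, hence open, condition on the matrix that mentions no eigenvalue. *)
Lemma disc_neq0 m (V : 'M[C]_m) (d : 'rV[C]_m) : V \is unitarymx ->
  disc (V *m diag_mx d *m V^t*) != 0 <-> injective (d 0).
Proof.
move=> hV; rewrite disc_diag // sqrf_eq0; split=> [|inj].
  move/prodf_neq0 => h.
  suff lt_neq (i j : 'I_m) : (i < j)%N -> d 0 i != d 0 j.
    move=> i j dij; apply/val_inj; case: (ltngtP i j) => // ij.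
      by move: (lt_neq _ _ ij); rewrite dij eqxx.
    by move: (lt_neq _ _ ij); rewrite dij eqxx.
  move=> ij; have /prodf_neq0 /(_ j) := h i isT.
  by rewrite ij subr_eq0 eq_sym; apply.
apply/prodf_neq0 => i _; apply/prodf_neq0 => j ij; rewrite subr_eq0.
by apply: contraTneq ij => /inj ->; rewrite ltnn.
Qed.

Lemma unitarymx_normal m (U : 'M[C]_m) : U \is unitarymx -> U \is normalmx.
Proof. by move=> hU; apply/normalmxP; rewrite unitarymx_adjK //; apply/unitarymxP. Qed.

Lemma normalmx_diag m (A : 'M[C]_m) : A \is normalmx ->
  exists (V : 'M[C]_m) (d : 'rV_m), V \is unitarymx /\ A = V *m diag_mx d *m V^t*.
Proof.
move=> /orthomx_spectralP hA; pose P : 'M[C]_m := spectralmx A.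
exists (P^t*), (spectral_diag A).
rewrite trmxC_unitary spectral_unitarymx; split=> //.
by rewrite trmxCK {1}hA invmx_unitary // spectral_unitarymx.
Qed.

End Discriminant.

(** * Entrywise limits of matrix-valued functions *)

Section Limits.
Variable R : realType.
Local Notation C := R[i].
Variables (X : Type) (N : R -> X -> Prop).
Hypothesis Nle : forall d d' x, d <= d' -> N d x -> N d' x.

(* [N d x] reads: [x] lies in the basic neighbourhood of size [d] of the limit point. *)
Definition tendsto (f : X -> C) (l : C) :=
  forall e, 0 < e -> exists2 d, 0 < d & forall x, N d x -> normc (f x - l) < e.

Definition tendsto_mx m n (F : X -> 'M[C]_(m, n)) (L : 'M[C]_(m, n)) :=
  forall i j, tendsto (fun x => F x i j) (L i j).

Lemma tendsto_cst c : tendsto (fun=> c) c.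
Proof. by move=> e e0; exists 1 => // x _; rewrite subrr normc0. Qed.

Lemma tendsto_ext f g l : (exists2 d, 0 < d & forall x, N d x -> f x = g x) ->
  tendsto f l -> tendsto g l.
Proof.
move=> [d0 d00 fg] hf e /hf [d d_gt0 hd]; exists (Num.min d0 d).
  by rewrite lt_min d00.
move=> x Nx; rewrite -fg; first by apply: hd; apply: Nle Nx; rewrite ge_min lexx orbT.
by apply: Nle Nx; rewrite ge_min lexx.
Qed.

Lemma tendsto2 f g l k e e' : 0 < e -> 0 < e' -> tendsto f l -> tendsto g k ->
  exists2 d, 0 < d & forall x, N d x -> normc (f x - l) < e /\ normc (g x - k) < e'.
Proof.
move=> e0 e'0 /(_ e e0) [d d0 hd] /(_ e' e'0) [d' d'0 hd'].
exists (Num.min d d'); first by rewrite lt_min d0.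
move=> x Nx; split; [apply: hd|apply: hd']; apply: Nle Nx.
  by rewrite ge_min lexx.
by rewrite ge_min lexx orbT.
Qed.

Lemma tendstoD f g l k : tendsto f l -> tendsto g k -> tendsto (fun x => f x + g x) (l + k).
Proof.
move=> hf hg e e0; have e2 : 0 < e / 2 by rewrite divr_gt0.
have [d d0 hd] := tendsto2 e2 e2 hf hg; exists d => // x /hd [h1 h2].
by rewrite opprD addrACA (le_lt_trans (le_normcD _ _)) // [ltRHS](splitr e) ltrD.
Qed.

Lemma tendstoM f g l k : tendsto f l -> tendsto g k -> tendsto (fun x => f x * g x) (l * k).
Proof.
move=> hf hg e e0; pose K := 1 + normc l + normc k.
have K0 : 0 < K by rewrite /K; have := normc_ge0 l; have := normc_ge0 k; lra.
have m0 : 0 < Num.min 1 (e / K) by rewrite lt_min ltr01 divr_gt0.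
have [d d0 hd] := tendsto2 m0 m0 hf hg; exists d => // x /hd [].
rewrite !lt_min => /andP[f1 f2] /andP[g1 g2].
have -> : f x * g x - l * k = (f x - l) * (g x - k) + (f x - l) * k + l * (g x - k) by ring.
rewrite (le_lt_trans (le_normcD _ _)) //.
rewrite (le_lt_trans (lerD (le_normcD _ _) (lexx _))) // !normcM.
apply: (@le_lt_trans _ _ (normc (f x - l) * (1 + normc k) + normc l * normc (g x - k))).
  rewrite lerD2r mulrDr lerD2r ler_wpM2l ?normc_ge0 //; lra.
have -> : e = (e / K) * (1 + normc k) + normc l * (e / K).
  by rewrite /K; field; rewrite -/K gt_eqF.
apply: ltr_leD; first by rewrite ltr_pM2r //; have := normc_ge0 k; lra.
by rewrite ler_wpM2l ?normc_ge0 // ltW.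
Qed.

Lemma tendstoN f l : tendsto f l -> tendsto (fun x => - f x) (- l).
Proof.
move=> hf e /hf [d d0 hd]; exists d => // x /hd; by rewrite -opprD normcN.
Qed.

Lemma tendsto_conj f l : tendsto f l -> tendsto (fun x => (f x)^*) (l^*).
Proof.
move=> hf e /hf [d d0 hd]; exists d => // x /hd.
by rewrite -(rmorphB (@Num.conj C)) normc_conj.
Qed.

Lemma tendsto_neq0 f l : l != 0 -> tendsto f l ->
  exists2 d, 0 < d & forall x, N d x -> normc l / 2 < normc (f x).
Proof.
move=> l0 hf; have e0 : 0 < normc l / 2 by rewrite divr_gt0 ?normc_gt0.
have [d d0 hd] := hf _ e0; exists d => // x /hd h.
have := normc_triangle l (f x) 0; rewrite !subr0 normcB; lra.
Qed.

Lemma tendstoV f l : l != 0 -> tendsto f l -> tendsto (fun x => (f x)^-1) l^-1.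
Proof.
move=> l0 hf e e0; have nl : 0 < normc l by rewrite normc_gt0.
have [d d0 hd] := tendsto_neq0 l0 hf.
have e1 : 0 < e * (normc l / 2 * normc l) by rewrite !mulr_gt0 // invr_gt0 ltr0n.
have [d' d'0 hd'] := hf _ e1.
exists (Num.min d d'); first by rewrite lt_min d0.
move=> x Nx; have h1 : normc l / 2 < normc (f x).
  by apply: hd; apply: Nle Nx; rewrite ge_min lexx.
have h2 : normc (f x - l) < e * (normc l / 2 * normc l).
  by apply: hd'; apply: Nle Nx; rewrite ge_min lexx orbT.
have nf : 0 < normc (f x) by apply: lt_trans h1; rewrite divr_gt0.
have f0 : f x != 0 by rewrite -normc_gt0.
have -> : (f x)^-1 - l^-1 = - (f x - l) / (f x * l) by field; rewrite f0 l0.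
rewrite normcM normcN normcV normcM ltr_pdivrMr ?mulr_gt0 //.
by apply: lt_le_trans h2 _; rewrite ler_pM2l // ler_pM2r // ltW.
Qed.

Lemma tendsto_sum I (r : seq I) (P : pred I) (F : I -> X -> C) L :
  (forall i, P i -> tendsto (F i) (L i)) ->
  tendsto (fun x => \sum_(i <- r | P i) F i x) (\sum_(i <- r | P i) L i).
Proof.
move=> h; elim: r => [|i r IH].
  by rewrite big_nil; under eq_fun do rewrite big_nil; exact: tendsto_cst.
rewrite big_cons; under eq_fun do rewrite big_cons.
by case: ifP => // Pi; apply: tendstoD => //; apply: h.
Qed.

Lemma tendsto_prod I (r : seq I) (P : pred I) (F : I -> X -> C) L :
  (forall i, P i -> tendsto (F i) (L i)) ->
  tendsto (fun x => \prod_(i <- r | P i) F i x) (\prod_(i <- r | P i) L i).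
Proof.
move=> h; elim: r => [|i r IH].
  by rewrite big_nil; under eq_fun do rewrite big_nil; exact: tendsto_cst.
rewrite big_cons; under eq_fun do rewrite big_cons.
by case: ifP => // Pi; apply: tendstoM => //; apply: h.
Qed.

Lemma tendsto_mx_cst m n (A : 'M[C]_(m, n)) : tendsto_mx (fun=> A) A.
Proof. by move=> i j; exact: tendsto_cst. Qed.

Lemma tendsto_mxD m n F G (K L : 'M[C]_(m, n)) :
  tendsto_mx F K -> tendsto_mx G L -> tendsto_mx (fun x => F x + G x) (K + L).
Proof.
move=> hF hG i j; rewrite mxE; under eq_fun do rewrite mxE.
exact: tendstoD.
Qed.

Lemma tendsto_mxN m n F (K : 'M[C]_(m, n)) :
  tendsto_mx F K -> tendsto_mx (fun x => - F x) (- K).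
Proof.
move=> hF i j; rewrite mxE; under eq_fun do rewrite mxE; exact: tendstoN.
Qed.

Lemma tendsto_mxZ m n f F c (K : 'M[C]_(m, n)) :
  tendsto f c -> tendsto_mx F K -> tendsto_mx (fun x => f x *: F x) (c *: K).
Proof.
move=> hf hF i j; rewrite mxE; under eq_fun do rewrite mxE; exact: tendstoM.
Qed.

Lemma tendsto_mxM m n p F G (K : 'M[C]_(m, n)) (L : 'M[C]_(n, p)) :
  tendsto_mx F K -> tendsto_mx G L -> tendsto_mx (fun x => F x *m G x) (K *m L).
Proof.
move=> hF hG i j; rewrite mxE; under eq_fun do rewrite mxE.
by apply: tendsto_sum => k _; apply: tendstoM.
Qed.

Lemma tendsto_mx_tr m n F (K : 'M[C]_(m, n)) :
  tendsto_mx F K -> tendsto_mx (fun x => (F x)^T) K^T.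
Proof. by move=> hF i j; rewrite mxE; under eq_fun do rewrite mxE; exact: hF. Qed.

Lemma tendsto_mx_adj m n F (K : 'M[C]_(m, n)) :
  tendsto_mx F K -> tendsto_mx (fun x => (F x)^t*) (K^t*).
Proof.
move=> hF i j; rewrite !mxE; under eq_fun do rewrite !mxE; exact: tendsto_conj.
Qed.

Lemma tendsto_det m F (K : 'M[C]_m) :
  tendsto_mx F K -> tendsto (fun x => \det (F x)) (\det K).
Proof.
move=> hF; apply: tendsto_sum => s _; apply: tendstoM; first exact: tendsto_cst.
by apply: tendsto_prod => i _; exact: hF.
Qed.

(** Cramer's rule makes each entry of the inverse a quotient of determinants. [invmx] obeys it only
    where the determinant is non-zero, hence the passage through [tendsto_ext]. *)
Lemma tendsto_mxV m F (K : 'M[C]_m) : K \in unitmx ->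
  tendsto_mx F K -> tendsto_mx (fun x => invmx (F x)) (invmx K).
Proof.
move=> hK hF i j.
have K0 : \det K != 0 by move: hK; rewrite unitmxE unitfE.
have hdet := tendsto_det hF; have [d d0 hd] := tendsto_neq0 K0 hdet.
have invE (A : 'M[C]_m) : \det A != 0 -> (\det A)^-1 * cofactor A j i = invmx A i j.
  by rewrite /invmx unitmxE unitfE => ->; rewrite [RHS]mxE [\adj A i j]mxE.
rewrite -(invE K K0); apply: (@tendsto_ext (fun x => (\det (F x))^-1 * cofactor (F x) j i)).
  exists d => // x /hd h; apply: invE.
  by rewrite -normc_gt0 (lt_trans _ h) // divr_gt0 ?normc_gt0 ?ltr0n.
apply: tendstoM; first exact: tendstoV.
apply: tendstoM; first exact: tendsto_cst.
apply: tendsto_det => a b; rewrite !mxE; under eq_fun do rewrite !mxE; exact: hF.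
Qed.

Lemma tendsto_mxX m n F (K : 'M[C]_m) :
  tendsto_mx F K -> tendsto_mx (fun x => F x ^+ n) (K ^+ n).
Proof.
move=> hF; elim: n => [|n IH].
  by rewrite expr0; under eq_fun do rewrite expr0; exact: tendsto_mx_cst.
rewrite exprS; under eq_fun do rewrite exprS; exact: tendsto_mxM.
Qed.

Lemma tendsto_disc m F (K : 'M[C]_m) :
  tendsto_mx F K -> tendsto (fun x => disc (F x)) (disc K).
Proof.
move=> hF; apply: tendsto_det => i j; rewrite mxE; under eq_fun do rewrite mxE.
by apply: tendsto_sum => k _; apply: tendsto_mxX.
Qed.

Lemma near_forall (I : finType) (P : I -> X -> Prop) :
  (forall i, exists2 d, 0 < d & forall x, N d x -> P i x) ->
  exists2 d, 0 < d & forall x, N d x -> forall i, P i x.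
Proof.
move=> h; suff [d d0 hd] : exists2 d, 0 < d &
    forall x, N d x -> forall i, i \in enum I -> P i x.
  by exists d => // x /hd hx i; apply: hx; rewrite mem_enum.
elim: (enum I) => [|i s [d d0 hd]]; first by exists 1.
have [d' d'0 hd'] := h i; exists (Num.min d d'); first by rewrite lt_min d0.
move=> x Nx j; rewrite inE => /orP[/eqP->|].
  by apply: hd'; apply: Nle Nx; rewrite ge_min lexx orbT.
by apply: hd; apply: Nle Nx; rewrite ge_min lexx.
Qed.

Lemma tendsto_mxP m n F (K : 'M[C]_(m, n)) :
  tendsto_mx F K <->
  forall e, 0 < e -> exists2 d, 0 < d & forall x, N d x -> mle e (F x - K).
Proof.
split=> [hF e e0|hF i j e e0]; last first.
  have [|d d0 hd] := hF (e / 2); first by rewrite divr_gt0.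
  by exists d => // x /hd /(_ i j); rewrite !mxE; lra.
have [|d d0 hd] := @near_forall ('I_m * 'I_n)%type
    (fun ij x => normc ((F x - K) ij.1 ij.2) <= e).
  move=> [i j]; have [d d0 hd] := hF i j e e0; exists d => // x /hd.
  by rewrite !mxE => /ltW.
by exists d => // x /hd h i j; exact: (h (i, j)).
Qed.

End Limits.

(** * Moebius interpolation and the matching symmetry *)

Section Moebius.
Variable R : realType.
Local Notation C := R[i].
Variable m : nat.
Implicit Types (A B U : 'M[C]_m) (t : R).

Definition mob_num t A B : 'M[C]_m := (1 + t)%:C%C *: B + (1 - t)%:C%C *: A.
Definition mob_den t A B : 'M[C]_m := (1 - t)%:C%C *: B + (1 + t)%:C%C *: A.

(* With [B = A V] this is [A ((1 + t) V + (1 - t)) ((1 - t) V + (1 + t))^-1]: in the Cayley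
   chart of [V] the straight path from [1] to [V], rewritten with a single inverse. *)
Definition mob t A B : 'M[C]_m := mob_num t A B *m invmx (mob_den t A B) *m A.

Lemma unitarymx_mul_adj U : U \is unitarymx -> U *m U^t* = 1%:M.
Proof. by move/unitarymxP. Qed.

Lemma unitarymx_adj_unitary U : U \is unitarymx -> U^t* \is unitarymx.
Proof. by rewrite trmxC_unitary. Qed.

Lemma unitarymx_of_adj U : U^t* *m U = 1%:M -> U \is unitarymx.
Proof. by move=> h; apply/unitarymxP; apply: mulmx1C. Qed.

Lemma adj_mul n p q (U : 'M[C]_(n, p)) (V : 'M[C]_(p, q)) : (U *m V)^t* = V^t* *m U^t*.
Proof. by rewrite trmx_mul map_mxM. Qed.

Lemma adj_lin (a b : R) A B :
  (a%:C%C *: A + b%:C%C *: B)^t* = a%:C%C *: A^t* + b%:C%C *: B^t*.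
Proof.
apply/matrixP => i j; rewrite !mxE rmorphD !rmorphM; congr (_ * _ + _ * _); exact: conjc_real.
Qed.

(** Near [A] the denominator is [2 A] up to a left factor close to [1]. With [m ^ 2 * e <= 1] the
    quantity that [small_unitmx] wants below [1] is at most [1 / 2]. *)
Lemma mob_den_unit t A B e : 0 <= t <= 1 -> A \is unitarymx ->
  mle e (B - A) -> m%:R ^+ 2 * e <= 1 -> mob_den t A B \in unitmx.
Proof.
move=> /andP[t0 t1] hA hAB he; have AU := unitarymx_unit hA.
have -> : mob_den t A B =
    (2 : C) *: ((1%:M + ((1 - t) / 2)%:C%C *: ((B - A) *m A^t*)) *m A).
  rewrite mulmxDl mul1mx -scalemxAl -mulmxA unitarymx_adjK // mulmx1.
  rewrite scalerDr scalerA /mob_den.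
  have -> : 2 * ((1 - t) / 2)%:C%C = (1 - t)%:C%C :> C.
    by rewrite -(rmorph_nat (real_complex R)) -rmorphM /= mulrC divfK ?pnatr_eq0.
  rewrite scalerBr addrCA -scalerBl; congr (_ + _ *: _).
  by rewrite -(rmorph_nat (real_complex R)) -rmorphB /=; congr (_%:C)%C; ring.
rewrite unitmxZ ?unitfE ?pnatr_eq0 // unitmx_mul AU andbT.
have [m0|m0] := posnP m; first by rewrite unitmxE; move: (1%:M + _); rewrite m0 => M; rewrite det_mx00 unitr1.
have mg : 0 < m%:R :> R by rewrite ltr0n.
have hM := mleM hAB (unitarymx_mle (unitarymx_adj_unitary hA)).
apply: small_unitmx (mleZ _ hM) _; rewrite normc_real ger0_norm; last first.
  by rewrite divr_ge0 // subr_ge0.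
have -> : m%:R * ((1 - t) / 2 * (m%:R * (e * 1))) = (1 - t) / 2 * (m%:R ^+ 2 * e) by ring.
have h0 : 0 <= (1 - t) / 2 by rewrite divr_ge0 ?subr_ge0.
by apply: le_lt_trans (ler_wpM2l h0 he) _; lra.
Qed.

Lemma mob0 A B : mob_den 0 A B \in unitmx -> mob 0 A B = A.
Proof.
move=> h; rewrite /mob; have -> : mob_num 0 A B = mob_den 0 A B.
  by rewrite /mob_num /mob_den addr0 subr0.
by rewrite mulmxV // mul1mx.
Qed.

Lemma mob1 A B : A \is unitarymx -> mob 1 A B = B.
Proof.
move=> hA; have AU := unitarymx_unit hA; rewrite /mob /mob_num /mob_den subrr.
have -> : (1 + 1 : R)%:C%C = 2 :> C by rewrite -[X in (1 + X)%:C%C]/(1 : R) -(rmorph_nat (real_complex R)).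
rewrite !scale0r addr0 add0r invmxZ ?unitmxZ ?unitfE ?pnatr_eq0 //.
rewrite -scalemxAl -scalemxAr scalerA divff ?pnatr_eq0 // scale1r.
by rewrite mulmxKV.
Qed.

(** The right-hand side does not change when [a] and [b] are exchanged. [mob_num] and [mob_den]
    differ by just this exchange, so they have the same [N^t* N] and their ratio is unitary. *)
Lemma adj_lin_sqr (a b : R) A B : A \is unitarymx -> B \is unitarymx ->
  (a%:C%C *: A + b%:C%C *: B)^t* *m (a%:C%C *: A + b%:C%C *: B) =
  (a ^+ 2 + b ^+ 2)%:C%C *: 1%:M + (a * b)%:C%C *: (A^t* *m B + B^t* *m A).
Proof.
move=> hA hB; rewrite adj_lin mulmxDl !mulmxDr.
rewrite -!(scalemxAl a%:C%C) -!(scalemxAl b%:C%C) -!(scalemxAr a%:C%C) -!(scalemxAr b%:C%C).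
rewrite !unitarymx_adjK //; move: (A^t* *m B) (B^t* *m A) 1%:M => {hA hB} X Y I.
have -> : (a ^+ 2 + b ^+ 2)%:C%C = a%:C%C * a%:C%C + b%:C%C * b%:C%C by rewrite !expr2 rmorphD !rmorphM.
have -> : (a * b)%:C%C = a%:C%C * b%:C%C by rewrite rmorphM.
move: (a%:C)%C (b%:C)%C => u v.
apply/matrixP => i j.
rewrite !mxE.
move: (X i j) (Y i j) (I i j) => x y z.
ring.
Qed.

Lemma unitarymx_ratio (N D : 'M[C]_m) : N^t* *m N = D^t* *m D -> D \in unitmx ->
  N *m invmx D \is unitarymx.
Proof.
move=> ND hD; apply: unitarymx_of_adj; rewrite adj_mul -mulmxA (mulmxA (N^t*)) ND.
by rewrite -(mulmxA (D^t*)) (mulmxV hD) mulmx1 -adj_mul (mulmxV hD) trmx1 map_mx1.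
Qed.

Lemma mob_unitary_factor t A B : A \is unitarymx -> B \is unitarymx ->
  mob_den t A B \in unitmx -> mob_num t A B *m invmx (mob_den t A B) \is unitarymx.
Proof.
move=> hA hB; apply: unitarymx_ratio.
apply: etrans (adj_lin_sqr (1 + t) (1 - t) hB hA) _.
apply/esym; apply: etrans (adj_lin_sqr (1 - t) (1 + t) hB hA) _.
by rewrite (addrC ((1 - t) ^+ 2)) (mulrC (1 - t)).
Qed.

End Moebius.

Section MoebiusMore.
Variable R : realType.
Local Notation C := R[i].
Variable m : nat.
Implicit Types (A B U : 'M[C]_m) (t : R).

Lemma mob_unitary t A B : A \is unitarymx -> B \is unitarymx ->
  mob_den t A B \in unitmx -> mob t A B \is unitarymx.
Proof. by move=> hA hB hD; exact: (mul_unitarymx (mob_unitary_factor hA hB hD) hA). Qed.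

Lemma mob_close t A B e : 0 <= t <= 1 -> A \is unitarymx -> B \is unitarymx ->
  mle e (B - A) -> mob_den t A B \in unitmx -> mle ((1 + m%:R) * e) (mob t A B - A).
Proof.
move=> /andP[t0 t1] hA hB hAB hD.
have hW := mob_unitary_factor hA hB hD; set W := _ *m _ in hW.
have WD : W *m mob_den t A B = mob_num t A B by rewrite /W mulmxKV.
have -> : mob t A B - A = (W - 1%:M) *m A by rewrite mulmxBl mul1mx.
(* Subtract [D] from [W D = N], where [D = 2 A + (1 - t) (B - A)] is the denominator. Unitarity
   bounds the entries of [W - 1] by [2], so no estimate of [invmx] is required. *)
have key : (2 : C) *: ((W - 1%:M) *m A) =
    (2 : C) *: (t%:C%C *: (B - A)) - (1 - t)%:C%C *: ((W - 1%:M) *m (B - A)).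
  have : (W - 1%:M) *m mob_den t A B = mob_num t A B - mob_den t A B by rewrite mulmxBl WD mul1mx.
  have -> : mob_num t A B - mob_den t A B = (2 : C) *: (t%:C%C *: (B - A)).
    apply/matrixP => i j; rewrite !mxE !rmorphD !rmorphN /= rmorph1; ring.
  have -> : mob_den t A B = (2 : C) *: A + (1 - t)%:C%C *: (B - A).
    apply/matrixP => i j; rewrite !mxE !rmorphD !rmorphN /= rmorph1; ring.
  by rewrite mulmxDr -!scalemxAr => <-; rewrite addrK.
have hW1 : mle (1 + 1) (W - 1%:M).
  apply: mleB; first exact: unitarymx_mle.
  by apply: unitarymx_mle; apply/unitarymxP; rewrite trmx1 map_mx1 mulmx1.
have e0 (i j : 'I_m) : 0 <= e by exact: le_trans (normc_ge0 _) (hAB i j).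
move=> i j; have e_ge0 := e0 i j.
have := mleB (mleZ 2 (mleZ t%:C%C hAB)) (mleZ (1 - t)%:C%C (mleM hW1 hAB)).
rewrite -key => /(_ i j); rewrite mxE normcM normc_nat !normc_real.
rewrite !ger0_norm ?subr_ge0 //.
have ye : 0 <= t * (m%:R * e) by rewrite !mulr_ge0.
have te : t * e <= e by rewrite ler_piMl.
move: (normc _) => x; have -> : (1 - t) * (m%:R * ((1 + 1) * e)) =
  2 * (m%:R * e) - 2 * (t * (m%:R * e)) by ring.
rewrite (mulrDl 1 _ e) mul1r; move: ye; move: (t * (m%:R * e)) => z; move: (m%:R * e) (t * e) te => y w.
clear; lra.
Qed.

Lemma mob_tendsto X (N : R -> X -> Prop) (hN : forall d d' x, d <= d' -> N d x -> N d' x)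
  (s : X -> R) (F G : X -> 'M[C]_m) t A B :
  tendsto N (fun x => (s x)%:C%C) t%:C%C -> tendsto_mx N F A -> tendsto_mx N G B ->
  mob_den t A B \in unitmx -> tendsto_mx N (fun x => mob (s x) (F x) (G x)) (mob t A B).
Proof.
move=> hs hF hG hD.
have h1 : tendsto N (fun x => (1 + s x)%:C%C) (1 + t)%:C%C.
  by rewrite rmorphD; under eq_fun do rewrite rmorphD; apply: tendstoD => //; exact: tendsto_cst.
have h2 : tendsto N (fun x => (1 - s x)%:C%C) (1 - t)%:C%C.
  rewrite rmorphB; under eq_fun do rewrite rmorphB.
  by apply: tendstoD => //; [exact: tendsto_cst|exact: tendstoN].
apply: tendsto_mxM => //; apply: tendsto_mxM => //.
  by apply: tendsto_mxD => //; apply: tendsto_mxZ.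
by apply: tendsto_mxV => //; apply: tendsto_mxD => //; apply: tendsto_mxZ.
Qed.

(** [twist] reverses products and so moves the outer factor [A] of [mob] to the front; this brings
    it back. *)
Lemma mob_comm t A B : A \in unitmx -> mob_den t A B \in unitmx ->
  A *m (invmx (mob_den t A B) *m mob_num t A B) = mob_num t A B *m invmx (mob_den t A B) *m A.
Proof.
move=> hA; have [V BV] : exists V, B = A *m V by exists (invmx A *m B); rewrite mulKVmx.
pose D := (1 - t)%:C%C *: V + (1 + t)%:C%C *: 1%:M.
pose N := (1 + t)%:C%C *: V + (1 - t)%:C%C *: 1%:M.
have -> : mob_den t A B = A *m D by rewrite /D mulmxDr -!scalemxAr mulmx1 -BV.
have -> : mob_num t A B = A *m N by rewrite /N mulmxDr -!scalemxAr mulmx1 -BV.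
have DN : D *m N = N *m D.
  rewrite /D /N !mulmxDl !mulmxDr -!scalemxAl -!scalemxAr !mulmx1 !mul1mx !scalerA.
  move: (V *m V) (1 - t)%:C%C (1 + t)%:C%C => W u v.
  by apply/matrixP => i j; rewrite !mxE; ring.
rewrite unitmx_mul => /andP[_ hD].
have -> : invmx (A *m D) = invmx D *m invmx A.
  have hAD : A *m D \in unitmx by rewrite unitmx_mul hA.
  by apply: (can_inj (mulKmx hAD)); rewrite (mulmxV hAD) mulmxA (mulmxK hD) (mulmxV hA).
have DV : invmx D *m N = N *m invmx D.
  by apply: (can_inj (mulKmx hD)); rewrite mulmxA (mulmxV hD) mul1mx mulmxA DN (mulmxK hD).
by rewrite -!mulmxA (mulKmx hA) (mulVmx hA) mulmx1 DV.
Qed.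

End MoebiusMore.

(** * The matching symmetry, with sign [s = 1] for bosons and [s = -1] for fermions *)

Section Twist.
Variable R : realType.
Local Notation C := R[i].
Variable m : nat.
Variables (E : 'M[C]_m) (s : C).
Hypothesis hE : E \is unitarymx.
Hypothesis Etr : E^T = s *: E.
Hypothesis s_sqr : s * s = 1.
Implicit Types (A B U : 'M[C]_m) (t : R).

(* Matching families are those with [al k = twist (al (- k))]. *)
Definition twist A : 'M[C]_m := E^t* *m A^T *m E.

Lemma twistM A B : twist (A *m B) = twist B *m twist A.
Proof.
by rewrite /twist trmx_mul !mulmxA -[X in _ = X *m _ *m _]mulmxA (unitarymx_mul_adj hE) mulmx1.
Qed.

Lemma twistK A : twist (twist A) = A.
Proof.
rewrite /twist; move: (unitarymx_mul_adj hE) (unitarymx_adjK hE).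
move: (E^t*) => F EF FE; have FtrE : F^T *m E = s%:M.
  have := congr1 trmx EF; rewrite trmx_mul Etr trmx1 -scalemxAr.
  by move=> /(congr1 ( *:%R s)); rewrite scalerA s_sqr scale1r scale_scalar_mx mulr1.
rewrite !trmx_mul Etr trmxK -!mulmxA FtrE -!scalemxAl -scalemxAr.
by rewrite (mulmxA F E) FE mul1mx mul_mx_scalar scalerA s_sqr scale1r.
Qed.

Lemma twistD A B : twist (A + B) = twist A + twist B.
Proof. by rewrite /twist linearD /= mulmxDr mulmxDl. Qed.

Lemma twistZ z A : twist (z *: A) = z *: twist A.
Proof. by rewrite /twist linearZ /= -scalemxAr -scalemxAl. Qed.

Lemma twistB A B : twist (A - B) = twist A - twist B.
Proof. by rewrite twistD -scaleN1r twistZ scaleN1r. Qed.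

Lemma twist1 : twist 1%:M = 1%:M.
Proof. by rewrite /twist trmx1 mulmx1 unitarymx_adjK. Qed.

Lemma twist_unitary A : A \is unitarymx -> twist A \is unitarymx.
Proof.
move=> hA; apply: mul_unitarymx hE; apply: mul_unitarymx (unitarymx_adj_unitary hE) _.
by rewrite trmx_unitary.
Qed.

Lemma twist_unit A : A \in unitmx -> twist A \in unitmx.
Proof.
move=> hA; rewrite /twist unitmx_mul (unitarymx_unit hE) unitmx_mul unitmx_tr hA.
by rewrite (unitarymx_unit (unitarymx_adj_unitary hE)).
Qed.

Lemma twistV A : A \in unitmx -> twist (invmx A) = invmx (twist A).
Proof.
move=> hA; apply: (can_inj (mulKmx (twist_unit hA))).
by rewrite (mulmxV (twist_unit hA)) -twistM (mulVmx hA) twist1.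
Qed.

Lemma twist_mle a A : mle a A -> mle (m%:R * (m%:R * a)) (twist A).
Proof.
move=> hA; have e1 := unitarymx_mle hE.
have := mleM (mleM (mle_adj e1) (mle_tr hA)) e1.
by rewrite mul1r mulr1.
Qed.

Lemma twist_tendsto X (N : R -> X -> Prop) (hN : forall d d' x, d <= d' -> N d x -> N d' x)
  (F : X -> 'M[C]_m) A :
  tendsto_mx N F A -> tendsto_mx N (fun x => twist (F x)) (twist A).
Proof.
move=> hF; apply: tendsto_mxM (tendsto_mx_cst _ _) => //.
by apply: tendsto_mxM (tendsto_mx_cst _ _) (tendsto_mx_tr _).
Qed.

(* In terms of [B = A V] both sides are [A] times a function of [V], and these commute. *)
Lemma twist_mob t A B : A \is unitarymx -> mob_den t A B \in unitmx ->
  twist (mob t A B) = mob t (twist A) (twist B).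
Proof.
move=> hA hD; have AU := unitarymx_unit hA; rewrite /mob !twistM (twistV hD).
have -> : twist (mob_num t A B) = mob_num t (twist A) (twist B) by rewrite twistD !twistZ.
have -> : twist (mob_den t A B) = mob_den t (twist A) (twist B) by rewrite twistD !twistZ.
have hD' : mob_den t (twist A) (twist B) \in unitmx.
  have -> : mob_den t (twist A) (twist B) = twist (mob_den t A B) by rewrite twistD !twistZ.
  exact: twist_unit.
exact: mob_comm (twist_unit AU) hD'.
Qed.

End Twist.

(** * Matching families and their null-homotopies *)

Section Families.
Variable R : realType.
Local Notation C := R[i].
Local Notation K2 := (R * R)%type.
Variable m : nat.

Definition nbh (k : K2) (d : R) (k' : K2) := `|k'.1 - k.1| < d /\ `|k'.2 - k.2| < d.

Lemma nbh_le k d d' k' : d <= d' -> nbh k d k' -> nbh k d' k'.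
Proof. by move=> dd' [h1 h2]; split; apply: lt_le_trans dd'. Qed.

Definition opp2 (k : K2) : K2 := (- k.1, - k.2).

Lemma opp2K k : opp2 (opp2 k) = k.
Proof. by case: k => a b; rewrite /opp2 /= !opprK. Qed.

Lemma nbh_opp2 k d k' : nbh k d k' -> nbh (opp2 k) d (opp2 k').
Proof. by case; rewrite /nbh /= -!opprD !normrN. Qed.

Definition fam_cont (al : K2 -> 'M[C]_m) := forall k, tendsto_mx (nbh k) al (al k).

Definition periodic (T : Type) (f : K2 -> T) :=
  forall k, f (k.1 + 1, k.2) = f k /\ f (k.1, k.2 + 1) = f k.

Definition matching (E : 'M[C]_m) (al : K2 -> 'M[C]_m) :=
  [/\ fam_cont al, periodic al, forall k, al k \is unitarymx
    & forall k, al k = twist E (al (opp2 k))].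

(** Neighbourhoods relative to [[0, 1]]: nothing is required of a homotopy at times outside the
    interval. *)
Definition nbh2 (p : R * K2) (d : R) (x : R * K2) :=
  [/\ 0 <= x.1 <= 1, `|x.1 - p.1| < d & nbh p.2 d x.2].

Lemma nbh2_le p d d' x : d <= d' -> nbh2 p d x -> nbh2 p d' x.
Proof. by move=> dd' [? h1 h2]; split=> //; [exact: lt_le_trans dd'|exact: nbh_le h2]. Qed.

Definition null_homotopic (E : 'M[C]_m) (al : K2 -> 'M[C]_m) :=
  exists H : R -> K2 -> 'M[C]_m,
  [/\ forall t k, 0 <= t <= 1 -> tendsto_mx (nbh2 (t, k)) (fun x => H x.1 x.2) (H t k),
      forall t, 0 <= t <= 1 -> matching E (H t),
      forall k, H 0 k = al k & forall k, H 1 k = 1%:M].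

Lemma tendsto_real X (N : R -> X -> Prop) (f : X -> R) l :
  (forall e, 0 < e -> exists2 d, 0 < d & forall x, N d x -> `|f x - l| < e) ->
  tendsto N (fun x => (f x)%:C%C) l%:C%C.
Proof.
move=> h e /h [d d0 hd]; exists d => // x /hd.
by rewrite -rmorphB normc_real.
Qed.

Lemma tendsto_comp X Y (N : R -> X -> Prop) (N' : R -> Y -> Prop) (g : X -> Y) p q
    (F : Y -> 'M[C]_(p, q)) L :
  (forall e, 0 < e -> exists2 d, 0 < d & forall x, N d x -> N' e (g x)) ->
  tendsto_mx N' F L -> tendsto_mx N (fun x => F (g x)) L.
Proof.
move=> hg hF i j e e0; have [d d0 hd] := hF i j e e0; have [d' d'0 hd'] := hg _ d0.
by exists d' => // x /hd' /hd.
Qed.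

Lemma max0_lip (x y : R) : `|Num.max 0 x - Num.max 0 y| <= `|x - y|.
Proof.
case: (leP 0 x) => x0; case: (leP 0 y) => y0 //; rewrite ?subrr ?normr0 ?normr_ge0 //.
  by rewrite subr0 ger0_norm // ger0_norm; lra.
by rewrite sub0r normrN ger0_norm // ler0_norm; lra.
Qed.

Variables (E : 'M[C]_m) (s : C).
Hypothesis hE : E \is unitarymx.
Hypothesis Etr : E^T = s *: E.
Hypothesis s_sqr : s * s = 1.

Lemma null_homotopic_close al al' e : matching E al -> matching E al' ->
  (forall k, mle e (al' k - al k)) -> m%:R ^+ 2 * e <= 1 ->
  null_homotopic E al -> null_homotopic E al'.
Proof.
move=> [c p u tw] [c' p' u' tw'] hc he [H [Hc Hm H0 H1]].
have hD (t : R) k : 0 <= t <= 1 -> mob_den t (al k) (al' k) \in unitmx.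
  by move=> ht; exact: mob_den_unit ht (u k) (hc k) he.
pose f (t : R) : R := Num.max 0 (2 * t - 1); pose g (t : R) : R := Num.max 0 (1 - 2 * t).
have f01 (t : R) : 0 <= t <= 1 -> 0 <= f t <= 1.
  by move=> /andP[t0 t1]; rewrite /f le_max lexx /= ge_max ler01 /=; lra.
have g01 (t : R) : 0 <= t <= 1 -> 0 <= g t <= 1.
  by move=> /andP[t0 t1]; rewrite /g le_max lexx /= ge_max ler01 /=; lra.
(* One product covers both halves of the concatenated path, so continuity at [t = 1 / 2] needs no
   gluing. For [t <= 1 / 2] the factor [H (f t) = al] cancels the adjoint; for [t >= 1 / 2] the
   Moebius factor is [al] and cancels it. *)
pose G (t : R) (k : K2) := H (f t) k *m ((al k)^t* *m mob (g t) (al k) (al' k)).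
have Gl (t : R) : 0 <= t <= 1 -> t <= 1 / 2 -> G t = fun k => mob (g t) (al k) (al' k).
  move=> t01 th; apply/funext => k; rewrite /G.
  have -> : f t = 0 by rewrite /f; apply/max_idPl; lra.
  by rewrite H0 mulmxA (unitarymx_mul_adj (u k)) mul1mx.
have Gr (t : R) : 0 <= t <= 1 -> 1 / 2 <= t -> G t = H (f t).
  move=> t01 th; apply/funext => k; rewrite /G.
  have -> : g t = 0 by rewrite /g; apply/max_idPl; lra.
  have h01 : (0 : R) <= (0 : R) <= 1 by apply/andP; split.
  by rewrite (mob0 (hD _ _ h01)) (unitarymx_adjK (u k)) mulmx1.
exists G; split.
- move=> t k t01; have tc (F : K2 -> 'M[C]_m) : fam_cont F ->
      tendsto_mx (nbh2 (t, k)) (fun x => F x.2) (F k).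
    by move=> hF; apply: tendsto_comp (hF k) => d d0; exists d => // x [].
  apply: (tendsto_mxM (@nbh2_le _)).
    have := Hc (f t) k (f01 _ t01).
    apply: (@tendsto_comp _ _ _ _ (fun x : R * K2 => (f x.1, x.2))) => d d0.
    exists (d / 2); first by rewrite divr_gt0.
    move=> x [x01 x1 x2]; split=> /=; [exact: f01| |apply: nbh_le x2; lra].
    rewrite /f (le_lt_trans (max0_lip _ _)) //.
    have -> : 2 * x.1 - 1 - (2 * t - 1) = 2 * (x.1 - t) by ring.
    by rewrite normrM ger0_norm //; move: x1 => /=; lra.
  apply: (tendsto_mxM (@nbh2_le _)).
    exact: tendsto_mx_adj (tc _ c).
  apply: (mob_tendsto (@nbh2_le _)) (tc _ c) (tc _ c') (hD _ _ (g01 _ t01)).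
  apply: tendsto_real => d d0; exists (d / 2); first by rewrite divr_gt0.
  move=> x [x01 x1 x2]; rewrite /g (le_lt_trans (max0_lip _ _)) //.
  have -> : 1 - 2 * x.1 - (1 - 2 * t) = - (2 * (x.1 - t)) by ring.
  by rewrite normrN normrM ger0_norm //; move: x1 => /=; lra.
- move=> t t01; case: (leP t (1 / 2)) => th; last first.
    by rewrite (Gr _ t01 (ltW th)); exact: Hm (f01 _ t01).
  rewrite (Gl _ t01 th); split.
  + move=> k; apply: (mob_tendsto (@nbh_le _)) (c k) (c' k) (hD _ _ (g01 _ t01)).
    exact: tendsto_cst.
  + by move=> k; case: (p k) (p' k) => p1 p2 [p1' p2']; rewrite p1 p2 p1' p2'.
  + by move=> k; exact: mob_unitary (u k) (u' k) (hD _ _ (g01 _ t01)).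
  + move=> k; rewrite (twist_mob hE (u _) (hD _ _ (g01 _ t01))).
    by rewrite -tw -tw'.
- move=> k; have h01 : (0 : R) <= (0 : R) <= 1 by apply/andP; split.
  rewrite (Gl _ h01) /=; last by rewrite divr_ge0.
  have -> : g 0 = 1 by rewrite /g mulr0 subr0; exact/max_idPr.
  exact: mob1 (u k).
- move=> k; have h01 : (0 : R) <= (1 : R) <= 1 by apply/andP; split.
  rewrite (Gr _ h01) /=; last by lra.
  have -> : f 1 = 1 by rewrite /f mulr1; have -> : 2 - 1 = 1 :> R by [ring]; exact/max_idPr.
  exact: H1.
Qed.

End Families.

(** * Avoiding degenerate Hermitian matrices *)

Section Pigeonhole.
Variable R : realType.
Variables (T J : finType) (t0 : J -> T) (F : J -> (T -> R) -> T -> R).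
Variables (K L dl : R).
Hypotheses (K0 : 0 < K) (dl0 : 0 < dl).
Hypothesis F_lip : forall j q q' r, 0 <= r -> (forall t, `|q t| <= K) -> (forall t, `|q' t| <= K) ->
  (forall t, t != t0 j -> `|q t - q' t| <= r) -> forall t, `|F j q t - F j q' t| <= L * r.

(** [[-K, K]] is cut into [N] intervals; the additional index is for the right endpoint [u = K]. *)
Definition cell N (u : R) : 'I_N.+1 := inord (Num.truncn ((u + K) / (2 * K) * N%:R)).

Lemma cell_close N u u' : (0 < N)%N -> `|u| <= K -> `|u'| <= K -> cell N u = cell N u' ->
  `|u - u'| <= 2 * K / N%:R.
Proof.
move=> N0 hu hu' /(congr1 val); have Nr : 0 < N%:R :> R by rewrite ltr0n.
have K2 : 0 < 2 * K by rewrite mulr_gt0.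
have tr v : `|v| <= K -> let w := (v + K) / (2 * K) * N%:R in
    (Num.truncn w < N.+1)%N /\ (Num.truncn w)%:R <= w < (Num.truncn w).+1%:R.
  rewrite ler_norml => /andP[v1 v2] w.
  have w0 : 0 <= w by rewrite !mulr_ge0 ?invr_ge0 ?ler0n ?(ltW K2) // -lerBlDr sub0r.
  have wN : w <= N%:R by rewrite ler_piMl ?ler0n // ler_pdivrMr // mul1r; lra.
  have /andP[h1 h2] := truncn_itv w0; rewrite h1 h2; split=> //.
  by rewrite ltnS -(ler_nat R) (le_trans h1).
have [a1 /andP[a2 a3]] := tr _ hu; have [b1 /andP[b2 b3]] := tr _ hu'.
rewrite /= !inordK // => e; move: b2 b3; rewrite -e => b2 b3.
set w := (u + K) / (2 * K) * N%:R in a2 a3 b2 b3.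
set w' := (u' + K) / (2 * K) * N%:R in b2 b3.
have -> : u - u' = (w - w') * (2 * K / N%:R) by rewrite /w /w'; field; rewrite !gt_eqF.
have h0 : 0 <= 2 * K / N%:R by rewrite ltW // divr_gt0.
rewrite normrM (ger0_norm h0) ler_piMl //.
by move: a3 b3; rewrite -natr1 => a3 b3; rewrite ler_norml; lra.
Qed.

(* The maps [F j] effectively depend on [#|T| - 1] real parameters, so their images cannot hit
   every point of a fine enough grid in [R^T]. *)
Lemma exists_avoiding : exists2 x : T -> R, forall t, `|x t| <= dl
  & forall j q, (forall t, `|q t| <= K) -> exists t, F j q t != x t.
Proof.
apply: contrapT => hno.
have hit x : (forall t, `|x t| <= dl) -> exists jq : J * (T -> R),
    (forall t, `|jq.2 t| <= K) /\ forall t, F jq.1 jq.2 t = x t.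
  move=> hx; apply: contrapT => hx'; apply: hno; exists x => // j q hq.
  apply: contrapT => hF; apply: hx'; exists (j, q); split=> // t.
  by apply/eqP; apply: contrapT => /negP ht; apply: hF; exists t.
(* Since [c > 2 K L / dl], parameters in a common cell have images closer than the grid step
   [dl / M]. [M] is chosen so that the [M ^ n] grid points outnumber the at most
   [#|J| (2 c M) ^ (n - 1)] labels. *)
pose n := #|T|; pose c := (Num.truncn (2 * K * L / dl)).+1.
pose M := (#|J| * (2 * c) ^ n.-1).+1; pose N := (c * M)%N.
have hc : 2 * K * L / dl < c%:R by exact: truncnS_gt.
have M0 : 0 < M%:R :> R by rewrite ltr0n.
pose g (i : {ffun T -> 'I_M}) (t : T) : R := (i t)%:R * (dl / M%:R).
have hg i t : `|g i t| <= dl.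
  rewrite /g ger0_norm; last by rewrite mulr_ge0 // ltW // divr_gt0.
  by rewrite mulrCA ler_piMr ?(ltW dl0) // ler_pdivrMr // mul1r ler_nat ltnW.
have [f hf] := choice (fun i => hit (g i) (hg i)).
have n0 (j : J) : (0 < n)%N by apply/card_gt0P; exists (t0 j).
(* A grid point is labelled by a branch that hits it and by the cells of a preimage in all
   coordinates but [t0 j]. *)
pose P (i : {ffun T -> 'I_M}) : J * {ffun 'I_n.-1 -> 'I_N.+1} := ((f i).1,
  [ffun l : 'I_n.-1 => cell N ((f i).2 (nth (t0 (f i).1) (enum (predC1 (t0 (f i).1))) l))]).
have Pinj : injective P.
  move=> i i' [e1 /ffunP e2]; apply/ffunP => t; apply/val_inj/eqP.
  have [hq hF] := hf i; have [hq' hF'] := hf i'.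
  move: e2 hF hq; rewrite e1; set j := (f i').1; move: (f i).2 => q; move: hF' hq'.
  rewrite -/j; move: (f i').2 => q' hF' hq' e2 hF hq.
  have hclose s : s != t0 j -> `|q s - q' s| <= 2 * K / N%:R.
    move=> sj; have sin : s \in enum (predC1 (t0 j)) by rewrite mem_enum.
    have ls : (index s (enum (predC1 (t0 j))) < n.-1)%N.
      by rewrite /n -(cardC1 (t0 j)) cardE index_mem.
    have := e2 (Ordinal ls); rewrite !ffunE /= nth_index //.
    by apply: cell_close => //; rewrite muln_gt0.
  have r0 : 0 <= 2 * K / N%:R by rewrite divr_ge0 // mulr_ge0 // ltW.
  have := F_lip r0 hq hq' hclose t; rewrite hF hF' /g -mulrBl normrM [X in _ * X]ger0_norm; last first.
    by rewrite ltW // divr_gt0.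
  have c0 : 0 < c%:R :> R by rewrite ltr0n.
  have -> : L * (2 * K / N%:R) = (2 * K * L / dl) / c%:R * (dl / M%:R).
    by rewrite /N natrM; field; rewrite !gt_eqF.
  rewrite ler_pM2r ?divr_gt0 // => h.
  have h1 : `|(i t)%:R - (i' t)%:R| < 1 :> R.
    by apply: le_lt_trans h _; rewrite ltr_pdivrMr // mul1r.
  move: h1; rewrite ltr_norml => /andP[a b].
  have ab : ((i t)%:R < (i' t).+1%:R :> R) && ((i' t)%:R < (i t).+1%:R :> R).
    by rewrite -!natr1; clear -a b; apply/andP; split; lra.
  by move: ab; rewrite !ltr_nat !ltnS -eqn_leq.
have := leq_card _ Pinj; rewrite card_prod !card_ffun !card_ord -/n.
(* Without any branch the point [0] already avoids everything; a branch is needed to know that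
   [n > 0]. *)
have [j] : exists j : J, True.
  by apply: contrapT => hJ; apply: hno; exists (fun=> 0) => [t|j]; [rewrite normr0 ltW|case: hJ; exists j].
move=> _; rewrite -{1}(prednK (n0 j)) expnS; apply/negP; rewrite -ltnNge.
apply: (@leq_ltn_trans (#|J| * ((2 * c) ^ n.-1 * M ^ n.-1))).
  have leq_exp p a b : (a <= b)%N -> (a ^ p <= b ^ p)%N.
    by move=> ab; elim: p => // p IH; rewrite !expnS leq_mul.
  by rewrite leq_mul2l -expnMn leq_exp ?orbT // -mulnA mul2n -addnn -[X in (X <= _)%N]addn1 leq_add // muln_gt0.
by rewrite mulnA ltn_pmul2r ?expn_gt0.
Qed.
End Pigeonhole.

(** * Hermitian matrices as real vectors *)

Section HermitianCoordinates.
Variable R : realType.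
Local Notation C := R[i].
Variable m : nat.
Local Notation T := ('I_m * 'I_m)%type.
Implicit Types (A B X : 'M[C]_m) (q : T -> R).

(** The slots on and above the diagonal hold real parts, those below it imaginary parts. Coordinates
    and parameters of [deg_form] are thus indexed by the same [T], as [exists_avoiding] demands. *)
Definition herm_of q : 'M[C]_m := \matrix_(a, b)
  if a == b then (q (a, a))%:C%C
  else if (a < b)%N then (q (a, b) +i* q (b, a))%C else (q (b, a) -i* q (a, b))%C.

Definition herm_coord A (t : T) : R :=
  if (t.1 <= t.2)%N then Re (A t.1 t.2) else Im (A t.2 t.1).

Lemma herm_of_adj q : (herm_of q)^t* = herm_of q.
Proof.
apply/matrixP => a b; rewrite !mxE eq_sym; case: eqVneq => [->|ab].
  exact: conjc_real.
case: (ltngtP a b) => [_|_|/val_inj ab']; last by rewrite ab' eqxx in ab.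
  by rewrite -[LHS]/(conjc _) /= opprK.
by rewrite -[LHS]/(conjc _).
Qed.

Lemma herm_ofK q t : herm_coord (herm_of q) t = q t.
Proof.
case: t => a b; rewrite /herm_coord /= !mxE; case: (ltngtP a b) => [ab|ab|/val_inj ->] /=.
- by have -> : (a == b) = false by apply: contraTF ab => /eqP ->; rewrite ltnn.
- by have -> : (b == a) = false by apply: contraTF ab => /eqP ->; rewrite ltnn.
- by rewrite eqxx.
Qed.

Lemma herm_coordK A : A^t* = A -> herm_of (herm_coord A) = A.
Proof.
move=> hA; apply/matrixP => a b; rewrite mxE /herm_coord /=.
have hab : A a b = conjc (A b a) by rewrite -[in LHS]hA !mxE.
rewrite leqnn; case: eqVneq => [ab|ab].
  move: hab; rewrite -ab; case: (A a a) => x y [] /= /eqP.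
  by rewrite -subr_eq0 opprK -mulr2n mulrn_eq0 /= => /eqP ->.
case: (ltngtP a b) => [_|_|/val_inj ab'] /=; last by rewrite ab' eqxx in ab.
  by rewrite hab; case: (A b a) => x y /=.
by rewrite hab; case: (A b a) => x y /=.
Qed.

Lemma herm_coord_le A e t : mle e A -> `|herm_coord A t| <= e.
Proof.
move=> hA; rewrite /herm_coord; case: ifP => _.
  exact: le_trans (le_normc_Re _) (hA _ _).
exact: le_trans (le_normc_Im _) (hA _ _).
Qed.

Lemma herm_coordB A B t : herm_coord (A - B) t = herm_coord A t - herm_coord B t.
Proof.
by rewrite /herm_coord !mxE; case: ifP => _; [case: (A t.1 t.2)|case: (A t.2 t.1)] => x y; case: (B _ _).
Qed.

Lemma herm_of_le q e : (forall t, `|q t| <= e) -> mle (2 * e) (herm_of q).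
Proof.
move=> hq a b; rewrite mxE (le_trans (le_normc_ReIm _)) //.
have e0 : 0 <= e by apply: le_trans (hq (a, b)).
case: ifP => _ /=; first by rewrite normr0 addr0 (le_trans (hq _)) // ler_peMl // ler1n.
by case: ifP => _ /=; rewrite ?normrN mulr_natl lerD.
Qed.

Lemma adjB A B : (A - B)^t* = A^t* - B^t*.
Proof. by rewrite linearB map_mxB. Qed.

Lemma adjD A B : (A + B)^t* = A^t* + B^t*.
Proof. by rewrite linearD map_mxD. Qed.

End HermitianCoordinates.

(** * Kernels of degenerate Hermitian matrices *)

Section Degenerate.
Variable R : realType.
Local Notation C := R[i].
Variable m : nat.
Implicit Types (A B X : 'M[C]_m).

Lemma argmax_entry (u : 'cV[C]_m) : u != 0 -> exists i, u i 0 != 0 /\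
  forall l, normc (u l 0) <= normc (u i 0).
Proof.
move=> u0; have [i0 ui0] : exists i, u i 0 != 0.
  apply: contrapT => h; move/eqP: u0; apply; apply/colP => i; rewrite mxE.
  by apply/eqP; apply: contrapT => /negP ui; apply: h; exists i.
pose i := [arg max_(l > i0) normc (u l 0)]%O.
have hi l : normc (u l 0) <= normc (u i 0) by rewrite /i; case: arg_maxP => // k _ /(_ l); apply.
exists i; split=> //; rewrite -normc_gt0 (lt_le_trans _ (hi i0)) //.
by rewrite normc_gt0.
Qed.

(** Gaussian elimination on two independent kernel vectors. Pivoting on entries of largest modulus
    bounds the reduced vectors by a constant that does not depend on [B], which keeps the parameters
    of [deg_form] in a fixed cube. *)
Lemma pivot_kernel B (u v : 'cV[C]_m) : B *m u = 0 -> B *m v = 0 -> u != 0 ->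
  (forall c, v != c *: u) ->
  exists i j (x y : 'cV[C]_m), [/\ i != j, B *m x = 0 /\ B *m y = 0,
    x i 0 = 1 /\ x j 0 = 0, y i 0 = 0 /\ y j 0 = 1 & mle 2 x /\ mle 2 y].
Proof.
move=> Bu Bv /argmax_entry [i [ui hi]] vu.
pose x0 := (u i 0)^-1 *: u; pose y0 := v - v i 0 *: x0.
have y0N : y0 != 0 by rewrite subr_eq0 scalerA; exact: vu.
have x0i : x0 i 0 = 1 by rewrite mxE mulVf.
have y0i : y0 i 0 = 0 by rewrite !mxE mulVf // mulr1 subrr.
have [j [yj hj]] := argmax_entry y0N.
have Bx0 : B *m x0 = 0 by rewrite -scalemxAr Bu scaler0.
have By0 : B *m y0 = 0 by rewrite mulmxBr Bv -scalemxAr Bx0 scaler0 subrr.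
pose y := (y0 j 0)^-1 *: y0; pose x := x0 - x0 j 0 *: y.
have hx0 : mle 1 x0.
  by move=> l l'; rewrite ord1 mxE normcM normcV mulrC ler_pdivrMr ?mul1r ?normc_gt0.
have hy : mle 1 y.
  by move=> l l'; rewrite ord1 mxE normcM normcV mulrC ler_pdivrMr ?mul1r ?normc_gt0.
have By : B *m y = 0 by rewrite -scalemxAr By0 scaler0.
have yi : y i 0 = 0 by rewrite mxE y0i mulr0.
have yj1 : y j 0 = 1 by rewrite mxE mulVf.
have xE l : x l 0 = x0 l 0 - x0 j 0 * y l 0 by rewrite !mxE.
exists i, j, x, y; split.
- by apply: contraNneq yj => <-; rewrite y0i.
- split; last exact: By.
  by rewrite mulmxBr Bx0 -scalemxAr By scaler0 subr0.
- by rewrite !xE x0i yi yj1 mulr0 subr0 mulr1 subrr.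
- by [].
- split; last by apply: mle_le hy; rewrite ler1n.
  have := mleB hx0 (mleZ (x0 j 0) hy); apply: mle_le; rewrite mulr1.
  by have := hx0 j 0; lra.
Qed.

Lemma hermitian_diag A : A^t* = A -> exists (V : 'M[C]_m) (d : 'rV_m),
  [/\ V \is unitarymx, A = V *m diag_mx d *m V^t* & forall p, d 0 p = (Re (d 0 p))%:C%C].
Proof.
move=> hA.
have [V [d [hV AV]]] : exists (V : 'M[C]_m) (d : 'rV_m), V \is unitarymx /\ A = V *m diag_mx d *m V^t*.
  by apply: normalmx_diag; apply/normalmxP; rewrite hA.
have VV := unitarymx_adjK hV; exists V, d; split=> // p.
have dE : diag_mx d = V^t* *m A *m V by rewrite AV !mulmxA VV mul1mx -mulmxA VV mulmx1.
have : (diag_mx d)^t* = diag_mx d by rewrite dE !adj_mul trmxCK hA mulmxA.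
move=> /matrixP/(_ p p); rewrite !mxE eqxx !mulr1n -[LHS]/(conjc _).
case: (d 0 p) => x y [] /= /eqP.
by rewrite -subr_eq0 -opprD oppr_eq0 -mulr2n mulrn_eq0 /= => /eqP ->.
Qed.

(** Two equal eigenvalues put two columns of the unitary [V] into the kernel of [A - l]. The crude
    bound on [l] is read off from [diag_mx d = V^t* A V]. *)
Lemma degenerate_hermitian A a : A^t* = A -> disc A = 0 -> mle a A ->
  exists l : R, `|l| <= m%:R * (m%:R * a) /\ exists i j (x y : 'cV[C]_m), 
   [/\ i != j, (A - l%:C%C%:M) *m x = 0 /\ (A - l%:C%C%:M) *m y = 0,
    x i 0 = 1 /\ x j 0 = 0, y i 0 = 0 /\ y j 0 = 1 & mle 2 x /\ mle 2 y].
Proof.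
move=> hA dA hAa.
have [V [d [hV AV dre]]] := hermitian_diag hA.
have VV := unitarymx_adjK hV.
have ninj : ~ injective (d 0) by move/(disc_neq0 d hV); rewrite -AV dA eqxx.
have [p [r [pr dpr]]] : exists p r, p != r /\ d 0 p = d 0 r.
  apply: contrapT => h; apply: ninj => p r e; apply/eqP; apply: contrapT => /negP pr.
  by apply: h; exists p, r.
have dE : diag_mx d = V^t* *m A *m V.
  by rewrite AV !mulmxA VV mul1mx -mulmxA VV mulmx1.
have dreal := dre p.
exists (Re (d 0 p)); split.
  have := mleM (mleM (mle_adj (unitarymx_mle hV)) hAa) (unitarymx_mle hV).
  rewrite -dE => /(_ p p); rewrite mxE eqxx mulr1n mul1r mulr1.
  exact: le_trans (le_normc_Re _).
rewrite -dreal; set l := d 0 p.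
have AVd : A *m V = V *m diag_mx d by rewrite AV -mulmxA VV mulmx1.
have ker r' : d 0 r' = l -> (A - l%:M) *m col r' V = 0.
  move=> dr; have Ac : A *m col r' V = col r' (V *m diag_mx d) by rewrite -AVd !colE mulmxA.
  rewrite mulmxBl mul_scalar_mx Ac; apply/colP => a'.
  by rewrite mul_mx_diag !mxE dr mulrC subrr.
have col_inj c : delta_mx r 0 != c *: delta_mx p 0 :> 'cV[C]_m.
  apply/negP => /eqP/colP/(_ r); rewrite !mxE !eqxx /= eq_sym (negbTE pr) mulr0 => /eqP.
  by rewrite oner_eq0.
apply: (@pivot_kernel _ (col p V) (col r V)).
- exact: ker.
- by apply: ker; rewrite -dpr.
- apply/negP => /eqP /(congr1 (mulmx (V^t*))); rewrite colE mulmxA VV mul1mx mulmx0.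
  by move=> /colP/(_ p); rewrite !mxE !eqxx => /eqP; rewrite oner_eq0.
- move=> c; apply: contra (col_inj c) => /eqP /(congr1 (mulmx (V^t*))).
  by rewrite !colE -scalemxAr !mulmxA VV !mul1mx => ->.
Qed.
End Degenerate.

(** * Algebra of bounded Lipschitz functions *)

Section BoundedLipschitz.
Variable R : realType.
Local Notation C := R[i].
Variables (T : finType) (t0 : T) (K : R).
Hypothesis K0 : 0 < K.

(* Bounded and Lipschitz on the cube, and independent of the coordinate [t0]. *)
Definition bl (f : (T -> R) -> C) := exists2 L : R, 0 <= L
  & forall q, (forall t, `|q t| <= K) -> normc (f q) <= L /\
    forall q' r, 0 <= r -> (forall t, `|q' t| <= K) ->
      (forall t, t != t0 -> `|q t - q' t| <= r) -> normc (f q - f q') <= L * r.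

Lemma bl_cst c : bl (fun=> c).
Proof.
exists (normc c) => [|q hq]; first exact: normc_ge0.
split=> // q' r r0 _ _; rewrite subrr normc0 mulr_ge0 ?normc_ge0 //.
Qed.

Lemma bl_coord t : t != t0 -> bl (fun q => (q t)%:C%C).
Proof.
move=> tt0; exists (K + 1) => [|q hq]; first by rewrite addr_ge0 // ltW.
split=> [|q' r r0 hq' /(_ t tt0) h]; first by rewrite normc_real (le_trans (hq t)) // lerDl.
by rewrite -rmorphB normc_real (le_trans h) // ler_peMl // lerDr ltW.
Qed.

Lemma blD f g : bl f -> bl g -> bl (fun q => f q + g q).
Proof.
move=> [L L0 hf] [M M0 hg]; exists (L + M) => [|q hq]; first by rewrite addr_ge0.
have [f1 f2] := hf q hq; have [g1 g2] := hg q hq.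
split=> [|q' r r0 hq' h]; first by rewrite (le_trans (le_normcD _ _)) ?lerD.
by rewrite opprD addrACA mulrDl (le_trans (le_normcD _ _)) // lerD ?f2 ?g2.
Qed.

Lemma blN f : bl f -> bl (fun q => - f q).
Proof.
move=> [L L0 hf]; exists L => // q /hf [f1 f2]; rewrite normcN; split=> // q' r r0 hq' h.
by rewrite -opprD normcN f2.
Qed.

Lemma bl_conj f : bl f -> bl (fun q => conjc (f q)).
Proof.
move=> [L L0 hf]; exists L => // q /hf [f1 f2]; rewrite normc_conj; split=> // q' r r0 hq' h.
by rewrite -(rmorphB (@Num.conj C)) normc_conj f2.
Qed.

Lemma blM f g : bl f -> bl g -> bl (fun q => f q * g q).
Proof.
move=> [L L0 hf] [M M0 hg]; exists (L * M + L * M) => [|q hq].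
  by rewrite addr_ge0 ?mulr_ge0.
have [f1 f2] := hf q hq; have [g1 g2] := hg q hq.
split=> [|q' r r0 hq' h].
  by rewrite normcM (le_trans (ler_pM _ _ f1 g1)) ?normc_ge0 // lerDl mulr_ge0.
have [g1' _] := hg q' hq'.
have -> : f q * g q - f q' * g q' = f q * (g q - g q') + (f q - f q') * g q' by ring.
rewrite (le_trans (le_normcD _ _)) // !normcM mulrDl lerD //.
  by rewrite -mulrA ler_pM ?normc_ge0 ?g2.
by rewrite mulrAC ler_pM ?normc_ge0 ?f2.
Qed.

Lemma bl_ext f g : f =1 g -> bl f -> bl g.
Proof. by move/funext ->. Qed.

Lemma bl_sum I (r : seq I) (P : pred I) (F : I -> (T -> R) -> C) :
  (forall i, P i -> bl (F i)) -> bl (fun q => \sum_(i <- r | P i) F i q).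
Proof.
move=> h; elim: r => [|i r IH].
  by apply: bl_ext (bl_cst 0) => q; rewrite big_nil.
have [Pi|Pi] := boolP (P i).
  by apply: bl_ext (blD (h i Pi) IH) => q; rewrite big_cons Pi.
by apply: bl_ext IH => q; rewrite big_cons (negbTE Pi).
Qed.

End BoundedLipschitz.

(** * Parametrization of degenerate Hermitian matrices *)

Section HermitianPerturbation.
Variable R : realType.
Local Notation C := R[i].
Local Notation K2 := (R * R)%type.
Variable m : nat.
Local Notation T := ('I_m * 'I_m)%type.
Implicit Types (A B X : 'M[C]_m) (q : T -> R).

(* A Hermitian [B] with kernel vectors [x], [y] as in [pivot_kernel] satisfies [B = S^* B S] for
   [S = 1 - x e_i^T - y e_j^T], whose rows [i] and [j] vanish.  The parameters of [deg_form] are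
   the eigenvalue [q (i, i)], the entries of [B] off the rows and columns [i], [j], and the
   columns [i], [j] of [S]; the slots [(i, j)] and [(j, i)] are kept for the base point. *)
Definition deg_factor (i j : 'I_m) q : 'M[C]_m := \matrix_(a, b)
  if (a == i) || (a == j) then 0
  else if b == i then (q (a, i))%:C%C + 'i%C * (q (i, a))%:C%C
  else if b == j then (q (a, j))%:C%C + 'i%C * (q (j, a))%:C%C
  else (a == b)%:R.

Definition deg_core (i j : 'I_m) q : 'M[C]_m := \matrix_(a, b)
  if [|| a == i, a == j, b == i | b == j] then 0
  else if a == b then (q (a, a))%:C%C
  else if (a < b)%N then (q (a, b))%:C%C + 'i%C * (q (b, a))%:C%C
  else (q (b, a))%:C%C - 'i%C * (q (a, b))%:C%C.

Definition deg_form (i j : 'I_m) q : 'M[C]_m :=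
  (q (i, i))%:C%C%:M + (deg_factor i j q)^t* *m (deg_core i j q *m deg_factor i j q).

(** The slot [(j, j)] is the one left over: the form and the base point together occupy the other
    [m ^ 2 - 1]. This is the codimension one that [exists_avoiding] consumes. *)
Lemma bl_deg_form i j K a b : 0 < K -> i != j -> bl (j, j) K (fun q => deg_form i j q a b).
Proof.
move=> K0 ij.
have blc t : t.1 != j \/ t.2 != j -> bl (j, j) K (fun q => (q t)%:C%C).
  move=> h; apply: bl_coord => //; rewrite -pair_eqE negb_and /=.
  by case: h => ->; rewrite ?orbT.
have blci t : t.1 != j \/ t.2 != j -> bl (j, j) K (fun q => 'i%C * (q t)%:C%C).
  by move=> h; apply: blM (bl_cst _ _ _) (blc _ h).
have fac c d : bl (j, j) K (fun q => deg_factor i j q c d).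
  suff h : bl (j, j) K (fun q => if (c == i) || (c == j) then 0
    else if d == i then (q (c, i))%:C%C + 'i%C * (q (i, c))%:C%C
    else if d == j then (q (c, j))%:C%C + 'i%C * (q (j, c))%:C%C
    else (c == d)%:R) by apply: bl_ext h => q; rewrite mxE.
  have [_|] := boolP ((c == i) || (c == j)); first exact: bl_cst.
  rewrite negb_or => /andP[ci cj].
  have [_|_] := boolP (d == i); first by apply: blD; [apply: blc; left|apply: blci; right].
  have [_|_] := boolP (d == j); first by apply: blD; [apply: blc; left|apply: blci; right].
  exact: bl_cst.
have cor c d : bl (j, j) K (fun q => deg_core i j q c d).
  suff h : bl (j, j) K (fun q => if [|| c == i, c == j, d == i | d == j] then 0
    else if c == d then (q (c, c))%:C%C
    else if (c < d)%N then (q (c, d))%:C%C + 'i%C * (q (d, c))%:C%C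
    else (q (d, c))%:C%C - 'i%C * (q (c, d))%:C%C) by apply: bl_ext h => q; rewrite mxE.
  have [_|] := boolP [|| c == i, c == j, d == i | d == j]; first exact: bl_cst.
  rewrite !negb_or => /and4P[ci cj di dj].
  have [_|_] := boolP (c == d); first by apply: blc; left.
  have [_|_] := boolP (c < d)%N; first by apply: blD; [apply: blc; left|apply: blci; left].
  by apply: blD; [apply: blc; left|apply: blN; apply: blci; left].
suff h : bl (j, j) K (fun q => (q (i, i))%:C%C *+ (a == b) +
    \sum_c conjc (deg_factor i j q c a) * \sum_d (deg_core i j q c d * deg_factor i j q d b)).
  apply: bl_ext h => q.
  rewrite [RHS]mxE [X in _ = X + _]mxE [X in _ = _ + X]mxE; congr (_ + _).
  by apply: eq_bigr => c _; rewrite [X in _ = _ * X]mxE; congr (_ * _); rewrite [RHS]mxE [X in _ = _ X]mxE.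
apply: blD.
  case: (a == b); last exact: bl_ext (bl_cst _ _ 0).
  by apply: blc; left.
apply: bl_sum => c _; apply: blM; first exact: bl_conj.
by apply: bl_sum => d _; apply: blM.
Qed.

(** [B S = B] because [x] and [y] are in the kernel, and taking adjoints gives [S^t* B = B] as well.
    As the rows [i] and [j] of [S] vanish, [S^t* B S] reads [B] only off the rows and columns [i],
    [j], where [deg_core] agrees with it. *)
Lemma deg_formP A l (i j : 'I_m) (x y : 'cV[C]_m) a : A^t* = A -> i != j ->
  (A - l%:C%C%:M) *m x = 0 -> (A - l%:C%C%:M) *m y = 0 ->
  x i 0 = 1 -> x j 0 = 0 -> y i 0 = 0 -> y j 0 = 1 ->
  mle 2 x -> mle 2 y -> mle a (A - l%:C%C%:M) -> `|l| <= a ->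
  forall k : K2, exists q, [/\ deg_form i j q = A, q (i, j) = k.1, q (j, i) = k.2
    & forall t, `|q t| <= a + 2 + `|k.1| + `|k.2|].
Proof.
move=> hA ij Bx By xi xj yi yj hx hy; set B := A - _ => hB hl k.
have hB' : B^t* = B.
  rewrite /B adjB hA; congr (_ - _); apply/matrixP => b c; rewrite !mxE eq_sym.
  by case: (_ == _); rewrite ?mulr1n ?mulr0n; [exact: conjc_real|exact: conjc0].
pose q (t : T) : R :=
  if (t.1 == i) && (t.2 == i) then l
  else if (t.1 == i) && (t.2 == j) then k.1
  else if (t.1 == j) && (t.2 == i) then k.2
  else if (t.1 == j) && (t.2 == j) then 0
  else if t.2 == i then - Re (x t.1 0)
  else if t.1 == i then - Im (x t.2 0)
  else if t.2 == j then - Re (y t.1 0)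
  else if t.1 == j then - Im (y t.2 0)
  else herm_coord B t.
have ji : (j == i) = false by rewrite eq_sym (negbTE ij).
have a0 : 0 <= a by apply: le_trans hl.
exists q; split.
- have facE : deg_factor i j q = 1%:M - x *m delta_mx 0 i - y *m delta_mx 0 j.
    have outer (z : 'cV[C]_m) c b d : (z *m delta_mx 0 c : 'M_m) b d = z b 0 * (d == c)%:R.
      by rewrite mxE big_ord1 mxE eqxx.
    apply/matrixP => b c; rewrite [LHS]mxE; have -> : (1%:M - x *m delta_mx 0 i -
        y *m delta_mx 0 j) b c = (b == c)%:R - x b 0 * (c == i)%:R - y b 0 * (c == j)%:R.
      rewrite [LHS]mxE [X in X + _]mxE [X in X + _ + _]mxE [X in _ + X + _]mxE [X in _ + X]mxE.
      by rewrite !outer.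
    case: (eqVneq b i) => [->|bi] /=.
      by rewrite xi yi mul0r mul1r subr0 eq_sym subrr.
    case: (eqVneq b j) => [->|bj] /=.
      by rewrite xj yj mul0r mul1r subr0 eq_sym subrr.
    rewrite /q /= (negbTE bi) (negbTE bj) /=.
    case: (eqVneq c i) => [->|ci] /=.
      rewrite (negbTE bi) eqxx (negbTE ij) mulr1 mulr0 subr0 sub0r.
      by rewrite {3}[x b 0]complexE !rmorphN mulrN opprD.
    case: (eqVneq c j) => [->|cj] /=.
      rewrite (negbTE bj) ji eqxx mulr1 mulr0 subr0 sub0r.
      by rewrite {3}[y b 0]complexE !rmorphN mulrN opprD.
    by rewrite !mulr0 !subr0.
  have BS : B *m deg_factor i j q = B.
    by rewrite facE !mulmxBr mulmx1 !mulmxA Bx By !mul0mx !subr0.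
  have fac0 c b : (c == i) || (c == j) -> deg_factor i j q c b = 0 by rewrite mxE => ->.
  have coreE c d : ~~ ((c == i) || (c == j)) -> ~~ ((d == i) || (d == j)) ->
      deg_core i j q c d = B c d.
    rewrite !negb_or => /andP[ci cj] /andP[di dj].
    rewrite -[in RHS](herm_coordK hB') !mxE (negbTE ci) (negbTE cj) (negbTE di) (negbTE dj) /=.
    rewrite /q /= (negbTE ci) (negbTE cj) (negbTE di) (negbTE dj) /=.
    case: ifP => // _; case: ifP => _; rewrite [RHS]complexE //=.
    by rewrite rmorphN mulrN.
  have CS c b : ~~ ((c == i) || (c == j)) -> (deg_core i j q *m deg_factor i j q) c b = B c b.
    move=> hc; rewrite -[in RHS]BS !mxE; apply: eq_bigr => d _.
    have [hd|hd] := boolP ((d == i) || (d == j)); first by rewrite (fac0 d b hd) !mulr0.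
    by rewrite coreE.
  have -> : deg_form i j q = l%:C%C%:M + (deg_factor i j q)^t* *m B.
    have qii : q (i, i) = l by rewrite /q /= eqxx.
    rewrite /deg_form qii; congr (_ + _); apply/matrixP => b c.
    rewrite [LHS]mxE [RHS]mxE; apply: eq_bigr => d _.
    have [hd|hd] := boolP ((d == i) || (d == j)); last by rewrite CS.
    have -> : ((deg_factor i j q)^t*) b d = 0 by rewrite !mxE hd; exact: conjc0.
    by rewrite !mul0r.
  by rewrite -[in X in _ *m X]hB' -adj_mul BS hB' addrC subrK.
- by rewrite /q /= eqxx ji /= eqxx.
- by rewrite /q /= eqxx ji /= eqxx.
- have n1 := normr_ge0 k.1; have n2 := normr_ge0 k.2.
  have b1 (r b : R) : `|r| <= b -> b <= a + 2 -> `|r| <= a + 2 + `|k.1| + `|k.2|.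
    by move=> h1 h2; lra.
  have hr (z : 'cV[C]_m) b : mle 2 z -> `|- Re (z b 0)| <= 2.
    by move=> hz; rewrite normrN (le_trans (le_normc_Re _)).
  have hi (z : 'cV[C]_m) b : mle 2 z -> `|- Im (z b 0)| <= 2.
    by move=> hz; rewrite normrN (le_trans (le_normc_Im _)).
  move=> t; rewrite /q; case: ifP => _; first by apply: b1 hl _; lra.
  case: ifP => _; first by clear -n2 a0; lra.
  case: ifP => _; first by clear -n1 a0; lra.
  case: ifP => _; first by rewrite normr0; clear -n1 n2 a0; lra.
  case: ifP => _; first by apply: b1 (hr _ _ hx) _; clear -a0; lra.
  case: ifP => _; first by apply: b1 (hi _ _ hx) _; clear -a0; lra.
  case: ifP => _; first by apply: b1 (hr _ _ hy) _; clear -a0; lra.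
  case: ifP => _; first by apply: b1 (hi _ _ hy) _; clear -a0; lra.
  by apply: b1 (herm_coord_le _ hB) _; clear; lra.
Qed.

End HermitianPerturbation.

Section HermitianPerturbationMain.
Variable R : realType.
Local Notation C := R[i].
Local Notation K2 := (R * R)%type.
Variable m : nat.
Local Notation T := ('I_m * 'I_m)%type.

Lemma mle_exists n p (A : 'M[C]_(n, p)) : exists2 B, 0 <= B & mle B A.
Proof.
exists (\sum_i \sum_j normc (A i j)) => [|i j].
  by apply: sumr_ge0 => i _; apply: sumr_ge0 => j _; exact: normc_ge0.
rewrite (bigD1 i) //= (bigD1 j) //= -addrA lerDl addr_ge0 //.
  by apply: sumr_ge0 => l _; exact: normc_ge0.
by apply: sumr_ge0 => k _; apply: sumr_ge0 => l _; exact: normc_ge0.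
Qed.

(** If [h k + X] is degenerate, then [X = deg_form i j q - h k] for parameters [q] whose slots
    [(i, j)] and [(j, i)] spell out [k]. A single [X] missed by the finitely many maps [F ij]
    therefore works for all [k] of the square at once. *)
Lemma hermitian_perturbation (h : K2 -> 'M[C]_m) Lh K0 dl : 0 <= Lh -> 0 < K0 -> 0 < dl ->
  (forall k, (h k)^t* = h k) ->
  (forall k k' r, `|k.1 - k'.1| <= r -> `|k.2 - k'.2| <= r -> mle (Lh * r) (h k - h k')) ->
  exists X, [/\ X^t* = X, mle dl X
    & forall k, `|k.1| <= K0 -> `|k.2| <= K0 -> disc (h k + X) != 0].
Proof.
move=> Lh0 K00 dl0 hh hL; have K0ge := ltW K00; have dlge := ltW dl0.
have [b0 b00 hb0] := mle_exists (h (0, 0)).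
have hb k r : `|k.1| <= r -> `|k.2| <= r -> mle (b0 + Lh * r) (h k).
  move=> h1 h2; rewrite -[h k](subrK (h (0, 0))) (addrC b0); apply: mleD _ hb0.
  by apply: hL; rewrite subr0.
(* [a1] bounds [h k + X], [a] bounds [A - l] for an eigenvalue [l] as in [degenerate_hermitian], and
   [K] bounds the parameters delivered by [deg_formP]. *)
pose a1 := b0 + Lh * K0 + dl; pose a := a1 + m%:R * (m%:R * a1).
have a10 : 0 <= a1 by rewrite !addr_ge0 ?mulr_ge0.
have a0 : 0 <= a by rewrite !addr_ge0 ?mulr_ge0.
pose K := a + 2 + K0 + K0.
have K_gt0 : 0 < K by rewrite /K; clear -a0 K00; lra.
have Kge := ltW K_gt0.
pose J : finType := {ij : T | ij.1 != ij.2}.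
pose M (ij : J) q : 'M[C]_m := deg_form (val ij).1 (val ij).2 q - h (q (val ij), q ((val ij).2, (val ij).1)).
pose F (ij : J) q := herm_coord (M ij q).
pose t0 (ij : J) : T := ((val ij).2, (val ij).2).
have blM ij (c d : 'I_m) : bl (t0 ij) K (fun q => M ij q c d).
  case: ij => [[i j] /= ij]; rewrite /M /t0 /=.
  suff hbl : bl (j, j) K (fun q => h (q (i, j), q (j, i)) c d).
    by apply: bl_ext (blD (bl_deg_form c d K_gt0 ij) (blN hbl)) => q; rewrite !mxE.
  exists (b0 + Lh * K + Lh) => [|q hq]; first by rewrite !addr_ge0 ?mulr_ge0.
  split=> [|q' r r0 hq' hqq'].
    by rewrite (le_trans (hb (q (i, j), q (j, i)) K (hq _) (hq _) c d)) // lerDl.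
  have := hL (q (i, j), q (j, i)) (q' (i, j), q' (j, i)) r; move=> /(_ _ _ c d); rewrite !mxE.
  move=> hle; apply: le_trans (hle _ _) _.
  - by apply: hqq'; rewrite -pair_eqE negb_and /= ij.
  - by apply: hqq'; rewrite -pair_eqE negb_and /= ij orbT.
  - by rewrite ler_wpM2r // lerDr addr_ge0 ?mulr_ge0.
have [Lf hLf] : exists Lf : J * T -> R, forall x, 0 <= Lf x /\ forall q, (forall t, `|q t| <= K) ->
    forall q' r, 0 <= r -> (forall t, `|q' t| <= K) ->
      (forall t, t != t0 x.1 -> `|q t - q' t| <= r) ->
      normc (M x.1 q x.2.1 x.2.2 - M x.1 q' x.2.1 x.2.2) <= Lf x * r.
  suff hex (x : J * T) : exists L : R, 0 <= L /\ forall q, (forall t, `|q t| <= K) ->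
      forall q' r, 0 <= r -> (forall t, `|q' t| <= K) ->
      (forall t, t != t0 x.1 -> `|q t - q' t| <= r) ->
      normc (M x.1 q x.2.1 x.2.2 - M x.1 q' x.2.1 x.2.2) <= L * r.
    by have [Lf hLf] := choice hex; exists Lf.
  have [L L0 hL'] := blM x.1 x.2.1 x.2.2; exists L; split=> // q hq q' r r0 hq' h'.
  by have [_ h2] := hL' q hq; exact: h2.
pose L := \sum_x Lf x.
have LfL x : Lf x <= L.
  by rewrite /L (bigD1 x) //= lerDl sumr_ge0 // => y _; case: (hLf y).
have L0 : 0 <= L by rewrite /L sumr_ge0 // => y _; case: (hLf y).
(* Half of [dl], since [herm_of_le] doubles the bound. *)
have [||x xd hx] := @exists_avoiding R T J t0 F K L (dl / 2) K_gt0; first by rewrite divr_gt0.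
  move=> ij q q' r r0 hq hq' hqq' t; rewrite /F -herm_coordB; apply: herm_coord_le => c d.
  rewrite mxE [X in _ + X]mxE; have [_ /(_ q hq q' r r0 hq' hqq')] := hLf (ij, (c, d)).
  by move=> /le_trans; apply; rewrite ler_wpM2r.
pose X := herm_of x.
have hX : X^t* = X := herm_of_adj x.
have Xd : mle dl X by apply: mle_le (herm_of_le xd); rewrite mulrC divfK // pnatr_eq0.
exists X; split=> // k k1 k2; apply/negP => /eqP dA.
set A := h k + X in dA.
have hA : A^t* = A by rewrite adjD hh hX.
have Aa : mle a1 A by apply: mleD Xd; exact: hb.
have [l [hl [i [j [x' [y' [ij [Bx By] [xi xj] [yi yj] [hx' hy']]]]]]]] := degenerate_hermitian hA dA Aa.
have Ba : mle a (A - l%:C%C%:M).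
  apply: mleB Aa _ => c d; rewrite mxE; case: (c == d); rewrite ?mulr1n ?mulr0n.
    by rewrite normc_real.
  by rewrite normc0 !mulr_ge0.
have la : `|l| <= a by rewrite (le_trans hl) // lerDr.
have [q [qA qk1 qk2 hq]] := deg_formP hA ij Bx By xi xj yi yj hx' hy' Ba la k.
have [|t /eqP] := hx (Sub (i, j) ij) q.
  by move=> t; apply: le_trans (hq t) _; rewrite /K; clear -k1 k2; lra.
apply; rewrite /F /M /= qA qk1 qk2 -surjective_pairing /A addrAC subrr add0r.
exact: herm_ofK.
Qed.

End HermitianPerturbationMain.

(** * Uniform constants on compact squares *)

Section Boxes.
Import numFieldNormedType.Exports.
Variable R : realType.
Local Notation K2 := (R * R)%type.

Definition box (c : K2) (r : R) (k : K2) := `|k.1 - c.1| <= r /\ `|k.2 - c.2| <= r.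

(** Heine-Borel for the closed square in its near-covering form. It stands in for the uniform moduli
    and Lebesgue numbers needed later. *)
Lemma box_uniform (c : K2) r (P : R -> K2 -> Prop) :
  (forall k, box c r k ->
     exists2 d, 0 < d & forall k' e, nbh k d k' -> 0 < e -> e < d -> P e k') ->
  exists2 e, 0 < e & forall k, box c r k -> P e k.
Proof.
move=> hP.
have seg (x y : R) : `[y - r, y + r]%classic x <-> `|x - y| <= r.
  by rewrite /= in_itv /= ler_distl.
have cpt := compact_setX (@segment_compact R (c.1 - r) (c.1 + r))
  (@segment_compact R (c.2 - r) (c.2 + r)).
have {}cpt := iffLR (compact_near_coveringP _) cpt R _ P (at_right_proper_filter (0 : R)).
have [|e0 /= e00 he0] := cpt.
  move=> [x y] [/= /seg hx /seg hy]; have [d d0 hd] := hP (x, y) (conj hx hy).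
  exists (ball (x, y) d, [set e : R | 0 < e < d]%classic) => /=.
    split; first exact: nbhsx_ballx.
    exists d => //= e; rewrite /ball_ /= sub0r normrN => /ltr_normlW ed e0.
    by rewrite e0 ed.
  move=> [k' e] /= [[h1 h2] /andP[e0 ed]]; apply: hd => //; split.
    by rewrite distrC; exact: h1.
  by rewrite distrC; exact: h2.
have e2 : 0 < e0 / 2 by rewrite divr_gt0.
exists (e0 / 2) => // -[x y] [hx hy]; apply: (he0 (e0 / 2)) => //.
  by rewrite /ball_ /= sub0r normrN gtr0_norm // ltr_pdivrMr // ltr_pMr // ltr1n.
by split; apply/seg.
Qed.

End Boxes.

(** * Lipschitz approximation on a square *)

Section LipschitzApproximation.
Variable R : realType.
Local Notation K2 := (R * R)%type.

Definition dist1 (k q : K2) : R := `|k.1 - q.1| + `|k.2 - q.2|.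

(* The approximation is the infimal convolution [inf_q (f q + n |k - q|)]. *)
Lemma lipschitz_approx (f : K2 -> R) B e : (forall k, `|f k| <= B) -> 0 < e ->
  (exists2 d, 0 < d & forall k k', nbh k d k' -> `|f k - f k'| <= e) ->
  exists g L, [/\ 0 <= L,
    forall k k' r, `|k.1 - k'.1| <= r -> `|k.2 - k'.2| <= r -> `|g k - g k'| <= L * r
    & forall k, `|g k - f k| <= e].
Proof.
move=> fB e0 [d d0 hd]; have B0 : 0 <= B by apply: le_trans (fB (0, 0)).
(* With this slope a step of length [d] costs [2 B], the largest possible gain in [f], so
   competitors at distance [d] or more never win. *)
pose n := 2 * B / d; have n0 : 0 <= n by rewrite divr_ge0 ?mulr_ge0 // ltW.
have nd : n * d = 2 * B by rewrite /n divfK // gt_eqF.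
have dist0 k q : 0 <= dist1 k q by rewrite addr_ge0.
pose S k := [set f q + n * dist1 k q | q in [set: K2]]%classic.
have lbS k : lbound (S k) (- B).
  move=> _ [q _ <-]; have /ler_normlP[] := fB q; have := mulr_ge0 n0 (dist0 k q); lra.
have Sn0 k : (S k !=set0)%classic by exists (f k + n * dist1 k k); exists k.
have hinf k : has_inf (S k) by split; [exact: Sn0|exists (- B); exact: lbS].
pose g k := inf (S k).
have gle k q : g k <= f q + n * dist1 k q.
  by apply: ge_inf; [exists (- B); exact: lbS|exists q].
have geg k y : (forall q, y <= f q + n * dist1 k q) -> y <= g k.
  by move=> h; apply: lb_le_inf => // _ [q _ <-].
have tri k k' q : dist1 k q <= dist1 k' q + (`|k.1 - k'.1| + `|k.2 - k'.2|).
  rewrite /dist1; have := ler_distD k'.1 k.1 q.1; have := ler_distD k'.2 k.2 q.2; lra.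
have lip1 k k' r : `|k.1 - k'.1| <= r -> `|k.2 - k'.2| <= r -> g k <= g k' + 2 * n * r.
  move=> h1 h2; rewrite -lerBlDr; apply: geg => q; rewrite lerBlDr (le_trans (gle k q)) //.
  rewrite -addrA lerD2l -mulrA (mulrCA 2) -mulrDr ler_wpM2l //.
  have := tri k k' q; lra.
(* The factor [2] compares [dist1], a sum over two coordinates, with the sup norm. *)
exists g, (2 * n); split; first by rewrite mulr_ge0.
  move=> k k' r h1 h2; rewrite ler_distl; apply/andP; split; last exact: lip1.
  by rewrite lerBlDr lip1 // distrC.
move=> k; rewrite ler_distl; apply/andP; split; last first.
  apply: le_trans (gle k k) _; rewrite /dist1 !subrr normr0 addr0 mulr0 addr0; lra.
apply: geg => q; have [h|h] := pselect (nbh k d q).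
  have /ler_normlP[_ h1] := hd _ _ h; have := mulr_ge0 n0 (dist0 k q); lra.
have dq : d <= dist1 k q.
  rewrite leNgt; apply/negP => hlt; apply: h; split; rewrite distrC; apply: le_lt_trans hlt.
    by rewrite lerDl.
  by rewrite lerDr.
have := ler_wpM2l n0 dq; rewrite nd.
have /ler_normlP[_ h1] := fB k; have /ler_normlP[h2 _] := fB q; lra.
Qed.

Definition clamp (c r x : R) : R := Num.max (c - r) (Num.min x (c + r)).

Lemma clamp_box c r x : 0 <= r -> `|clamp c r x - c| <= r.
Proof.
move=> r0; rewrite ler_distl /clamp le_max lexx /= ge_max ge_min lexx orbT andbT; lra.
Qed.

Lemma clamp_id c r x : `|x - c| <= r -> clamp c r x = x.
Proof. by rewrite ler_distl /clamp => /andP[h1 h2]; rewrite (min_idPl h2); apply/max_idPr. Qed.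

Lemma max_lip (a x y : R) : `|Num.max a x - Num.max a y| <= `|x - y|.
Proof.
have h := max0_lip (x - a) (y - a).
have e z : Num.max a z = Num.max 0 (z - a) + a by rewrite -[in RHS](subrr a) -addr_maxl subrK.
have -> : Num.max a x - Num.max a y = Num.max 0 (x - a) - Num.max 0 (y - a) by rewrite !e; ring.
by have <- : x - a - (y - a) = x - y by ring.
Qed.

Lemma min_lip (a x y : R) : `|Num.min x a - Num.min y a| <= `|x - y|.
Proof.
have e z : Num.min z a = - Num.max (- a) (- z) by rewrite oppr_max !opprK minC.
rewrite !e -opprD normrN (le_trans (max_lip _ _ _)) //.
by rewrite -opprD normrN.
Qed.

Lemma clamp_lip c r x y : `|clamp c r x - clamp c r y| <= `|x - y|.
Proof. exact: le_trans (max_lip _ _ _) (min_lip _ _ _). Qed.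

(** Composing [f] with the coordinatewise projection [clamp], which does not increase distances,
    makes it bounded and uniformly continuous on the whole plane without changing it on the box. *)
Lemma lipschitz_approx_box (f : K2 -> R) c r e : 0 <= r -> 0 < e ->
  (forall k, box c r k -> forall e', 0 < e' ->
     exists2 d, 0 < d & forall k', nbh k d k' -> `|f k' - f k| < e') ->
  exists g L, [/\ 0 <= L,
    forall k k' s, `|k.1 - k'.1| <= s -> `|k.2 - k'.2| <= s -> `|g k - g k'| <= L * s
    & forall k, box c r k -> `|g k - f k| <= e].
Proof.
move=> r0 e0 fc; pose cl (k : K2) := (clamp c.1 r k.1, clamp c.2 r k.2).
have clb k : box c r (cl k) by split; exact: clamp_box.
have clid k : box c r k -> cl k = k by case: k => x y [h1 h2]; rewrite /cl /= !clamp_id.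
have [d d0 hd] : exists2 d, 0 < d & forall k, box c r k ->
    forall k', box c r k' -> nbh k d k' -> `|f k - f k'| <= e.
  apply: (@box_uniform _ _ _ (fun d k => forall k', box c r k' -> nbh k d k' -> `|f k - f k'| <= e)).
  move=> k hk; have [|d d0 hd] := fc k hk (e / 2); first by rewrite divr_gt0.
  exists (d / 2); first by rewrite divr_gt0.
  move=> k' s hk' s0 sd k'' _ hk''.
  have h1 : `|f k' - f k| < e / 2 by apply: hd; apply: nbh_le hk'; lra.
  have h2 : `|f k'' - f k| < e / 2.
    apply: hd; case: hk' => a1 a2; case: hk'' => b1 b2; split.
      have := ler_distD k'.1 k''.1 k.1; lra.
    have := ler_distD k'.2 k''.2 k.2; lra.
  have := ler_distD (f k) (f k') (f k''); rewrite (distrC (f k) (f k'')); lra.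
have [B hB] : exists B, forall k, box c r k -> `|f k| <= B.
  (* [box_uniform] yields small constants, so an upper bound is obtained as the inverse of one. *)
  have [B B0 hB] : exists2 B, 0 < B & forall k, box c r k -> `|f k| <= B^-1.
    apply: box_uniform => k hk; have [|d1 d10 hd1] := fc k hk 1 _; first exact: ltr01.
    have n1 : 0 < 1 + `|f k| by rewrite ltr_pwDl.
    exists (Num.min d1 (1 + `|f k|)^-1); first by rewrite lt_min d10 invr_gt0.
    move=> k' s hk' s0; rewrite lt_min => /andP[s1 s2].
    have : `|f k' - f k| < 1 by apply: hd1; apply: nbh_le hk'; rewrite ge_min lexx.
    have s3 : 1 + `|f k| <= s^-1 by rewrite -[X in X <= _]invrK lef_pV2 ?ltW ?posrE ?invr_gt0.
    have := ler_normD (f k' - f k) (f k); rewrite subrK; lra.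
  by exists B^-1.
have [|||g [L [L0 gL gf]]] := @lipschitz_approx (fun k => f (cl k)) B e => //.
- by move=> k; apply: hB.
- exists d => // k k' [h1 h2]; apply: hd => //; split=> /=.
    exact: le_lt_trans (clamp_lip _ _ _ _) h1.
  exact: le_lt_trans (clamp_lip _ _ _ _) h2.
by exists g, L; split=> // k /clid {2}<-.
Qed.

End LipschitzApproximation.

(** * Cayley charts *)

Section CayleyChart.
Variable R : realType.
Local Notation C := R[i].
Variable m : nat.
Implicit Types (h : 'M[C]_m) (U : 'M[C]_m) (mu : C).
Local Notation I := ('i%C : C).

Lemma i_sqr : I * I = -1.
Proof. by rewrite -expr2 sqr_i. Qed.

Definition chart mu h : 'M[C]_m := mu *: ((1%:M + I *: h) *m invmx (1%:M - I *: h)).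
Definition chart_inv mu U : 'M[C]_m := - I *: ((U - mu%:M) *m invmx (U + mu%:M)).

Lemma adjZ n p z (A : 'M[C]_(n, p)) : (z *: A)^t* = conjc z *: A^t*.
Proof. by apply/matrixP => a b; rewrite !mxE rmorphM. Qed.

Lemma adj1 : (1%:M : 'M[C]_m)^t* = 1%:M.
Proof. by rewrite trmx1 map_mx1. Qed.

Lemma conj_i : conjc I = - I.
Proof. by apply/eqP; rewrite eq_complex /= oppr0 !eqxx. Qed.

(** A row vector with [v = i v h] has [v v^t*] equal to [i] times the self-adjoint [v h v^t*].
    Taking adjoints flips the sign, so [v v^t*] vanishes. *)
Lemma chart_den_unit h : h^t* = h -> 1%:M - I *: h \in unitmx.
Proof.
move=> hh; rewrite -row_free_unit -kermx_eq0; apply/eqP/row_matrixP => i; rewrite row0.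
set v := row i _; have : v *m (1%:M - I *: h) = 0 by rewrite -row_mul mulmx_ker row0.
rewrite mulmxBr mulmx1 -scalemxAr => /eqP; rewrite subr_eq0 => /eqP vE.
have s1 : v *m v^t* = I *: (v *m h *m v^t*) by rewrite {1}vE -scalemxAl.
have s2 : v *m v^t* = - I *: (v *m h *m v^t*).
  have : (v *m v^t*)^t* = v *m v^t* by rewrite adj_mul trmxCK.
  by rewrite {1}s1 adjZ !adj_mul trmxCK hh conj_i mulmxA => <-.
have vv0 : v *m v^t* = 0.
  apply/eqP; rewrite -(inj_eq (scalerI (_ : (2 : C) != 0))) ?pnatr_eq0 // scaler0.
  by rewrite -[X in X *: _]/(1 + 1) scalerDl scale1r {1}s1 s2 scaleNr addrN.
apply/rowP => j; have /matrixP/(_ 0 0) := vv0; rewrite [LHS]mxE [RHS]mxE.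
have vvE (k : 'I_m) : v 0 k * (v^t*) k 0 = (normc (v 0 k) ^+ 2)%:C%C.
  by rewrite normc_sqr !mxE.
under eq_bigr do rewrite vvE.
rewrite -(rmorph_sum (real_complex R)) => -[] /eqP.
rewrite psumr_eq0 => [/allP/(_ j)|k _]; last by rewrite exprn_ge0 ?normc_ge0.
rewrite mem_index_enum => /(_ isT) /=; rewrite sqrf_eq0 => /eqP /eq0_normc ->.
by rewrite mxE.
Qed.

Lemma chart_unitary mu h : normc mu = 1 -> h^t* = h -> chart mu h \is unitarymx.
Proof.
move=> mu1 hh; have hD := chart_den_unit hh.
have hU : (1%:M + I *: h) *m invmx (1%:M - I *: h) \is unitarymx.
  apply: unitarymx_ratio hD; rewrite adjD adjB adjZ adj1 hh conj_i scaleNr opprK.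
  move: (I *: h) => x; rewrite [LHS]mulmxDr mulmx1 mulmxBl mul1mx addrA subrK.
  by rewrite mulmxBr mulmx1 mulmxDl mul1mx opprD addrA addrK.
apply/unitarymxP; rewrite /chart adjZ -scalemxAl -scalemxAr scalerA.
by rewrite (normc1_conj mu1) scale1r; apply/unitarymxP.
Qed.

Lemma chart_alt mu h : h^t* = h -> chart mu h = mu *: ((2 : C) *: invmx (1%:M - I *: h) - 1%:M).
Proof.
move=> hh; congr (_ *: _); have hD := chart_den_unit hh.
have -> : 1%:M + I *: h = (2 : C) *: 1%:M - (1%:M - I *: h).
  have -> : (2 : C) = 1 + 1 by [].
  by rewrite scalerDl scale1r opprB addrA addrAC addrK addrC.
by rewrite mulmxBl -scalemxAl mul1mx (mulmxV hD).
Qed.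

(** By [chart_alt] twice this inverse is a unitary matrix plus [1], so its entries are bounded
    independently of [h]. *)
Lemma chart_den_le h : h^t* = h -> mle 1 (invmx (1%:M - I *: h)).
Proof.
move=> hh a b; have := unitarymx_mle (chart_unitary (normc1 R) hh) a b.
have := chart_alt 1 hh; rewrite scale1r => /matrixP/(_ a b) ->; rewrite !mxE.
move: (invmx _ a b) => z hz.
have h2 : normc (2 * z) <= 1 + 1.
  rewrite -[2 * z](subrK ((a == b)%:R)) (le_trans (le_normcD _ _)) // lerD //.
  by case: (a == b); rewrite ?normc0 ?normc1.
by move: h2; rewrite normcM normc_nat; clear; lra.
Qed.

(** The resolvent identity together with [chart_den_le]: the Lipschitz constant is the same on the
    whole chart, so errors in [h] are controlled without any bound on [h] itself. *)
Lemma chart_close mu h h' e : normc mu = 1 -> h^t* = h -> h'^t* = h' -> mle e (h' - h) ->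
  mle (2 * (m%:R * (m%:R * e))) (chart mu h' - chart mu h).
Proof.
move=> mu1 hh hh' he; have hD := chart_den_unit hh; have hD' := chart_den_unit hh'.
have le1 := chart_den_le hh; have le2 := chart_den_le hh'.
have -> : chart mu h' - chart mu h =
    (mu * 2 * I) *: (invmx (1%:M - I *: h') *m (h' - h) *m invmx (1%:M - I *: h)).
  rewrite !chart_alt // -scalerBr opprB addrA subrK -scalerBr -!scalerA.
  congr (_ *: (_ *: _)); have -> : h' - h = - I *: ((1%:M - I *: h) - (1%:M - I *: h')).
    rewrite [X in _ *: X](_ : _ = I *: (h' - h)).
      by rewrite scalerA mulNr i_sqr opprK scale1r.
    by rewrite scalerBr opprB [LHS]addrC addrA subrK.
  rewrite -scalemxAr -scalemxAl scalerA mulrN i_sqr opprK scale1r mulmxBr mulmxBl.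
  by rewrite (mulVmx hD') mul1mx -mulmxA (mulmxV hD) mulmx1.
have := mleZ (mu * 2 * I) (mleM (mleM le2 he) le1).
by rewrite !normcM mu1 normc_i normc_nat !mul1r !mulr1.
Qed.

(** The chart keeps the eigenvectors and acts on eigenvalues by the injective map
    [x -> mu (1 + i x) / (1 - i x)]. *)
Lemma chart_simple mu h : normc mu = 1 -> h^t* = h -> disc h != 0 -> disc (chart mu h) != 0.
Proof.
move=> mu1 hh; have [V [d [hV hE dre]]] := hermitian_diag hh.
rewrite {1}hE => /(disc_neq0 d hV) dinj.
have VV := unitarymx_adjK hV; have VV' := unitarymx_mul_adj hV.
have hD := chart_den_unit hh.
have den0 (x : R) : 1 - I * x%:C%C != 0.
  by apply/eqP => /eqP; rewrite eq_complex /= mul0r mul1r subrr subr0 oner_eq0.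
pose c := \row_p (mu * ((1 + I * d 0 p) / (1 - I * d 0 p))).
have -> : chart mu h = V *m diag_mx c *m V^t*.
  have lin (z : C) : 1%:M + z *: h = V *m diag_mx (\row_p (1 + z * d 0 p)) *m V^t*.
    have -> : diag_mx (\row_p (1 + z * d 0 p)) = 1%:M + z *: diag_mx d.
      by apply/matrixP => a b; rewrite !mxE; case: (a == b); rewrite ?mulr1n ?mulr0n ?mulr0 ?addr0.
    by rewrite mulmxDr mulmx1 mulmxDl VV' -scalemxAr -scalemxAl -hE.
  rewrite /chart scalemxAl; apply: (canLR (mulmxK hD)).
  have -> : 1%:M - I *: h = 1%:M + (- I) *: h by rewrite scaleNr.
  rewrite !lin !mulmxA -(mulmxA _ (V^t*) V) VV mulmx1 -(mulmxA V (diag_mx c)) mulmx_diag.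
  rewrite scalemxAl scalemxAr; congr (V *m _ *m V^t*).
  apply/matrixP => a b; rewrite !mxE; case: (a == b); rewrite ?mulr1n ?mulr0n ?mulr0 //.
  by rewrite mulNr -mulrA divfK // dre den0.
have cE p : c 0 p = mu * ((1 + I * d 0 p) / (1 - I * d 0 p)) by rewrite mxE.
have mu0 : mu != 0 by rewrite -normc_gt0 mu1.
apply/(disc_neq0 c hV) => p q; rewrite !cE => /(mulfI mu0) e; apply: dinj.
have dp0 : 1 - I * d 0 p != 0 by rewrite dre den0.
have dq0 : 1 - I * d 0 q != 0 by rewrite dre den0.
have i0 : I != 0 by rewrite -normc_gt0 normc_i.
move/eqP: e; rewrite eqr_div // => /eqP e.
have : 2 * I * (d 0 p - d 0 q) = (1 + I * d 0 p) * (1 - I * d 0 q) -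
  (1 + I * d 0 q) * (1 - I * d 0 p) by ring.
rewrite e subrr => /eqP; rewrite !mulf_eq0 pnatr_eq0 (negbTE i0) /= subr_eq0 => /eqP //.
Qed.

End CayleyChart.

(** * Removing degeneracies inside one chart *)

Section LocalSimple.
Variable R : realType.
Local Notation C := R[i].
Local Notation K2 := (R * R)%type.
Variable m : nat.
Implicit Types (h U : 'M[C]_m) (mu : C).
Local Notation I := ('i%C : C).

Lemma chart_inv_adj mu U : normc mu = 1 -> U \is unitarymx -> U + mu%:M \in unitmx ->
  (chart_inv mu U)^t* = chart_inv mu U.
Proof.
move=> mu1 hU hP; have adjmu : (mu%:M : 'M[C]_m)^t* = (conjc mu)%:M.
  by rewrite tr_scalar_mx map_scalar_mx.
have UU := unitarymx_adjK hU; have mm := normc1_conj mu1.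
have cI : conjc (- I) = I by apply/eqP; rewrite eq_complex /= !oppr0 opprK !eqxx.
have key : (U - mu%:M)^t* *m (U + mu%:M) = - ((U + mu%:M)^t* *m (U - mu%:M)).
  have ba : (conjc mu)%:M *m mu%:M = 1%:M :> 'M[C]_m by rewrite -scalar_mxM mulrC mm.
  rewrite adjB adjD adjmu !mulmxDl !mulmxDr !mulNmx !mulmxN UU ba.
  move: (_ *m _) (_ *m _) (1%:M) => x y z.
  by apply/matrixP => i j; rewrite !mxE; ring.
rewrite /chart_inv adjZ cI adj_mul scaleNr -scalerN; congr (_ *: _).
rewrite -[LHS]mulmx1 -(mulmxV hP) !mulmxA -(mulmxA _ _ (U + _)) key mulmxN mulNmx mulmxA.
by rewrite -adj_mul (mulmxV hP) adj1 mul1mx.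
Qed.

Lemma chart_invK mu U : normc mu = 1 -> U + mu%:M \in unitmx -> chart mu (chart_inv mu U) = U.
Proof.
move=> mu1 hP; have mu0 : mu != 0 by rewrite -normc_gt0 mu1.
have two : (2 : C) != 0 by rewrite pnatr_eq0.
have Ih : I *: chart_inv mu U = (U - mu%:M) *m invmx (U + mu%:M).
  by rewrite scalerA mulrN i_sqr opprK scale1r.
have hN : 1%:M + I *: chart_inv mu U = (2 : C) *: U *m invmx (U + mu%:M).
  rewrite Ih -{1}(mulmxV hP) -mulmxDl; congr (_ *m _).
  by rewrite addrACA subrr addr0 -[RHS]/((1 + 1) *: U) scalerDl scale1r.
have hD : 1%:M - I *: chart_inv mu U = ((2 * mu) *: 1%:M) *m invmx (U + mu%:M).
  rewrite Ih -{1}(mulmxV hP) -mulmxBl; congr (_ *m _).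
  rewrite opprB addrC addrA subrK scale_scalar_mx mulr1.
  by rewrite -[2 * mu]/((1 + 1) * mu) mulrDl mul1r (raddfD (@scalar_mx _ m)).
have hDu : ((2 * mu) *: 1%:M) *m invmx (U + mu%:M) \in unitmx.
  by rewrite unitmx_mul unitmx_inv hP unitmxZ ?unitmx1 // unitfE mulf_neq0.
rewrite /chart scalemxAl; apply: (canLR (mulmxK _)); rewrite hD ?hN //.
rewrite scalemxAl scalerA mulmxA -scalemxAr mulmx1 (mulrC mu); reflexivity.
Qed.

Lemma herm_ofB (q q' : 'I_m * 'I_m -> R) :
  herm_of q - herm_of q' = herm_of (fun t => q t - q' t).
Proof.
apply/matrixP => a b; rewrite !mxE; case: ifP => _; first by rewrite -rmorphB.
by case: ifP => _ //; apply/eqP; rewrite eq_complex /= !eqxx /= ?opprB ?opprK; apply/eqP; ring.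
Qed.

Lemma chart_tendsto X (N : R -> X -> Prop) (hN : forall d d' x, d <= d' -> N d x -> N d' x)
    mu (F : X -> 'M[C]_m) h : h^t* = h ->
  tendsto_mx N F h -> tendsto_mx N (fun x => chart mu (F x)) (chart mu h).
Proof.
move=> hh hF; have hD := chart_den_unit hh.
have hI : tendsto_mx N (fun x => I *: F x) (I *: h).
  by apply: tendsto_mxZ => //; exact: tendsto_cst.
apply: tendsto_mxZ => //; first exact: tendsto_cst.
apply: tendsto_mxM => //; first by apply: tendsto_mxD => //; exact: tendsto_mx_cst.
apply: tendsto_mxV => //; apply: tendsto_mxD => //; first exact: tendsto_mx_cst.
exact: tendsto_mxN.
Qed.

Lemma chart_inv_tendsto X (N : R -> X -> Prop) (hN : forall d d' x, d <= d' -> N d x -> N d' x)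
    mu (F : X -> 'M[C]_m) U : U + mu%:M \in unitmx ->
  tendsto_mx N F U -> tendsto_mx N (fun x => chart_inv mu (F x)) (chart_inv mu U).
Proof.
move=> hP hF.
apply: tendsto_mxZ => //; first exact: tendsto_cst.
apply: tendsto_mxM => //; first by apply: tendsto_mxD => //; exact: tendsto_mx_cst.
by apply: tendsto_mxV => //; apply: tendsto_mxD => //; exact: tendsto_mx_cst.
Qed.

Lemma tendsto_herm_coord X (N : R -> X -> Prop) (F : X -> 'M[C]_m) h t :
  tendsto_mx N F h -> forall e, 0 < e ->
  exists2 d, 0 < d & forall x, N d x -> `|herm_coord (F x) t - herm_coord h t| < e.
Proof.
move=> hF e e0; rewrite /herm_coord; case: ifP => _.
  have [d d0 hd] := hF t.1 t.2 e e0; exists d => // x /hd.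
  by apply: le_lt_trans; rewrite (le_trans _ (le_normc_Re _)) //; case: (F _ _ _); case: (h _ _).
have [d d0 hd] := hF t.2 t.1 e e0; exists d => // x /hd.
by apply: le_lt_trans; rewrite (le_trans _ (le_normc_Im _)) //; case: (F _ _ _); case: (h _ _).
Qed.

(** Approximating the real coordinates [herm_coord] instead of the complex entries keeps the result
    Hermitian. *)
Lemma herm_lipschitz_approx (h : K2 -> 'M[C]_m) c r e : 0 <= r -> 0 < e ->
  (forall k, box c r k -> (h k)^t* = h k /\ tendsto_mx (nbh k) h (h k)) ->
  exists g L, [/\ 0 <= L, forall k, (g k)^t* = g k,
    forall k k' s, `|k.1 - k'.1| <= s -> `|k.2 - k'.2| <= s -> mle (L * s) (g k - g k')
    & forall k, box c r k -> mle e (g k - h k)].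
Proof.
move=> r0 e0 hc; have e2 : 0 < e / 2 by rewrite divr_gt0.
have ex (t : 'I_m * 'I_m) : exists gL : (K2 -> R) * R, [/\ 0 <= gL.2,
    forall k k' s, `|k.1 - k'.1| <= s -> `|k.2 - k'.2| <= s -> `|gL.1 k - gL.1 k'| <= gL.2 * s
    & forall k, box c r k -> `|gL.1 k - herm_coord (h k) t| <= e / 2].
  have [|g [L [L0 gL gf]]] := @lipschitz_approx_box _ (fun k => herm_coord (h k) t) c r (e / 2) r0 e2.
    by move=> k /hc [_ hk] e' e'0; exact: tendsto_herm_coord.
  by exists (g, L).
have [G hG] := choice ex.
pose L := \sum_t (G t).2.
have L0 : 0 <= L by rewrite /L sumr_ge0 // => t _; case: (hG t).
have LG t : (G t).2 <= L.
  by rewrite /L (bigD1 t) //= lerDl sumr_ge0 // => t' _; case: (hG t').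
exists (fun k => herm_of (fun t => (G t).1 k)), (2 * L); split.
- by rewrite mulr_ge0.
- by move=> k; exact: herm_of_adj.
- move=> k k' s h1 h2; rewrite herm_ofB -mulrA; apply: herm_of_le => t.
  have [_ h3 _] := hG t; apply: le_trans (h3 _ _ _ h1 h2) _; apply: ler_wpM2r => //.
  by apply: le_trans h1.
- move=> k hk; have [hh _] := hc k hk; rewrite -[h k](herm_coordK hh) herm_ofB.
  apply: mle_le (_ : 2 * (e / 2) <= e) _; first by rewrite mulrC divfK ?pnatr_eq0.
  by apply: herm_of_le => t; have [_ _ h3] := hG t; exact: h3.
Qed.

(** [be] is unitary and continuous on the whole plane because [chart] is defined for every Hermitian
    matrix. It is not asked to be periodic or matching; [free_patch] restores both properties. *)
Lemma local_simple (al : K2 -> 'M[C]_m) c r mu dl : 0 <= r -> 0 < dl -> normc mu = 1 ->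
  fam_cont al -> (forall k, al k \is unitarymx) ->
  (forall k, box c r k -> al k + mu%:M \in unitmx) ->
  exists be, [/\ fam_cont be, forall k, be k \is unitarymx
    & forall k, box c r k -> mle dl (be k - al k) /\ disc (be k) != 0].
Proof.
move=> r0 dl0 mu1 alc alu alP.
(* [2 m ^ 2] is the Lipschitz constant in [chart_close]. The error [dl / M] is shared equally by the
   Lipschitz approximation and the constant shift, hence the extra [/ 2] in [e]. *)
pose M := 2 * (m%:R * m%:R) + 1 : R.
have M0 : 0 < M by rewrite ltr_wpDl // !mulr_ge0.
pose e := dl / M / 2; have e0 : 0 < e by rewrite !divr_gt0.
pose h k := chart_inv mu (al k).
have hh k : box c r k -> (h k)^t* = h k by move=> hk; exact: chart_inv_adj (alu k) (alP k hk).
have [|g [L [L0 gh gL gc]]] := @herm_lipschitz_approx h c r e r0 e0.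
  by move=> k hk; split; [exact: hh|apply: chart_inv_tendsto (alP k hk) (alc k); exact: nbh_le].
pose K0 := `|c.1| + `|c.2| + r + 1.
have K00 : 0 < K0 by rewrite ltr_wpDl // !addr_ge0.
have [X [hX Xe hXs]] := hermitian_perturbation L0 K00 e0 gh gL.
have gX k : (g k + X)^t* = g k + X by rewrite adjD gh hX.
exists (fun k => chart mu (g k + X)); split.
- move=> k; apply: chart_tendsto (gX k) _; first exact: nbh_le.
  apply: tendsto_mxD (tendsto_mx_cst _ _); first exact: nbh_le.
  apply/(tendsto_mxP (@nbh_le _ k)) => d d0.
  exists (d / (L + 1)); first by rewrite divr_gt0 // ltr_wpDl.
  move=> k' [h1 h2]; have := gL k' k _ (ltW h1) (ltW h2); apply: mle_le.
  by rewrite mulrA ler_pdivrMr ?ltr_wpDl // mulrDr mulr1 mulrC lerDl ltW.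
- by move=> k; exact: chart_unitary.
- move=> k hk; split.
    rewrite -[al k](chart_invK mu1 (alP k hk)).
    have : mle (e + e) (g k + X - h k) by rewrite addrAC; apply: mleD Xe; exact: gc.
    move/(chart_close mu1 (hh k hk) (gX k)); apply: mle_le.
    have -> : e + e = dl / M by rewrite /e; field; rewrite gt_eqF.
    have -> : 2 * (m%:R * (m%:R * (dl / M))) = dl * (2 * (m%:R * m%:R) / M) by ring.
    by rewrite ler_piMr ?(ltW dl0) // ler_pdivrMr // mul1r /M lerDl.
  apply: chart_simple => //; apply: hXs; case: hk => h1 h2; rewrite /K0.
    by have := ler_normD (k.1 - c.1) c.1; rewrite subrK; have := normr_ge0 c.2; lra.
  by have := ler_normD (k.2 - c.2) c.2; rewrite subrK; have := normr_ge0 c.1; lra.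
Qed.

End LocalSimple.

(** * Points on the unit circle *)

Section UnitNumbers.
Variable R : realType.
Local Notation C := R[i].
Local Notation I := ('i%C : C).

Definition unit_of (x : R) : C := (1 + I * x%:C%C) / (1 - I * x%:C%C).

Lemma one_sub_ix_neq0 x : 1 - I * x%:C%C != 0.
Proof.
by apply/eqP => /eqP; rewrite eq_complex /= mul0r mul1r subrr subr0 oner_eq0.
Qed.

Lemma normc_unit_of x : normc (unit_of x) = 1.
Proof.
have -> : unit_of x = (1 - I * x%:C%C)^* / (1 - I * x%:C%C).
  congr (_ / _); apply/eqP; rewrite eq_complex /=; apply/andP; split; apply/eqP; ring.
rewrite normcM normcV normc_conj divff //.
by rewrite gt_eqF // normc_gt0 one_sub_ix_neq0.
Qed.

Lemma unit_of_inj : injective unit_of.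
Proof.
move=> x y /eqP; rewrite eqr_div ?one_sub_ix_neq0 // => /eqP e.
have : 2 * I * (x%:C%C - y%:C%C) = (1 + I * x%:C%C) * (1 - I * y%:C%C) -
  (1 + I * y%:C%C) * (1 - I * x%:C%C) by ring.
have i0 : I != 0 by rewrite -normc_gt0 normc_i.
rewrite e subrr => /eqP; rewrite !mulf_eq0 pnatr_eq0 (negbTE i0) /= subr_eq0.
by move=> /eqP [].
Qed.

Lemma unit_of_close x : normc (unit_of x - 1) <= 2 * `|x|.
Proof.
have -> : unit_of x - 1 = 2 * I * x%:C%C / (1 - I * x%:C%C).
  by rewrite /unit_of; field; rewrite one_sub_ix_neq0.
rewrite !normcM normcV normc_i normc_nat normc_real mulr1 ler_piMr ?mulr_ge0 //.
rewrite invf_le1 ?normc_gt0 ?one_sub_ix_neq0 //.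
have /ler_normlW := le_normc_Re (1 - I * x%:C%C).
by rewrite /= mul0r mul1r subrr subr0.
Qed.

(** The [m + 1] distinct numbers [- unit_of n] cannot all be roots of the characteristic
    polynomial. *)
Lemma exists_shift m (U : 'M[C]_m) : exists2 mu, normc mu = 1 & U + mu%:M \in unitmx.
Proof.
apply: contrapT => h.
have hroot mu : normc mu = 1 -> root (char_poly U) (- mu).
  move=> mu1; rewrite -eigenvalue_root_char; apply/negP => hne; apply: h; exists mu => //.
  move: hne; rewrite /eigenspace kermx_eq0 row_free_unit.
  by rewrite raddfN /= opprK.
pose rs := [seq - unit_of n%:R | n <- iota 0 m.+1].
have := @max_poly_roots _ (char_poly U) rs; rewrite size_char_poly size_map size_iota ltnn.
have -> : char_poly U != 0 by rewrite monic_neq0 // char_poly_monic.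
move=> /(_ isT) hr; suff : false by []; apply: hr.
  by apply/allP => _ /mapP [n _ ->]; apply: hroot; exact: normc_unit_of.
rewrite map_inj_uniq ?iota_uniq // => a b /oppr_inj /unit_of_inj /eqP.
by rewrite eqr_nat => /eqP.
Qed.

(** Turning [z] by [unit_of (e / 2 / n.+1)] gives infinitely many candidates within [e] of [z], of
    which the list already built can exclude only finitely many. *)
Lemma distinct_units (s : seq C) e : 0 < e -> all (fun z => normc z == 1) s ->
  exists s', [/\ size s' = size s, uniq s', all (fun z => normc z == 1) s'
    & forall i, (i < size s)%N -> normc (s'`_i - s`_i) <= e].
Proof.
move=> e0; elim: s => [|z s IH]; first by exists [::].
move=> /= /andP[/eqP z1 /IH [s' [sz us as' hs]]].
pose cand (n : nat) : C := z * unit_of (e / 2 / n.+1%:R).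
have [n hn] : exists n, cand n \notin s'.
  apply: contrapT => h; pose l := [seq cand n | n <- iota 0 (size s').+1].
  suff : (size l <= size s')%N by rewrite size_map size_iota ltnn.
  apply: uniq_leq_size.
    rewrite map_inj_uniq ?iota_uniq // => a b.
    have z0 : z != 0 by rewrite -normc_gt0 z1.
    move=> /(mulfI z0) /unit_of_inj /mulfI; rewrite gt_eqF ?divr_gt0 // => /(_ isT) /invr_inj /eqP.
    by rewrite eqr_nat eqSS => /eqP.
  by move=> _ /mapP [n _ ->]; apply: contrapT => /negP hn; apply: h; exists n.
exists (cand n :: s'); split=> /=.
- by rewrite sz.
- by rewrite hn.
- by rewrite as' normcM z1 normc_unit_of mulr1 eqxx.
- case=> [|i] /=; last by rewrite ltnS; exact: hs.
  move=> _; rewrite /cand -[X in _ - X]mulr1 -mulrBr normcM z1 mul1r.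
  rewrite (le_trans (unit_of_close _)) // ger0_norm; last by rewrite !divr_ge0 ?ltW.
  rewrite [2 * _]mulrC mulrAC divfK ?pnatr_eq0 // ?ler_pdivrMr ?ltr0n // ?ler_peMr ?ler1n ?(ltW e0) //.
Qed.

End UnitNumbers.

(** * Local models at the high-symmetry points *)

Section AdaptedBases.
Variable R : realType.
Local Notation C := R[i].
Variable m : nat.
Implicit Types (A E : 'M[C]_m).

Definition conjmx n p (A : 'M[C]_(n, p)) : 'M[C]_(n, p) := map_mx Num.conj A.

Lemma conjmxK n p (A : 'M[C]_(n, p)) : conjmx (conjmx A) = A.
Proof. by apply/matrixP => i j; rewrite !mxE conjCK. Qed.

Lemma conjmxM n p q (A : 'M[C]_(n, p)) (B : 'M[C]_(p, q)) :
  conjmx (A *m B) = conjmx A *m conjmx B.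
Proof. exact: map_mxM. Qed.

Lemma conjmx_adj n p (A : 'M[C]_(n, p)) : conjmx (A^t*) = A^T.
Proof. by apply/matrixP => i j; rewrite !mxE conjCK. Qed.

Lemma adj_conjmx n p (A : 'M[C]_(n, p)) : (conjmx A)^t* = A^T.
Proof. by apply/matrixP => i j; rewrite !mxE conjCK. Qed.

Lemma conjmx_tr n p (A : 'M[C]_(n, p)) : (conjmx A)^T = A^t*.
Proof. by apply/matrixP => i j; rewrite !mxE. Qed.

Lemma eigen_adj n A (V : 'M[C]_(m, n)) (d : 'rV_n) : A \is unitarymx -> V^t* *m V = 1%:M ->
  A *m V = V *m diag_mx d -> A^t* *m V = V *m (diag_mx d)^t*.
Proof.
move=> hA VV AV; have DD : (diag_mx d)^t* *m diag_mx d = 1%:M.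
  have : (A *m V)^t* *m (A *m V) = 1%:M.
    by rewrite adj_mul -mulmxA (mulmxA (A^t*)) (unitarymx_adjK hA) mul1mx.
  by rewrite AV adj_mul -mulmxA (mulmxA (V^t*)) VV mul1mx.
have /(congr1 (mulmx (A^t*))) := AV; rewrite !mulmxA (unitarymx_adjK hA) mul1mx => {2}->.
by rewrite -[RHS]mulmxA (mulmx1C DD) mulmx1.
Qed.

(* The orthogonal projection off the span of [V] commutes with [A], so it maps some vector of
   an eigenbasis of [A] to a nonzero eigenvector. *)
Lemma eigen_extend n A (V : 'M[C]_(m, n)) (d : 'rV_n) : A \is unitarymx -> (n < m)%N ->
  V^t* *m V = 1%:M -> A *m V = V *m diag_mx d ->
  exists (x : 'cV[C]_m) l, [/\ x != 0, A *m x = l *: x & V^t* *m x = 0].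
Proof.
move=> hA nm VV AV; have [P [e [hP AP]]] := normalmx_diag (unitarymx_normal hA).
have AP' : A *m P = P *m diag_mx e by rewrite AP -mulmxA (unitarymx_adjK hP) mulmx1.
pose Q := 1%:M - V *m V^t*.
have QA : A *m Q = Q *m A.
  have VA : V^t* *m A = diag_mx d *m V^t*.
    have /(congr1 (fun B : 'M[C]_(m, n) => B^t*)) := eigen_adj hA VV AV.
    by rewrite !adj_mul !trmxCK.
  by rewrite /Q mulmxBr mulmxBl mulmx1 mul1mx mulmxA AV -!mulmxA VA.
have Q0 : Q *m P != 0.
  apply/negP => /eqP h; have : Q = 0.
    by rewrite -[Q]mulmx1 -(unitarymx_mul_adj hP) mulmxA h mul0mx.
  move/eqP; rewrite subr_eq0 => /eqP h1; have := mxrankM_maxr V (V^t*).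
  by rewrite -h1 mxrank1 => /leq_trans/(_ (rank_leq_row _)); rewrite leqNgt nm.
have [i hi] : exists i, col i (Q *m P) != 0.
  apply: contrapT => h; move/eqP: Q0; apply; apply/matrixP => a i.
  have : col i (Q *m P) = 0 by apply/eqP; apply: contrapT => /negP hi; apply: h; exists i.
  by move=> /colP/(_ a); rewrite !mxE.
have VQ : V^t* *m Q = 0 by rewrite mulmxBr mulmx1 mulmxA VV mul1mx subrr.
exists (col i (Q *m P)), (e 0 i); split=> //; last by rewrite colE !mulmxA VQ !mul0mx.
have -> : A *m col i (Q *m P) = col i (Q *m P *m diag_mx e).
  by rewrite !colE !mulmxA QA -(mulmxA Q A) AP' !mulmxA.
by apply/colP => a; rewrite mul_mx_diag !mxE mulrC.
Qed.

(** A real scalar suffices, and it keeps a vector fixed by [conjmx] fixed. *)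
Lemma normalize_vec (x : 'cV[C]_m) : x != 0 ->
  exists c : R, (c%:C%C *: x)^t* *m (c%:C%C *: x) = 1%:M.
Proof.
move=> x0; pose s := \sum_i normc (x i 0) ^+ 2.
have xx : x^t* *m x = (s%:C%C)%:M.
  apply/matrixP => i j; rewrite !ord1 !mxE eqxx mulr1n (rmorph_sum (real_complex R)).
  by apply: eq_bigr => k _; rewrite !mxE mulrC; exact/esym/normc_sqr.
have s0 : 0 < s.
  have [i [xi _]] := argmax_entry x0.
  rewrite /s (bigD1 i) //= ltr_pwDl ?exprn_gt0 ?normc_gt0 // sumr_ge0 // => j _.
  by rewrite exprn_ge0 ?normc_ge0.
exists (Num.sqrt s)^-1; rewrite adjZ -scalemxAl -scalemxAr xx scalerA scale_scalar_mx.
rewrite conjc_real -!rmorphM -expr2 exprVn sqr_sqrtr ?ltW // mulVf ?gt_eqF //.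
Qed.

Lemma adj_row_mx n p q (V : 'M[C]_(q, n)) (W : 'M[C]_(q, p)) :
  (row_mx V W)^t* = col_mx (V^t*) (W^t*).
Proof. by rewrite tr_row_mx map_col_mx. Qed.

Lemma adj0 n p : (0 : 'M[C]_(n, p))^t* = 0.
Proof. by rewrite trmx0 map_mx0. Qed.

Lemma row_mx_extend n A (V : 'M[C]_(m, n)) (d : 'rV_n) (x : 'cV_m) l :
  V^t* *m V = 1%:M -> A *m V = V *m diag_mx d -> x^t* *m x = 1%:M -> A *m x = l *: x ->
  V^t* *m x = 0 -> (row_mx x V)^t* *m row_mx x V = 1%:M /\
  A *m row_mx x V = row_mx x V *m diag_mx (row_mx l%:M d).
Proof.
move=> VV AV xx Ax Vx; have xV : x^t* *m V = 0.
  by rewrite -[LHS]trmxCK adj_mul trmxCK Vx adj0.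
rewrite adj_row_mx mul_col_row VV xx Vx xV -scalar_mx_block; split=> //.
rewrite diag_mx_row mul_mx_row mul_row_block !mulmx0 addr0 add0r AV Ax; congr (row_mx _ _).
by apply/colP => a; rewrite mul_mx_diag !mxE /= mulr1n mulrC.
Qed.

Lemma eigvec_adj A (x : 'cV[C]_m) l : A \is unitarymx -> x^t* *m x = 1%:M -> A *m x = l *: x ->
  A^t* *m x = conjc l *: x.
Proof.
move=> hA xx Ax; have ll : conjc l * l = 1.
  have : (A *m x)^t* *m (A *m x) = 1%:M.
    by rewrite adj_mul -mulmxA (mulmxA (A^t*)) (unitarymx_adjK hA) mul1mx.
  rewrite Ax adjZ -scalemxAl -scalemxAr xx scalerA scale_scalar_mx mulr1.
  by move=> /matrixP/(_ 0 0); rewrite !mxE eqxx !mulr1n.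
have : A^t* *m (A *m x) = x by rewrite mulmxA (unitarymx_adjK hA) mul1mx.
by rewrite Ax -scalemxAr => {2}<-; rewrite scalerA ll scale1r.
Qed.

Lemma normalize_eigvec n A (V : 'M[C]_(m, n)) (x : 'cV[C]_m) l :
  x != 0 -> A *m x = l *: x -> V^t* *m x = 0 -> exists (c : R) (y : 'cV[C]_m),
    [/\ y = c%:C%C *: x, y^t* *m y = 1%:M, A *m y = l *: y & V^t* *m y = 0].
Proof.
move=> x0 Ax Vx; have [c xx] := normalize_vec x0; exists c, (c%:C%C *: x); split=> //.
  by rewrite -scalemxAr Ax !scalerA mulrC.
by rewrite -scalemxAr Vx scaler0.
Qed.

(** For symmetric [A], conjugating [A^t* x = conjc l *: x] shows that complex conjugation preserves
    each eigenspace. So [x + conjmx x], or ['i *: x] when this sum vanishes, is a real eigenvector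
    for the same [l], still orthogonal to the real frame [V]. *)
Lemma real_eigenbasis A : A \is unitarymx -> A^T = A ->
  exists (V : 'M[C]_m) (d : 'rV_m),
    [/\ V \is unitarymx, conjmx V = V & A = V *m diag_mx d *m V^t*].
Proof.
move=> hA At.
have /(_ m (leqnn m)) [V [d [VV cV AV]]] : forall n, (n <= m)%N -> exists (V : 'M[C]_(m, n)) (d : 'rV_n),
    [/\ V^t* *m V = 1%:M, conjmx V = V & A *m V = V *m diag_mx d].
  elim=> [_|n IH nm].
    exists 0, 0; split; [|by apply/matrixP => i []|by apply/matrixP => i []].
    by apply/matrixP => -[].
  have [V [d [VV cV AV]]] := IH (ltnW nm).
  have [x [l [x0 Ax Vx]]] := eigen_extend hA nm VV AV.
  have [_ [x1 [_ xx Ax1 Vx1]]] := normalize_eigvec x0 Ax Vx.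
  have Acx : A *m conjmx x1 = l *: conjmx x1.
    have := congr1 (@conjmx _ _) (eigvec_adj hA xx Ax1).
    rewrite conjmxM conjmx_adj At => ->; apply/matrixP => i j.
    by rewrite !mxE rmorphM; congr (_ * _); exact: conjcK.
  have Vcx : V^t* *m conjmx x1 = 0.
    have -> : V^t* = V^T by rewrite -conjmx_tr cV.
    by rewrite -(conjmx_adj V) -conjmxM Vx1; apply/matrixP => i j; rewrite !mxE conjC0.
  have [y [y0 cy Ay Vy]] : exists y : 'cV[C]_m,
      [/\ y != 0, conjmx y = y, A *m y = l *: y & V^t* *m y = 0].
    have [z0|z0] := eqVneq (x1 + conjmx x1) 0; last first.
      exists (x1 + conjmx x1); split=> //.
      - apply/matrixP => i j; rewrite !mxE rmorphD addrC; congr (_ + _); exact: conjcK.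
      - by rewrite mulmxDr Ax1 Acx scalerDr.
      - by rewrite mulmxDr Vx1 Vcx addr0.
    have cx : conjmx x1 = - x1 by apply/eqP; rewrite -addr_eq0 addrC z0.
    have i0 : ('i%C : C) != 0 by rewrite -normc_gt0 normc_i.
    exists ('i%C *: x1); split.
    - rewrite scaler_eq0 (negbTE i0) /=; apply/eqP => x10.
      move: xx; rewrite x10 mulmx0 => /matrixP/(_ 0 0); rewrite !mxE => /esym/eqP.
      by rewrite oner_eq0.
    - apply/matrixP => i j; have /matrixP/(_ i j) := cx; rewrite !mxE => e.
      rewrite -[LHS]/(conjc _) rmorphM /= -[conjc (x1 i j)]/((x1 i j)^*) e.
      by rewrite -[LHS]/(conjc 'i%C * - x1 i j) conj_i mulrNN.
    - by rewrite -scalemxAr Ax1 !scalerA mulrC.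
    - by rewrite -scalemxAr Vx1 scaler0.
  have [c' [y1 [y1E yy Ay1 Vy1]]] := normalize_eigvec y0 Ay Vy.
  have [h1 h2] := row_mx_extend VV AV yy Ay1 Vy1.
  exists (row_mx y1 V), (row_mx l%:M d); split=> //.
  have cy1 : conjmx y1 = y1.
    rewrite y1E; apply/matrixP => i j; have /matrixP/(_ i j) := cy; rewrite !mxE => e.
    rewrite -[LHS]/(conjc _) rmorphM /= -[conjc (y i j)]/((y i j)^*) e.
    by congr (_ * _); exact: conjc_real.
  rewrite -[in RHS]cy1 -[in RHS]cV.
  by apply/matrixP => i j; rewrite !mxE; case: (@fintype.split 1 n j) => k; rewrite !mxE.
exists V, d; have hV := unitarymx_of_adj VV; split=> //.
by rewrite -AV -mulmxA (unitarymx_mul_adj hV) mulmx1.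
Qed.

End AdaptedBases.

(** * Kramers pairs *)

Section Kramers.
Variable R : realType.
Local Notation C := R[i].
Variable m : nat.
Variables (E A : 'M[C]_m).
Hypothesis hE : E \is unitarymx.
Hypothesis Etr : E^T = - E.
Hypothesis hA : A \is unitarymx.
Hypothesis tA : A = twist E A.

(* Time reversal: an antiunitary operator of square [-1] with [A (theta v) = l (theta v)]
   whenever [A v = l v]. *)
Definition theta n (W : 'M[C]_(m, n)) : 'M[C]_(m, n) := E^t* *m conjmx W.

Lemma theta_eigen n (W : 'M[C]_(m, n)) d : W^t* *m W = 1%:M ->
  A *m W = W *m diag_mx d -> A *m theta W = theta W *m diag_mx d.
Proof.
move=> WW AW; have AE : A *m E^t* = E^t* *m A^T.
  by rewrite {1}tA /twist -!mulmxA (unitarymx_mul_adj hE) mulmx1.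
have := congr1 (@conjmx _ _ _) (eigen_adj hA WW AW).
rewrite !conjmxM !conjmx_adj tr_diag_mx /theta mulmxA AE -!mulmxA => <-.
by [].
Qed.

Lemma theta_adj_theta n p (W : 'M[C]_(m, n)) (W' : 'M[C]_(m, p)) :
  (theta W)^t* *m theta W' = conjmx (W^t* *m W').
Proof.
rewrite /theta adj_mul trmxCK adj_conjmx -mulmxA (mulmxA E) (unitarymx_mul_adj hE) mul1mx.
by rewrite conjmxM conjmx_adj.
Qed.

(** The pairing of [W] with [theta W'] inherits antisymmetry from [E]. For a single column it forces
    [x] and [theta x] to be orthogonal, which is Kramers degeneracy. *)
Lemma adj_theta_tr n p (W : 'M[C]_(m, n)) (W' : 'M[C]_(m, p)) :
  (W^t* *m theta W')^T = - (W'^t* *m theta W).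
Proof.
have EtT : (E^t*)^T = - E^t*.
  apply/matrixP => i j; have /matrixP/(_ i j) := Etr; rewrite !mxE => e.
  by rewrite -[LHS]/(conjc (E i j)) -[E i j]opprK -e rmorphN.
rewrite /theta !trmx_mul EtT conjmx_tr mulmxN mulNmx -[(W^t*)^T]/(_) mulmxA.
congr (- (_ *m _)); by apply/matrixP => i j; rewrite !mxE.
Qed.

Definition kramers_frame n (W : 'M[C]_(m, n)) (d : 'rV[C]_n) :=
  [/\ W^t* *m W = 1%:M, W^t* *m theta W = 0 & A *m W = W *m diag_mx d].

Lemma kramers_full n (W : 'M[C]_(m, n)) d : kramers_frame W d ->
  (row_mx W (theta W))^t* *m row_mx W (theta W) = 1%:M /\
  A *m row_mx W (theta W) = row_mx W (theta W) *m diag_mx (row_mx d d).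
Proof.
move=> [WW WT AW]; have TW : (theta W)^t* *m W = 0.
  by rewrite -[LHS]trmxCK adj_mul trmxCK WT adj0.
rewrite adj_row_mx mul_col_row WW WT TW theta_adj_theta WW.
rewrite diag_mx_row mul_mx_row mul_row_block !mulmx0 addr0 add0r AW (theta_eigen WW AW).
split=> //; rewrite scalar_mx_block; congr block_mx.
by apply/matrixP => i j; rewrite !mxE; case: (_ == _); rewrite ?mulr1n ?mulr0n ?conjC1 ?conjC0.
Qed.

(** Extending the full frame made of [W] and [theta W] gives an eigenvector [x] orthogonal to both.
    That [theta x] is orthogonal to [W] and to [x] then follows from antisymmetry. *)
Lemma kramers_basis n : (n + n <= m)%N ->
  exists (W : 'M[C]_(m, n)) (d : 'rV_n), kramers_frame W d.
Proof.
elim: n => [_|n IH nm].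
  exists 0, 0; split; [by apply/matrixP => -[]|by apply/matrixP => -[]|].
  by apply/matrixP => i [].
have nm' : (n + n < m)%N by move: nm; lia.
have [W [d Wd]] := IH (ltnW nm'); have [VV AV] := kramers_full Wd.
have [x0 [l [x00 Ax0 Vx0]]] := eigen_extend hA nm' VV AV.
have [_ [x [_ xx Ax Vx]]] := normalize_eigvec x00 Ax0 Vx0.
have [WW WT AW] := Wd.
move: Vx; rewrite adj_row_mx mul_col_mx -[0](@col_mx0 _ n n 1) => /eq_col_mx [Wx Tx].
(* The new vector goes in front because [1 + n] computes to [n.+1]. *)
exists (row_mx x W : 'M_(m, 1 + n)), (row_mx l%:M d : 'rV_(1 + n)).
have [h1 h2] := row_mx_extend WW AW xx Ax Wx; split=> //.
have xTx : x^t* *m theta x = 0.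
  have := adj_theta_tr x x; set s := _ *m _ => h.
  have st : s^T = s by apply/matrixP => i j; rewrite mxE !ord1.
  apply/eqP; rewrite -(inj_eq (scalerI (_ : (2 : C) != 0))) ?pnatr_eq0 // scaler0.
  by rewrite -[X in X *: _]/(1 + 1) scalerDl scale1r -{1}st h addNr.
have xTW : x^t* *m theta W = 0.
  by rewrite -[LHS]trmxCK adj_mul trmxCK Tx adj0.
have WTx : W^t* *m theta x = 0.
  by apply: trmx_inj; rewrite adj_theta_tr xTW oppr0 trmx0.
have -> : theta (row_mx x W : 'M_(m, 1 + n)) = row_mx (theta x) (theta W).
  by rewrite /theta -mul_mx_row; congr (_ *m _); exact: map_row_mx.
suff h0 : (row_mx x W)^t* *m row_mx (theta x) (theta W) = 0 by exact: h0.
by rewrite adj_row_mx mul_col_row xTx xTW WTx WT block_mx0.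
Qed.

End Kramers.

(** * Spectra read off from eigenframes *)

Section Spectra.
Variable R : realType.
Local Notation C := R[i].
Variable m : nat.
Implicit Types (A V : 'M[C]_m) (d : 'rV[C]_m).

Definition eigenframe A V d := V^t* *m V = 1%:M /\ A *m V = V *m diag_mx d.

Lemma eigenframe_decomp A V d : eigenframe A V d ->
  V \is unitarymx /\ A = V *m diag_mx d *m V^t*.
Proof.
move=> [VV AV]; have hV := unitarymx_of_adj VV; split=> //.
by rewrite -AV -mulmxA (unitarymx_mul_adj hV) mulmx1.
Qed.

Lemma eigenframe_disc A V d : eigenframe A V d -> (disc A != 0 <-> injective (d 0)).
Proof. by move=> /eigenframe_decomp [hV ->]; exact: disc_neq0. Qed.

Lemma unitarymx_eigenframe A : A \is unitarymx -> exists V d, eigenframe A V d.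
Proof.
move=> hA; have [V [d [hV AV]]] := normalmx_diag (unitarymx_normal hA).
exists V, d; split; first exact: unitarymx_adjK.
by rewrite AV -mulmxA (unitarymx_adjK hV) mulmx1.
Qed.

Definition simple_spec A := exists V d, eigenframe A V d /\ injective (d 0).

Definition double_spec A := exists V d, eigenframe A V d /\
  forall i, exists j, [/\ j != i, d 0 j = d 0 i & forall l, d 0 l = d 0 i -> l = i \/ l = j].

Definition clustered_spec (a : R) A := exists V d, eigenframe A V d /\
  forall i j : 'I_m, i./2 != j./2 -> a <= normc (d 0 i - d 0 j).

Lemma disc_simple_spec A : A \is unitarymx -> disc A != 0 -> simple_spec A.
Proof.
move=> hA; have [V [d Vd]] := unitarymx_eigenframe hA => /(eigenframe_disc Vd).
by exists V, d.
Qed.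

Lemma eigenframe_norm A V d j : A \is unitarymx -> eigenframe A V d -> normc (d 0 j) = 1.
Proof.
move=> hA [VV AV]; have : (A *m V)^t* *m (A *m V) = 1%:M.
  by rewrite adj_mul -mulmxA (mulmxA (A^t*)) (unitarymx_adjK hA) mul1mx.
rewrite AV adj_mul -mulmxA (mulmxA (V^t*)) VV mul1mx tr_diag_mx map_diag_mx mulmx_diag.
move=> /matrixP/(_ j j); rewrite !mxE eqxx !mulr1n mulrC => h.
have h1 : (normc (d 0 j) ^+ 2)%:C%C = 1%:C%C by rewrite normc_sqr.
move: h1 => /complexI /eqP; rewrite sqrf_eq1 => /orP[/eqP //|/eqP h1].
by have := normc_ge0 (d 0 j); rewrite h1 ler0N1.
Qed.

Lemma distinct_units_row n (d : 'rV[C]_n) e : 0 < e -> (forall i, normc (d 0 i) = 1) ->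
  exists d' : 'rV[C]_n, [/\ forall i, normc (d' 0 i) = 1, injective (d' 0)
    & forall i, normc (d' 0 i - d 0 i) <= e].
Proof.
move=> e0 hd; pose s := [seq d 0 i | i <- enum 'I_n].
have ss : size s = n by rewrite size_map size_enum_ord.
have sn (i : 'I_n) : s`_i = d 0 i.
  by rewrite (nth_map i) ?size_enum_ord // nth_ord_enum.
have [|s' [sz us as' hs]] := @distinct_units _ s e e0.
  by apply/allP => _ /mapP [i _ ->]; apply/eqP.
exists (\row_i s'`_i); split=> [i|i j|i]; rewrite !mxE.
- by apply/eqP; apply: (allP as'); rewrite mem_nth // sz ss.
- by move/eqP; rewrite nth_uniq ?sz ?ss // => /eqP /val_inj.
- by rewrite -sn; apply: hs; rewrite ss.
Qed.

Lemma diag_conj_close n (V : 'M[C]_(m, n)) (d d' : 'rV[C]_n) e : mle 1 V -> 0 <= e ->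
  (forall i, normc (d' 0 i - d 0 i) <= e) ->
  mle (n%:R * (n%:R * e)) (V *m diag_mx d' *m V^t* - V *m diag_mx d *m V^t*).
Proof.
move=> hV e0 hd; rewrite -mulmxBl -mulmxBr.
have hD : mle e (diag_mx d' - diag_mx d).
  move=> i j; rewrite !mxE; case: eqVneq => [->|_]; rewrite ?mulr1n ?mulr0n //.
  by rewrite subrr normc0.
by have := mleM (mleM hV hD) (mle_adj hV); rewrite mul1r mulr1.
Qed.

Lemma diag_conj_unitary (V : 'M[C]_m) (d : 'rV[C]_m) : V \is unitarymx ->
  (forall i, normc (d 0 i) = 1) -> V *m diag_mx d *m V^t* \is unitarymx.
Proof.
move=> hV hd; apply: mul_unitarymx (unitarymx_adj_unitary hV); apply: mul_unitarymx hV _.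
apply/unitarymxP; rewrite tr_diag_mx map_diag_mx mulmx_diag.
apply/matrixP => i j; rewrite !mxE; case: (i == j); rewrite ?mulr1n ?mulr0n //.
exact: normc1_conj.
Qed.

(** Only the eigenvalues are moved. The eigenbasis is real, so the new matrix is again symmetric. *)
Lemma symmetric_model A dl : A \is unitarymx -> A^T = A -> 0 < dl ->
  exists A', [/\ A' \is unitarymx, A'^T = A', mle dl (A' - A) & disc A' != 0].
Proof.
move=> hA At dl0; have [V [d [hV cV AV]]] := real_eigenbasis hA At.
have VVd : eigenframe A V d.
  by split; [exact: unitarymx_adjK|rewrite AV -mulmxA (unitarymx_adjK hV) mulmx1].
pose M : R := m%:R * m%:R + 1; have M0 : 0 < M by rewrite ltr_wpDl // mulr_ge0.
have e0 : 0 < dl / M by rewrite divr_gt0.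
have [d' [d'1 d'i d'd]] := distinct_units_row e0 (fun i => eigenframe_norm i hA VVd).
exists (V *m diag_mx d' *m V^t*); split.
- exact: diag_conj_unitary.
- have VT : V^T = V^t* by rewrite -conjmx_tr cV.
  have VsT : (V^t*)^T = V by rewrite -[RHS]cV; apply/matrixP => i j; rewrite !mxE.
  by rewrite !trmx_mul tr_diag_mx VsT -mulmxA; congr (_ *m (_ *m _)).
- rewrite AV; apply: mle_le (diag_conj_close (unitarymx_mle hV) (ltW e0) d'd).
  have -> : m%:R * (m%:R * (dl / M)) = dl * (m%:R * m%:R / M) by ring.
  by rewrite ler_piMr ?(ltW dl0) // ler_pdivrMr // mul1r /M lerDl.
- exact/(disc_neq0 d' hV).
Qed.

End Spectra.

Section Symplectic.
Variable R : realType.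
Local Notation C := R[i].
Variable m : nat.

(** For antisymmetric [E] the condition on [V] says that it is symplectic. A model with the right
    symmetry can then be written in standard coordinates and carried over to a Kramers basis. *)
Lemma twist_symplectic (E V B : 'M[C]_m) : E \is unitarymx -> E *m V = conjmx V *m E ->
  twist E (V *m B *m V^t*) = V *m twist E B *m V^t*.
Proof.
move=> hE EV; have EE := unitarymx_adjK hE; have EE' := unitarymx_mul_adj hE.
have l1 : E^t* *m conjmx V = V *m E^t*.
  by rewrite -[LHS]mulmx1 -EE' mulmxA -(mulmxA (E^t*)) -EV mulmxA EE mul1mx.
have l2 : V^T *m E = E *m V^t*.
  rewrite -[V^T in LHS]adj_conjmx -[E in LHS]trmxCK -adj_mul l1 adj_mul.
  by rewrite trmxCK.
have VT : (V^t*)^T = conjmx V by apply/matrixP => i j; rewrite !mxE.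
rewrite /twist !trmx_mul VT; move: l1 l2.
move: (V^T) (conjmx V) (E^t*) (B^T) (V^t*) => Vt Vc F Bt Vs l1 l2.
by rewrite !mulmxA l1 -!mulmxA l2.
Qed.

End Symplectic.

(** * The model that splits Kramers pairs *)

Section KramersModel.
Variable R : realType.
Local Notation C := R[i].
Local Notation K2 := (R * R)%type.
Variable h : nat.
Local Notation I := ('i%C : C).

Definition Jblock : 'M[C]_(h + h) := block_mx 0 1%:M (- 1%:M) 0.

Lemma Jblock_adj : Jblock^t* = block_mx 0 (- 1%:M) 1%:M 0.
Proof.
by rewrite tr_block_mx map_block_mx linearN /= map_mxN !trmx0 !map_mx0 adj1.
Qed.

Lemma Jblock_tr : Jblock^T = - Jblock.
Proof.
by rewrite tr_block_mx opp_block_mx !trmx0 !oppr0 opprK linearN /= trmx1.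
Qed.

Lemma Jblock_unitary : Jblock \is unitarymx.
Proof.
apply/unitarymxP; rewrite Jblock_adj mulmx_block !mulmx0 !mul0mx !mulmx1 mulNmx mulmxN mulmx1.
by rewrite opprK !add0r !addr0 -scalar_mx_block.
Qed.

Definition sqn (k : K2) : R := k.1 ^+ 2 + k.2 ^+ 2.

Lemma sqn_ge0 k : 0 <= sqn k.
Proof. by rewrite addr_ge0 ?sqr_ge0. Qed.

(* The Cayley transform of the off-diagonal Hermitian matrix [[0, q], [q^*, 0]], tensored with
   [diag_mx d]; its eigenvalues are [d i * unit_of (+- |q|)]. *)
Definition split_block (d : 'rV[C]_h) (k : K2) : 'M[C]_(h + h) :=
  let ca := ((1 - sqn k) / (1 + sqn k))%:C%C in
  let cb := 2 * I / (1 + sqn k)%:C%C in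
  block_mx (ca *: diag_mx d) ((cb * (k.1 +i* k.2)%C) *: diag_mx d)
           ((cb * (k.1 -i* k.2)%C) *: diag_mx d) (ca *: diag_mx d).

Lemma twist_Jblock (a b c d : 'M[C]_h) :
  twist Jblock (block_mx a b c d) = block_mx d^T (- b^T) (- c^T) a^T.
Proof.
rewrite /twist Jblock_adj tr_block_mx; move: a^T b^T c^T d^T => {}a {}b {}c {}d.
rewrite !mulmx_block !mul0mx !mul1mx !mulNmx !mul1mx !add0r !addr0.
by rewrite !mulmx0 !mulmxN !mulmx1 !addr0 !add0r opprK.
Qed.

(** The off-diagonal blocks are odd in [k] and change sign under [twist Jblock]; the two signs
    cancel. *)
Lemma split_block_twist d k : twist Jblock (split_block d (opp2 k)) = split_block d k.
Proof.
have sE : sqn (opp2 k) = sqn k by rewrite /sqn /= !sqrrN.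
have qE : (- k.1 +i* - k.2)%C = - (k.1 +i* k.2)%C by [].
have qcE : (- k.1 -i* - k.2)%C = - (k.1 -i* k.2)%C by [].
rewrite /split_block sE twist_Jblock /= qE qcE !mulrN !scaleNr.
have TN (X : 'M[C]_h) : (- X)^T = - X^T by apply/matrixP => i j; rewrite !mxE.
have TZ z (X : 'M[C]_h) : (z *: X)^T = z *: X^T by apply/matrixP => i j; rewrite !mxE.
have e1 z : (z *: diag_mx d)^T = z *: diag_mx d by rewrite TZ tr_diag_mx.
have e2 z : - (- (z *: diag_mx d))^T = z *: diag_mx d by rewrite TN opprK e1.
by congr block_mx; [exact: e1|exact: e2|exact: e2|exact: e1].
Qed.

Lemma tendsto_block_mx X (N : R -> X -> Prop) (a b c d : X -> 'M[C]_h) a0 b0 c0 d0 :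
  tendsto_mx N a a0 -> tendsto_mx N b b0 -> tendsto_mx N c c0 -> tendsto_mx N d d0 ->
  tendsto_mx N (fun x => block_mx (a x) (b x) (c x) (d x)) (block_mx a0 b0 c0 d0).
Proof.
move=> ha hb hc hd i j.
case: (split_ordP i) => i' ->; case: (split_ordP j) => j' ->.
- by rewrite block_mxEul; under eq_fun do rewrite block_mxEul; exact: ha.
- by rewrite block_mxEur; under eq_fun do rewrite block_mxEur; exact: hb.
- by rewrite block_mxEdl; under eq_fun do rewrite block_mxEdl; exact: hc.
- by rewrite block_mxEdr; under eq_fun do rewrite block_mxEdr; exact: hd.
Qed.

Lemma split_block_cont d k : tendsto_mx (nbh k) (split_block d) (split_block d k).
Proof.
have le := @nbh_le R k.
have t1 : tendsto (nbh k) (fun x => (x.1)%:C%C) (k.1)%:C%C.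
  by apply: tendsto_real => e e0; exists e => // x [].
have t2 : tendsto (nbh k) (fun x => (x.2)%:C%C) (k.2)%:C%C.
  by apply: tendsto_real => e e0; exists e => // x [].
have sE x : (sqn x)%:C%C = x.1%:C%C * x.1%:C%C + x.2%:C%C * x.2%:C%C :> C.
  by rewrite /sqn !expr2 rmorphD !rmorphM.
have ts : tendsto (nbh k) (fun x => (sqn x)%:C%C) (sqn k)%:C%C.
  by rewrite sE; under eq_fun do rewrite sE; apply: tendstoD => //; apply: tendstoM.
have tp : tendsto (nbh k) (fun x => (1 + sqn x)%:C%C) (1 + sqn k)%:C%C.
  rewrite rmorphD; under eq_fun do rewrite rmorphD.
  by apply: tendstoD => //; exact: tendsto_cst.
have tm : tendsto (nbh k) (fun x => (1 - sqn x)%:C%C) (1 - sqn k)%:C%C.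
  rewrite rmorphB; under eq_fun do rewrite rmorphB.
  by apply: tendstoD => //; [exact: tendsto_cst|exact: tendstoN].
have p0 : (1 + sqn k)%:C%C != 0 :> C.
  by rewrite fmorph_eq0 gt_eqF // ltr_pwDl // sqn_ge0.
have tca : tendsto (nbh k) (fun x => ((1 - sqn x) / (1 + sqn x))%:C%C) ((1 - sqn k) / (1 + sqn k))%:C%C.
  have e x : ((1 - sqn x) / (1 + sqn x))%:C%C = (1 - sqn x)%:C%C / (1 + sqn x)%:C%C :> C.
    by rewrite rmorphM fmorphV.
  rewrite e; under eq_fun do rewrite e.
  by apply: tendstoM => //; apply: tendstoV.
have tcb : tendsto (nbh k) (fun x => 2 * I / (1 + sqn x)%:C%C) (2 * I / (1 + sqn k)%:C%C).
  by apply: tendstoM => //; [exact: tendsto_cst|apply: tendstoV].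
have tq : tendsto (nbh k) (fun x : K2 => (x.1 +i* x.2)%C) (k.1 +i* k.2)%C.
  have qE (x : K2) : (x.1 +i* x.2)%C = x.1%:C%C + I * x.2%:C%C :> C by rewrite [LHS]complexE.
  rewrite qE; under eq_fun do rewrite qE.
  by apply: tendstoD => //; apply: tendstoM => //; exact: tendsto_cst.
have tqc : tendsto (nbh k) (fun x : K2 => (x.1 -i* x.2)%C) (k.1 -i* k.2)%C.
  exact: tendsto_conj tq.
apply: tendsto_block_mx; apply: tendsto_mxZ => //; try exact: tendsto_mx_cst.
  by apply: tendstoM.
by apply: tendstoM.
Qed.

(** With [q = k.1 + i k.2] the eigenvectors are [(1, u)] and [(1, - u)] for [u = conj q / |q|]. They
    have no limit at [q = 0], where the two eigenvalues agree and any unit number may serve as [u];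
    the frame is only used pointwise. *)
Definition split_frame (k : K2) : 'M[C]_(h + h) :=
  let u : C := if sqn k == 0 then 1 else (k.1 -i* k.2)%C / (Num.sqrt (sqn k))%:C%C in
  (Num.sqrt 2)^-1%:C%C *: block_mx 1%:M 1%:M u%:M (- u%:M).

Definition split_diag (d : 'rV[C]_h) (k : K2) : 'rV[C]_(h + h) :=
  row_mx (unit_of (Num.sqrt (sqn k)) *: d) (unit_of (- Num.sqrt (sqn k)) *: d).

Lemma split_eigenframe d k : eigenframe (split_block d k) (split_frame k) (split_diag d k).
Proof.
pose s := Num.sqrt (sqn k); have s0 : 0 <= s by exact: sqrtr_ge0.
have ss : s ^+ 2 = sqn k by rewrite sqr_sqrtr // sqn_ge0.
pose q : C := (k.1 +i* k.2)%C; pose qc : C := (k.1 -i* k.2)%C.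
have qq : q * qc = (s ^+ 2)%:C%C.
  by rewrite ss /sqn; apply/eqP; rewrite eq_complex /=; apply/andP; split; apply/eqP; ring.
have s2s : Num.sqrt (s ^+ 2) = s by rewrite sqrtr_sqr ger0_norm.
rewrite /split_frame /split_diag /split_block -ss s2s -/q -/qc.
set u : C := if _ then _ else _.
(* These identities are all that the computation uses of [u], and they also hold for the default
   [u = 1] at [q = 0]. *)
have [hu1 hu2 hu3] : [/\ u * conjc u = 1, u * s%:C%C = qc & q * u = s%:C%C].
  rewrite /u; case: eqVneq => [s20|s2N].
    have sz : s = 0 by apply/eqP; rewrite -sqrf_eq0; apply/eqP.
    have [k10 k20] : k.1 = 0 /\ k.2 = 0.
      move: s20; rewrite ss /sqn => /eqP; rewrite paddr_eq0 ?sqr_ge0 // !sqrf_eq0.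
      by move=> /andP[/eqP -> /eqP ->].
    rewrite sz /q /qc k10 k20; split; first by rewrite mul1r; exact: conjc1.
      by rewrite mul1r; apply/eqP; rewrite eq_complex /= oppr0 !eqxx.
    by rewrite mulr1.
  have sN : s%:C%C != 0 :> C.
    by rewrite fmorph_eq0; apply: contra s2N => /eqP ->; rewrite expr0n.
  have qcc : conjc qc = q by rewrite /q /qc /= opprK.
  split; last 2 first.
  - by rewrite divfK.
  - by rewrite mulrA qq expr2 rmorphM mulfK.
  - rewrite [conjc _](_ : _ = q / s%:C%C); last first.
      transitivity (conjc qc * conjc (s%:C%C)^-1); first exact: (rmorphM (@conjc R)).
      by rewrite conjc_inv conjc_real qcc.
    by rewrite mulf_div mulrC (mulrC qc) qq expr2 rmorphM mulVf // mulf_neq0.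
set r : C := (Num.sqrt 2)^-1%:C%C.
have rr : r * conjc r * 2 = 1.
  rewrite /r conjc_real -rmorphM -expr2 exprVn sqr_sqrtr // -(rmorph_nat (real_complex R)) -rmorphM.
  by rewrite mulVf ?pnatr_eq0.
have uu2 : conjc u * u = 1 by rewrite mulrC.
have adju (z : C) : (z%:M : 'M[C]_h)^t* = (conjc z)%:M by rewrite tr_scalar_mx map_scalar_mx.
split.
  rewrite adjZ -scalemxAl -scalemxAr scalerA (mulrC (conjc r)).
  have -> : (block_mx 1%:M 1%:M u%:M (- u%:M) : 'M[C]_(h + h))^t* =
      block_mx 1%:M (conjc u)%:M 1%:M (- conjc u)%:M.
    rewrite tr_block_mx map_block_mx -raddfN !tr_scalar_mx !map_scalar_mx !rmorph1.
    by congr block_mx; congr (_%:M); exact: rmorphN.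
  rewrite mulmx_block -raddfN -!scalar_mxM -!(raddfD (@scalar_mx C h)).
  rewrite !mulr1 !mulrN !mulNr opprK uu2 subrr raddf0 -scalar_mx_block scale_scalar_mx.
  by congr (_%:M); exact: rr.
rewrite -scalemxAr -scalemxAl; congr (_ *: _); rewrite diag_mx_row !mulmx_block.
set ca := ((1 - s ^+ 2) / (1 + s ^+ 2))%:C%C; set cb := 2 * I / (1 + s ^+ 2)%:C%C.
set S := s%:C%C in hu2 hu3.
(* Splitting [unit_of t] into an even and an odd part shows that the eigenvalues of the block are
   [ca + cb S] and [ca - cb S]. *)
have pm (t : R) : unit_of t = ((1 - t ^+ 2) / (1 + t ^+ 2))%:C%C + 2 * I / (1 + t ^+ 2)%:C%C * t%:C%C.
  have n1 := one_sub_ix_neq0 t.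
  have c2 : (1 + t ^+ 2)%:C%C = 1 + t%:C%C ^+ 2 :> C by rewrite !expr2 rmorphD rmorphM.
  have c1 : ((1 - t ^+ 2) / (1 + t ^+ 2))%:C%C = (1 - t%:C%C ^+ 2) / (1 + t%:C%C ^+ 2) :> C.
    transitivity ((1 - t ^+ 2)%:C%C / (1 + t ^+ 2)%:C%C : C); first by rewrite rmorphM fmorphV.
    by rewrite c2; congr (_ / _); rewrite !expr2 rmorphB rmorphM.
  have n2 : 1 + (t%:C%C : C) ^+ 2 != 0.
    by rewrite -c2 fmorph_eq0 gt_eqF // ltr_pwDl ?sqr_ge0.
  rewrite /unit_of c1 c2; move: (t%:C%C) n1 n2 => T n1 n2; have Ie := i_sqr R.
  have e : 1 + T ^+ 2 = (1 + I * T) * (1 - I * T).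
    have -> : (1 + I * T) * (1 - I * T) = 1 - (I * I) * T ^+ 2 by ring.
    by rewrite Ie mulN1r opprK.
  have e2 : 1 - T ^+ 2 + 2 * I * T = (1 + I * T) * (1 + I * T).
    have -> : (1 + I * T) * (1 + I * T) = 1 + (I * I) * T ^+ 2 + 2 * I * T by ring.
    by rewrite Ie mulN1r.
  move: n2; rewrite e mulf_eq0 negb_or => /andP[n3 _].
  by rewrite [X in _ = _ + X]mulrAC -mulrDl e2 -mulf_div divff // mul1r.
have wp : unit_of s = ca + cb * S by rewrite pm.
have wm : unit_of (- s) = ca - cb * S by rewrite pm sqrrN rmorphN mulrN.
clearbody ca cb S.
have dZ (z : C) : diag_mx (z *: d) = z *: diag_mx d by rewrite linearZ.
move: (diag_mx d) dZ => D dZ; rewrite !dZ.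
rewrite !mulmxN !mulNmx !mul_mx_scalar !mul_scalar_mx !scaler0 oppr0 !addr0 !add0r !scale1r.
rewrite !scalerA -!scaleNr -!scalerDl.
rewrite wp wm; congr (block_mx (_ *: D) (_ *: D) (_ *: D) (_ *: D)).
- by rewrite -hu3; ring.
- by rewrite -hu3 -[- u *: _]/(- u * (cb * q)); ring.
- by rewrite -hu2; ring: uu2.
- rewrite -[- u *: _]/(- u * ca) -[- u *: _]/(- u * (ca - cb * S)) -hu2; ring.
Qed.

End KramersModel.

Section KramersModelMain.
Variable R : realType.
Local Notation C := R[i].
Local Notation K2 := (R * R)%type.
Variable h : nat.
Local Notation J := (Jblock R h).

Lemma eigenframe_conj m (V B U : 'M[C]_m) d : V \is unitarymx -> eigenframe B U d ->
  eigenframe (V *m B *m V^t*) (V *m U) d.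
Proof.
move=> hV [UU BU]; have VV := unitarymx_adjK hV; split.
  by rewrite adj_mul -mulmxA (mulmxA (V^t*)) VV mul1mx.
by rewrite -mulmxA (mulmxA (V^t*)) VV mul1mx -mulmxA BU mulmxA.
Qed.

Lemma eigenframe_perm m (A V : 'M[C]_m) d (s : 'I_m -> 'I_m) : injective s -> eigenframe A V d ->
  eigenframe A (\matrix_(a, b) V a (s b)) (\row_b d 0 (s b)).
Proof.
move=> si [VV AV]; split; apply/matrixP => i j.
  have /matrixP/(_ (s i) (s j)) := VV; rewrite !mxE (inj_eq si) => <-.
  by apply: eq_bigr => k _; rewrite !mxE.
have /matrixP/(_ i (s j)) := AV; rewrite !mul_mx_diag !mxE => <-.
by apply: eq_bigr => k _; rewrite mxE.
Qed.

Lemma half_lt (i : 'I_(h + h)) : (i./2 < h)%N.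
Proof. by rewrite ltn_half_double -addnn. Qed.

(** [row_mx e f] lists one member of every pair and then all the partners, whereas clusters are read
    off from [i./2]. This map puts partners at the positions [2 p] and [2 p + 1]. *)
Definition interleave (i : 'I_(h + h)) : 'I_(h + h) :=
  if odd i then rshift h (Ordinal (half_lt i)) else lshift h (Ordinal (half_lt i)).

Lemma interleave_inj : injective interleave.
Proof.
move=> i j; rewrite /interleave; have oi := odd_double_half i; have oj := odd_double_half j.
case: (boolP (odd i)) oi; case: (boolP (odd j)) oj => _ oj _ oi /(congr1 val) /= e;
  apply/val_inj => /=; have := half_lt i; have := half_lt j; rewrite -oi -oj /=; move: e; lia.
Qed.

Lemma clustered_of_pairs (A V : 'M[C]_(h + h)) (e f : 'rV[C]_h) a :
  eigenframe A V (row_mx e f) ->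
  (forall p q, p != q -> [/\ a <= normc (e 0 p - e 0 q), a <= normc (e 0 p - f 0 q),
    a <= normc (f 0 p - e 0 q) & a <= normc (f 0 p - f 0 q)]) ->
  clustered_spec a A.
Proof.
move=> hA hef; have hs := eigenframe_perm interleave_inj hA.
eexists; eexists; split; first exact: hs.
move=> i j ij; rewrite [X in normc (X - _)]mxE [X in normc (_ - X)]mxE /interleave.
have pq : Ordinal (half_lt i) != Ordinal (half_lt j) by [].
have [h1 h2 h3 h4] := hef _ _ pq.
by case: (odd i); case: (odd j); rewrite !(row_mxEl, row_mxEr).
Qed.

(** [near_forall] for the intervals [0 < x <= d] takes the place of a minimum, so an empty [I] needs
    no separate treatment. *)
Lemma finite_gap (I : finType) (f : I -> R) : (forall i, 0 < f i) -> exists2 g, 0 < g & forall i, g <= f i.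
Proof.
move=> f0; pose N (d x : R) := 0 < x <= d.
have Nle (d d' x : R) : d <= d' -> N d x -> N d' x by move=> dd' /andP[x0 /le_trans hx]; rewrite /N x0 hx.
have [i|d d0 hd] := @near_forall R R N Nle I (fun i x => x <= f i).
  by exists (f i) => // x /andP[].
by exists d => // i; apply: hd; rewrite /N d0 lexx.
Qed.

(** Different Kramers pairs of [A] may share an eigenvalue. Replacing [d] by the distinct [d']
    separates the pairs from each other; the dependence on [|k|] separates the two members of each
    pair away from the origin. *)
Lemma kramers_model (A : 'M[C]_(h + h)) dl : A \is unitarymx -> A = twist J A -> 0 < dl ->
  exists (B : K2 -> 'M[C]_(h + h)) (a r : R),
  [/\ 0 < a, 0 < r, fam_cont B, forall k, B k \is unitarymx
    & forall k, B k = twist J (B (opp2 k))] /\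
  [/\ double_spec (B (0, 0)),
      forall k, nbh (0, 0) r k -> mle dl (B k - A) /\ clustered_spec a (B k)
    & forall k, nbh (0, 0) r k -> k != (0, 0) -> disc (B k) != 0].
Proof.
move=> hA tA dl0.
have [W [d Wd]] := kramers_basis (Jblock_unitary R h) (Jblock_tr R h) hA tA (leqnn (h + h)).
have [VV AV] := kramers_full (Jblock_unitary R h) hA tA Wd.
set V := row_mx W _ in VV AV.
have hV := unitarymx_of_adj VV.
have AVd : eigenframe A V (row_mx d d) by [].
(* The columns of [V] are [W] and [theta W], which makes this basis symplectic. *)
have JV : J *m V = conjmx V *m J.
  have JJ := unitarymx_mul_adj (Jblock_unitary R h).
  have cV : conjmx V = row_mx (conjmx W) (- (J *m W)).
    transitivity (row_mx (conjmx W) (conjmx (theta J W))); first exact: map_row_mx.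
    by rewrite conjmxM conjmxK conjmx_adj Jblock_tr mulNmx.
  rewrite cV /V mul_mx_row /theta mulmxA JJ mul1mx mul_row_block !mulmx0 mulmx1 mulmxN mulmx1.
  by rewrite opprK add0r addr0.
have d1 i : normc (d 0 i) = 1.
  by have := eigenframe_norm (lshift h i) hA AVd; rewrite row_mxEl.
(* The [2] in [M] leaves half of [dl] for the change from [d] to [d'] and half for the variation of
   [B] with [k]. *)
pose n : R := (h + h)%:R; pose M : R := 2 * (n * n) + 1.
have n0 : 0 <= n by exact: ler0n.
have M0 : 0 < M by rewrite ltr_wpDl // !mulr_ge0.
have e0 : 0 < dl / M by rewrite divr_gt0.
have [d' [d'1 d'i d'd]] := distinct_units_row e0 d1.
pose B k := V *m split_block d' k *m V^t*.
have Beig k : eigenframe (B k) (V *m split_frame h k) (split_diag d' k).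
  exact: eigenframe_conj hV (split_eigenframe d' k).
have Bu k : B k \is unitarymx.
  have [hU ->] := eigenframe_decomp (Beig k); apply: diag_conj_unitary hU _ => i.
  by case: (split_ordP i) => j ->; rewrite !(row_mxEl, row_mxEr) mxE normcM normc_unit_of d'1 mulr1.
have Bc : fam_cont B.
  move=> k; apply: tendsto_mxM (tendsto_mx_cst _ _); first exact: nbh_le.
  by apply: tendsto_mxM (tendsto_mx_cst _ _) (split_block_cont _ _); exact: nbh_le.
have Bt k : B k = twist J (B (opp2 k)).
  by rewrite /B (twist_symplectic _ (Jblock_unitary R h) JV) split_block_twist.
have [g g0 hg] : exists2 g, 0 < g & forall pq : 'I_h * 'I_h, pq.1 != pq.2 -> g <= normc (d' 0 pq.1 - d' 0 pq.2).
  have [|g g0 hg] := @finite_gap ('I_h * 'I_h)%type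
      (fun pq => if pq.1 == pq.2 then 1 else normc (d' 0 pq.1 - d' 0 pq.2)).
    move=> [p q] /=; case: eqVneq => // pq; rewrite normc_gt0 subr_eq0.
    by apply: contra pq => /eqP /d'i ->.
  by exists g => // pq hpq; have := hg pq; rewrite (negbTE hpq).
have B0 : mle (dl / 2) (B (0, 0) - A).
  have [_ ->] := eigenframe_decomp AVd.
  have -> : B (0, 0) = V *m diag_mx (row_mx d' d') *m V^t*.
    rewrite /B /split_block /sqn /= !expr0n /= addr0 subr0 addr0 divr1.
    have -> : (0 +i* 0)%C = 0 :> C by [].
    have -> : (0 -i* 0)%C = 0 :> C by apply/eqP; rewrite eq_complex /= oppr0 !eqxx.
    by rewrite mulr0 scale0r scale1r diag_mx_row.
  apply: mle_le (diag_conj_close (unitarymx_mle hV) (ltW e0) _); last first.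
    by move=> i; case: (split_ordP i) => j ->; rewrite !(row_mxEl, row_mxEr).
  have -> : n * (n * (dl / M)) = dl / 2 * (2 * (n * n) / M) by field; rewrite gt_eqF.
  by rewrite ler_piMr ?divr_ge0 ?(ltW dl0) // ler_pdivrMr // mul1r /M lerDl.
have [r1 r10 hr1] : exists2 r, 0 < r & forall k, nbh (0, 0) r k -> mle (dl / 2) (B k - B (0, 0)).
  by have /(tendsto_mxP (@nbh_le _ _)) := Bc (0, 0); apply; rewrite divr_gt0.
(* For [|k| <= g / 8] each eigenvalue moves by at most [g / 4], by [unit_of_close], so different
   pairs stay [g / 2] apart. The radius [g / 16] makes up for the passage from sup norm to Euclidean
   norm. *)
pose r := Num.min r1 (g / 16); have r0 : 0 < r by rewrite lt_min r10 divr_gt0.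
have sq_small k : nbh (0, 0) r k -> Num.sqrt (sqn k) <= g / 8.
  move=> [/=]; rewrite !subr0 !lt_min => /andP[_ k1] /andP[_ k2].
  have -> : g / 8 = Num.sqrt ((g / 8) ^+ 2) by rewrite sqrtr_sqr ger0_norm // divr_ge0 // ltW.
  rewrite ler_wsqrtr // /sqn -(real_normK (num_real k.1)) -(real_normK (num_real k.2)).
  have := normr_ge0 k.1; have := normr_ge0 k.2; nra.
have close (x : R) : `|x| <= g / 8 -> normc (unit_of x - 1) <= g / 4.
  by move=> hx; have := unit_of_close x; lra.
have gap k : nbh (0, 0) r k -> forall x y, `|x| <= g / 8 -> `|y| <= g / 8 -> forall p q, p != q ->
    g / 2 <= normc (unit_of x * d' 0 p - unit_of y * d' 0 q).
  move=> hk x y hx hy p q pq; have h1 := hg (p, q) pq.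
  have a1 := close x hx; have a2 := close y hy.
  have b1 : normc (unit_of x * d' 0 p - d' 0 p) <= g / 4.
    by rewrite -[X in _ - X]mul1r -mulrBl normcM d'1 mulr1.
  have b2 : normc (unit_of y * d' 0 q - d' 0 q) <= g / 4.
    by rewrite -[X in _ - X]mul1r -mulrBl normcM d'1 mulr1.
  have t1 := normc_triangle (d' 0 p) (unit_of x * d' 0 p) (d' 0 q).
  have t2 := normc_triangle (unit_of x * d' 0 p) (unit_of y * d' 0 q) (d' 0 q).
  move: t1 t2 h1 b1 b2; rewrite /= (normcB (d' 0 p) (unit_of x * d' 0 p)); clear; lra.
have hs k : nbh (0, 0) r k -> `|Num.sqrt (sqn k)| <= g / 8 /\ `|- Num.sqrt (sqn k)| <= g / 8.
  by move=> /sq_small hk; rewrite normrN ger0_norm ?sqrtr_ge0.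
exists B, (g / 2), r; split; [split|split].
- by rewrite divr_gt0.
- exact: r0.
- exact: Bc.
- exact: Bu.
- exact: Bt.
- exists (V *m split_frame h (0, 0)), (split_diag d' (0, 0)); split; first exact: Beig.
  have -> : split_diag d' (0, 0) = row_mx d' d'.
    rewrite /split_diag /sqn /= !expr0n /= addr0 sqrtr0 oppr0.
    have -> : unit_of 0 = 1 :> C by rewrite /unit_of mulr0 addr0 subr0 divr1.
    by rewrite scale1r.
  move=> i; case: (split_ordP i) => p ->.
    exists (rshift h p); split; [by rewrite eq_sym eq_lrshift|by rewrite row_mxEl row_mxEr|].
    move=> l; case: (split_ordP l) => q ->; rewrite !(row_mxEl, row_mxEr) => /d'i ->; [by left|by right].
  exists (lshift h p); split; [by rewrite eq_lrshift|by rewrite row_mxEl row_mxEr|].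
  move=> l; case: (split_ordP l) => q ->; rewrite !(row_mxEl, row_mxEr) => /d'i ->; [by right|by left].
- move=> k hk; split.
    have := mle_triangle (hr1 k (nbh_le _ hk)) B0; rewrite -splitr; apply.
    by rewrite /r ge_min lexx.
  apply: (clustered_of_pairs (Beig k)) => p q pq; rewrite !mxE.
  by have [h1 h2] := hs k hk; split; apply: gap hk _ _ _ _ _ _ pq.
- move=> k hk k0; apply/(eigenframe_disc (Beig k)).
  have [h1 h2] := hs k hk.
  have s0 : Num.sqrt (sqn k) != 0.
    rewrite sqrtr_eq0 -ltNge lt_neqAle sqn_ge0 andbT eq_sym.
    apply: contra k0; rewrite /sqn paddr_eq0 ?sqr_ge0 // !sqrf_eq0.
    by case: k {hk h1 h2} => x y /= /andP[/eqP -> /eqP ->].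
  have ne p q x y : `|x| <= g / 8 -> `|y| <= g / 8 -> unit_of x * d' 0 p = unit_of y * d' 0 q -> p = q.
    move=> hx hy e; apply/eqP; apply: contrapT => /negP pq.
    have := gap k hk x y hx hy p q pq; rewrite e subrr normc0; lra.
  have pm p : unit_of (Num.sqrt (sqn k)) * d' 0 p = unit_of (- Num.sqrt (sqn k)) * d' 0 p -> False.
    have dp0 : d' 0 p != 0 by rewrite -normc_gt0 d'1.
    move=> /(mulIf dp0) /unit_of_inj /eqP; rewrite -addr_eq0 -mulr2n mulrn_eq0 /=.
    by rewrite (negbTE s0).
  move=> i j; case: (split_ordP i) => p ->; case: (split_ordP j) => q ->;
    rewrite !(row_mxEl, row_mxEr) !mxE => e.
  + by rewrite (ne _ _ _ _ h1 h1 e).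
  + by have pq := ne _ _ _ _ h1 h2 e; move: e; rewrite pq => /pm.
  + by have pq := ne _ _ _ _ h2 h1 e; move: e; rewrite pq => /esym /pm.
  + by rewrite (ne _ _ _ _ h2 h2 e).
Qed.

End KramersModelMain.

(** * Equivariant patching *)

Section Rounding.
Variable R : realType.
Implicit Types x y : R.

Definition rnd x : int := Num.floor (x + 1 / 2).
(** Distance to the nearest integer. It is even, periodic and Lipschitz, so cut-offs built from it
    inherit the symmetries of the torus. *)
Definition dz x : R := `|x - (rnd x)%:~R|.

Lemma dz_half x : dz x <= 1 / 2.
Proof.
have /andP[h1 h2] := floor_itv (x + 1 / 2); rewrite /dz /rnd ler_norml; move: h1 h2.
by rewrite intrD; lra.
Qed.

Lemma rnd_eq x (n : int) : `|x - n%:~R| < 1 / 2 -> rnd x = n.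
Proof.
rewrite ltr_norml => /andP[h1 h2]; apply/eqP; rewrite /rnd floor_eq intrD; apply/andP; split; lra.
Qed.

Lemma dz_le x (n : int) : dz x <= `|x - n%:~R|.
Proof.
rewrite leNgt; apply/negP => h; have hx := dz_half x.
have e : rnd x = n by apply: rnd_eq; lra.
by move: h; rewrite /dz e ltxx.
Qed.

Lemma dz_lip x y : `|dz x - dz y| <= `|x - y|.
Proof.
have h a b : dz a <= dz b + `|a - b|.
  apply: le_trans (dz_le a (rnd b)) _.
  by rewrite [leRHS]addrC; exact: ler_distD.
rewrite ler_norml; have := h x y; have := h y x; rewrite (distrC y); lra.
Qed.

Lemma dzD x (n : int) : dz (x + n%:~R) = dz x.
Proof.
have h a (p : int) : dz (a + p%:~R) <= dz a.
  by have := dz_le (a + p%:~R) (rnd a + p); rewrite intrD opprD addrACA subrr addr0.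
apply/eqP; rewrite eq_le h /= -{1}[x](addrK n%:~R) -mulrNz; exact: h.
Qed.

Lemma dzN x : dz (- x) = dz x.
Proof.
have h a : dz (- a) <= dz a.
  by have := dz_le (- a) (- rnd a); rewrite mulrNz -opprD normrN.
by apply/eqP; rewrite eq_le h -{1}[x]opprK h.
Qed.

Lemma dz_small x : `|x| <= 1 / 2 -> dz x = `|x|.
Proof.
move=> hx; apply/eqP; rewrite eq_le; apply/andP; split; first by have := dz_le x 0; rewrite subr0.
rewrite /dz; case: (eqVneq (rnd x) 0) => [->|]; first by rewrite subr0.
move=> n0; have : 1 <= `|(rnd x)%:~R| :> R.
  by rewrite -intr_norm -[1]/(1%:~R) ler_int; move: n0; case: (rnd x) => n; lia.
have := ler_normD (x - (rnd x)%:~R) (- x); rewrite addrAC subrr add0r !normrN; lra.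
Qed.

(** A periodic trapezoid: plateau within [w] of the integers, zero beyond [2 w]. *)
Definition bump (w x : R) : R := Num.max 0 (Num.min (2 - dz x / w) 1).

Lemma bump01 w x : 0 <= bump w x <= 1.
Proof. by rewrite /bump le_max lexx /= ge_max ler01 ge_min lexx orbT. Qed.

Lemma bump1 w x : 0 < w -> dz x <= w -> bump w x = 1.
Proof.
move=> w0 h; have h1 : dz x / w <= 1 by rewrite ler_pdivrMr // mul1r.
rewrite /bump; have -> : Num.min (2 - dz x / w) 1 = 1 by apply/min_idPr; lra.
exact/max_idPr.
Qed.

Lemma bump0 w x : 0 < w -> 2 * w <= dz x -> bump w x = 0.
Proof.
move=> w0 h; have h1 : 2 <= dz x / w by rewrite ler_pdivlMr.
by rewrite /bump; apply/max_idPl; rewrite ge_min; apply/orP; left; lra.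
Qed.

Lemma bump_lip w x y : 0 < w -> `|bump w x - bump w y| <= `|x - y| / w.
Proof.
move=> w0; rewrite (le_trans (max0_lip _ _)) // (le_trans (min_lip _ _ _)) //.
have -> : 2 - dz x / w - (2 - dz y / w) = - ((dz x - dz y) / w) by ring.
have w1 : 0 < w^-1 by rewrite invr_gt0.
by rewrite normrN normrM (gtr0_norm w1) ler_pM2r // dz_lip.
Qed.

Lemma bumpN w x : bump w (- x) = bump w x.
Proof. by rewrite /bump dzN. Qed.

End Rounding.

(** * Gluing a local family along a cut-off *)

Section Patch.
Variable R : realType.
Local Notation C := R[i].
Local Notation K2 := (R * R)%type.
Variable m : nat.
Variables (E : 'M[C]_m) (s : C).
Hypothesis hE : E \is unitarymx.
Hypothesis Etr : E^T = s *: E.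
Hypothesis s_sqr : s * s = 1.
Variables (al be : K2 -> 'M[C]_m) (chi : K2 -> R) (Om : K2 -> Prop) (e : R).
Hypothesis hal : matching E al.
Hypothesis chi01 : forall k, 0 <= chi k <= 1.
Hypothesis chi_cont : forall k, tendsto (nbh k) (fun k' => (chi k')%:C%C) (chi k)%:C%C.
Hypothesis chi_per : periodic chi.
Hypothesis chi_even : forall k, chi (opp2 k) = chi k.
Hypothesis Om_per : periodic Om.
Hypothesis Om_even : forall k, Om (opp2 k) = Om k.
Hypothesis Om_open : forall k, Om k -> exists2 d, 0 < d & forall k', nbh k d k' -> Om k'.
Hypothesis Om_out : forall k, ~ Om k -> exists2 d, 0 < d & forall k', nbh k d k' -> Om k' -> chi k' = 0.
Hypothesis be_cont : forall k, Om k -> tendsto_mx (nbh k) be (be k).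
Hypothesis be_per : forall k, Om k -> be (k.1 + 1, k.2) = be k /\ be (k.1, k.2 + 1) = be k.
Hypothesis be_unitary : forall k, Om k -> be k \is unitarymx.
Hypothesis be_twist : forall k, Om k -> be k = twist E (be (opp2 k)).
Hypothesis e0 : 0 <= e.
Hypothesis he : m%:R ^+ 2 * e <= 1.
Hypothesis be_close : forall k, Om k -> mle e (be k - al k).

(** The test is needed even though [chi] vanishes near the boundary of [Om]: where [be] is far from
    [al] the denominator may be singular, and then [mob 0] need not return [al]. *)
Definition patch (k : K2) : 'M[C]_m := if `[< Om k >] then mob (chi k) (al k) (be k) else al k.

Lemma patch_den k t : 0 <= t <= 1 -> Om k -> mob_den t (al k) (be k) \in unitmx.
Proof. by case: hal => _ _ u _ ht Ok; exact: mob_den_unit ht (u k) (be_close Ok) he. Qed.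

Lemma patch_in k : Om k -> patch k = mob (chi k) (al k) (be k).
Proof. by move=> Ok; rewrite /patch; case: asboolP. Qed.

Lemma patch_out k : ~ Om k -> patch k = al k.
Proof. by move=> Ok; rewrite /patch; case: asboolP. Qed.

Lemma patch_one k : Om k -> chi k = 1 -> patch k = be k.
Proof. by case: hal => _ _ u _ Ok c1; rewrite (patch_in Ok) c1; exact: mob1 (u k). Qed.

Lemma patch_zero k : Om k -> chi k = 0 -> patch k = al k.
Proof.
by move=> Ok c0; rewrite (patch_in Ok) c0 mob0 // -c0; exact: patch_den.
Qed.

Lemma patch_close k : mle ((1 + m%:R) * e) (patch k - al k).
Proof.
case: hal => _ _ u _; have [Ok|Ok] := pselect (Om k).
  by rewrite (patch_in Ok); exact: mob_close (chi01 k) (u k) (be_unitary Ok) (be_close Ok) (patch_den (chi01 k) Ok).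
rewrite (patch_out Ok) subrr => i j; rewrite mxE normc0 mulr_ge0 // addr_ge0 //.
Qed.

Lemma patch_matching : matching E patch.
Proof.
case: (hal) => c p u tw; split.
- move=> k; have [Ok|Ok] := pselect (Om k).
    have [d d0 hd] := Om_open Ok; move=> i j.
    apply: (@tendsto_ext _ _ _ (@nbh_le _ k) (fun x => mob (chi x) (al x) (be x) i j)).
      by exists d => // k' /hd Ok'; rewrite (patch_in Ok').
    rewrite (patch_in Ok).
    exact: (mob_tendsto (@nbh_le _ k) (chi_cont k) (c k) (be_cont Ok) (patch_den (chi01 k) Ok) i j).
  have [d d0 hd] := Om_out Ok; move=> i j; rewrite (patch_out Ok).
  apply: (@tendsto_ext _ _ _ (@nbh_le _ k) (fun x => al x i j)) (c k i j).
  exists d => // k' hk'; have [Ok'|Ok'] := pselect (Om k'); last by rewrite (patch_out Ok').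
  by rewrite (patch_zero Ok') // (hd k').
- move=> k; have [p1 p2] := p k; have [c1 c2] := chi_per k; have [o1 o2] := Om_per k.
  have [Ok|Ok] := pselect (Om k).
    have [b1 b2] := be_per Ok.
    by rewrite !patch_in ?o1 ?o2 // p1 p2 c1 c2 b1 b2.
  by rewrite !patch_out ?o1 ?o2.
- move=> k; have [Ok|Ok] := pselect (Om k); last by rewrite (patch_out Ok); exact: (u k).
  by rewrite (patch_in Ok); exact: mob_unitary (u k) (be_unitary Ok) (patch_den (chi01 k) Ok).
- move=> k; have [Ok|Ok] := pselect (Om k).
    have Ok' : Om (opp2 k) by rewrite Om_even.
    rewrite (patch_in Ok) (patch_in Ok') (twist_mob hE (u _) (patch_den (chi01 _) Ok')).
    by rewrite -tw -(be_twist Ok) chi_even.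
  by rewrite !patch_out // Om_even.
Qed.

End Patch.

(** * Distance to the high-symmetry points *)

Section Geometry.
Variable R : realType.
Local Notation C := R[i].
Local Notation K2 := (R * R)%type.

Lemma dz_ge0 (x : R) : 0 <= dz x.
Proof. exact: normr_ge0. Qed.

Lemma dz_add (x y : R) : dz (x + y) <= dz x + dz y.
Proof.
have := dz_le (x + y) (rnd x + rnd y); rewrite intrD opprD addrACA => /le_trans; apply.
exact: ler_normD.
Qed.

Lemma dz_double (x : R) : dz (2 * x) <= 2 * dz x.
Proof. by rewrite !mulr_natl mulr2n; have := dz_add x x; rewrite -mulr2n. Qed.

(* Sup-norm distance to the lattice of high-symmetry points [(1/2) Z^2]. *)
Definition sd (k : K2) : R := Num.max (dz (2 * k.1)) (dz (2 * k.2)) / 2.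

Lemma sd_lt (k : K2) r : sd k < r <-> dz (2 * k.1) < 2 * r /\ dz (2 * k.2) < 2 * r.
Proof. by rewrite /sd ltr_pdivrMr // gt_max (mulrC r); split=> [/andP[]|[-> ->]]. Qed.

Lemma sd_opp k : sd (opp2 k) = sd k.
Proof. by rewrite /sd /= !mulrN !dzN. Qed.

Lemma sd_le4 k : sd k <= 1 / 4.
Proof.
by have := dz_half (2 * k.1); have := dz_half (2 * k.2); rewrite /sd ler_pdivrMr // ge_max => h1 h2; apply/andP; split; lra.
Qed.

Lemma periodic_int T (f : K2 -> T) : periodic f ->
  forall (n p : int) k, f (k.1 + n%:~R, k.2 + p%:~R) = f k.
Proof.
move=> hf; have h1 (n : nat) k : f (k.1 + n%:R, k.2) = f k.
  elim: n => [|n IH]; first by rewrite addr0 -surjective_pairing.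
  by have [h _] := hf (k.1 + n%:R, k.2); rewrite -natr1 addrA; rewrite /= in h; rewrite h.
have h2 (n : nat) k : f (k.1, k.2 + n%:R) = f k.
  elim: n => [|n IH]; first by rewrite addr0 -surjective_pairing.
  by have [_ h] := hf (k.1, k.2 + n%:R); rewrite -natr1 addrA; rewrite /= in h; rewrite h.
have h1' (n : int) k : f (k.1 + n%:~R, k.2) = f k.
  case: n => n; first exact: h1.
  have := h1 n.+1 (k.1 + (Negz n)%:~R, k.2); rewrite /= NegzE mulrNz /= subrK => <-.
  by rewrite -surjective_pairing.
have h2' (n : int) k : f (k.1, k.2 + n%:~R) = f k.
  case: n => n; first exact: h2.
  have := h2 n.+1 (k.1, k.2 + (Negz n)%:~R); rewrite /= NegzE mulrNz /= subrK => <-.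
  by rewrite -surjective_pairing.
move=> n p k; have := h1' n (k.1, k.2 + p%:~R); rewrite /= => ->; exact: h2'.
Qed.

End Geometry.

(** * Correction on a cell and its mirror image *)

Section FreePatch.
Variable R : realType.
Local Notation C := R[i].
Local Notation K2 := (R * R)%type.
Variable m : nat.
Variables (E : 'M[C]_m) (s : C).
Hypothesis hE : E \is unitarymx.
Hypothesis Etr : E^T = s *: E.
Hypothesis s_sqr : s * s = 1.

(** [e'] is the error on a cell, [e] the error after [twist] has cost a factor [m ^ 2] on the mirror
    cell, and [dl] the error after Moebius interpolation has cost [1 + m]. The bound
    [m ^ 2 * e <= 1] keeps its denominator invertible. *)
Lemma tolerance (dl : R) : 0 < dl -> exists e e' : R,
  [/\ 0 < e' , 0 < e, e' <= e, m%:R * (m%:R * e') <= e & m%:R ^+ 2 * e <= 1 /\ (1 + m%:R) * e <= dl].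
Proof.
move=> dl0; pose M : R := m%:R ^+ 2 + 1; pose N : R := 1 + m%:R.
have m0 : 0 <= m%:R :> R by exact: ler0n.
have M1 : 1 <= M by rewrite lerDr exprn_ge0.
have M0 : 0 < M by lra.
have N0 : 0 < N by rewrite ltr_pwDl.
pose e := Num.min M^-1 (dl / N).
have e0 : 0 < e by rewrite lt_min invr_gt0 M0 divr_gt0.
have eM : e * M <= 1 by rewrite -ler_pdivlMr // mul1r ge_min lexx.
have eN : e * N <= dl by rewrite -ler_pdivlMr // ge_min lexx orbT.
exists e, (e / M); split=> //; first by rewrite divr_gt0.
- by rewrite ler_pdivrMr // ler_peMr // ltW.
- have -> : m%:R * (m%:R * (e / M)) = e * (m%:R ^+ 2 / M) by ring.
  by rewrite ler_piMr ?(ltW e0) // ler_pdivrMr // mul1r lerDl.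
- by split; [rewrite mulrC (le_trans _ eM) // ler_pM2l // lerDl|rewrite mulrC].
Qed.

Variables (al : K2 -> 'M[C]_m) (c : K2) (w : R) (mu : C) (dl : R).
Hypothesis hal : matching E al.
Hypothesis w0 : 0 < w.
Hypothesis sdc : 4 * w <= sd c.
Hypothesis dl0 : 0 < dl.
Hypothesis mu1 : normc mu = 1.
Hypothesis hmu : forall k, box c (3 * w) k -> al k + mu%:M \in unitmx.

(** Of the radii [w], [2 w], [3 w] the first bounds the plateau of the cut-off and the second its
    support; the ring up to the third keeps the support away from the boundary of the cell. *)
Definition Omp (k : K2) := dz (k.1 - c.1) < 3 * w /\ dz (k.2 - c.2) < 3 * w.
Definition Omf (k : K2) := Omp k \/ Omp (opp2 k).
Definition chip (k : K2) : R := bump w (k.1 - c.1) * bump w (k.2 - c.2).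
Definition chif (k : K2) : R := chip k + chip (opp2 k).
(** The translate of [k] next to [c]: [local_simple] has treated just one copy of the cell. *)
Definition repr (k : K2) : K2 :=
  (k.1 - (rnd (k.1 - c.1))%:~R, k.2 - (rnd (k.2 - c.2))%:~R).

Lemma w_small : w <= 1 / 16.
Proof. by have := sd_le4 c; have := sdc; lra. Qed.

(** If [k] and [-k] are both within [3 w] of [c] modulo [Z^2], then [2 c] is within [6 w] of [Z^2],
    so [sd c < 3 w]. *)
Lemma Omp_disjoint k : Omp k -> ~ Omp (opp2 k).
Proof.
move=> [h1 h2] [/= h3 h4]; have : sd c < 3 * w.
  have e a b : dz (a - b) < 3 * w -> dz (- a - b) < 3 * w -> dz (2 * b) < 2 * (3 * w).
    move=> u v; rewrite -dzN; have := dz_add (a - b) (- a - b).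
    by rewrite (_ : a - b + (- a - b) = - (2 * b)); [lra|ring].
  by apply/sd_lt; split; [exact: e h1 h3|exact: e h2 h4].
by have := sdc; have := w0; lra.
Qed.

(** This is what the margin [4 w <= sd c] provides: the models on [sd k <= w] stay untouched. *)
Lemma Omp_far k : sd k <= w -> ~ Omp k.
Proof.
move=> hk [h1 h2]; have : sd k < 2 * w by have := w0; lra.
move/sd_lt=> _; have hk' : dz (2 * k.1) <= 2 * w /\ dz (2 * k.2) <= 2 * w.
  by move: hk; rewrite /sd ler_pdivrMr // ge_max (mulrC w) => /andP[].
have e a b : dz (2 * a) <= 2 * w -> dz (a - b) < 3 * w -> dz (2 * b) < 2 * (4 * w).
  move=> u v; have := dz_add (2 * a) (- (2 * (a - b))); rewrite dzN.
  have -> : 2 * a - 2 * (a - b) = 2 * b by ring.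
  by have := dz_double (a - b); lra.
have : sd c < 4 * w by case: hk' => a b; apply/sd_lt; split; [exact: e a h1|exact: e b h2].
by have := sdc; lra.
Qed.

Lemma chip0 k : ~ Omp k -> chip k = 0.
Proof.
move=> h; have [h1|h1] := ltP (dz (k.1 - c.1)) (3 * w); last first.
  by rewrite /chip bump0 ?mul0r //; have := w0; lra.
have [h2|h2] := ltP (dz (k.2 - c.2)) (3 * w); first by case: h.
by rewrite /chip (bump0 (x := k.2 - c.2)) ?mulr0 //; have := w0; lra.
Qed.

Lemma chip01 k : 0 <= chip k <= 1.
Proof.
have /andP[a1 a2] := bump01 w (k.1 - c.1); have /andP[b1 b2] := bump01 w (k.2 - c.2).
by rewrite /chip mulr_ge0 //= mulr_ile1.
Qed.

Lemma chif01 k : 0 <= chif k <= 1.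
Proof.
have [h|h] := pselect (Omp k).
  by rewrite /chif (chip0 (Omp_disjoint h)) addr0 chip01.
by rewrite /chif (chip0 h) add0r chip01.
Qed.

Lemma bump_cont (f : K2 -> R) k : (forall k', `|f k' - f k| <= Num.max `|k'.1 - k.1| `|k'.2 - k.2|) ->
  tendsto (nbh k) (fun k' => (bump w (f k'))%:C%C) (bump w (f k))%:C%C.
Proof.
move=> hf; apply: tendsto_real => e e0; exists (e * w); first by rewrite mulr_gt0.
move=> k' [h1 h2]; apply: le_lt_trans (bump_lip _ _ w0) _.
by rewrite ltr_pdivrMr //; apply: le_lt_trans (hf k') _; rewrite gt_max h1.
Qed.

Lemma chif_cont k : tendsto (nbh k) (fun k' => (chif k')%:C%C) (chif k)%:C%C.
Proof.
have e k' : (chif k')%:C%C = (bump w (k'.1 - c.1))%:C%C * (bump w (k'.2 - c.2))%:C%C +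
    (bump w (- k'.1 - c.1))%:C%C * (bump w (- k'.2 - c.2))%:C%C :> C.
  by rewrite /chif /chip rmorphD !rmorphM.
rewrite e; under eq_fun do rewrite e.
apply: (tendstoD (@nbh_le _ k)); apply: (tendstoM (@nbh_le _ k)).
- apply: (@bump_cont (fun k' => k'.1 - c.1)) => k'.
  by rewrite opprB addrA subrK le_max lexx.
- apply: (@bump_cont (fun k' => k'.2 - c.2)) => k'.
  by rewrite opprB addrA subrK le_max lexx orbT.
- apply: (@bump_cont (fun k' => - k'.1 - c.1)) => k'.
  by rewrite opprB addrA subrK -opprD normrN le_max lexx.
- apply: (@bump_cont (fun k' => - k'.2 - c.2)) => k'.
  by rewrite opprB addrA subrK -opprD normrN le_max lexx orbT.
Qed.

Lemma shift1 (x b : R) : dz (x + 1 - b) = dz (x - b) /\ dz (- (x + 1) - b) = dz (- x - b).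
Proof.
split; first by have := dzD (x - b) 1; rewrite addrAC.
by have := dzD (- x - b) (-1); rewrite mulrNz opprD addrAC.
Qed.

Lemma Omf_per : periodic Omf.
Proof.
move=> k; have [a1 a2] := shift1 k.1 c.1; have [b1 b2] := shift1 k.2 c.2.
by split; rewrite /Omf /Omp /= ?a1 ?a2 ?b1 ?b2.
Qed.

Lemma chif_per : periodic chif.
Proof.
move=> k; have [a1 a2] := shift1 k.1 c.1; have [b1 b2] := shift1 k.2 c.2.
by split; rewrite /chif /chip /bump /= ?a1 ?a2 ?b1 ?b2.
Qed.

(** Inside the cell the rounded integers are locally constant, because [3 w < 1 / 2] keeps away from
    ties; so [repr] is a translation near [k]. *)
Lemma Omp_near k : Omp k -> exists2 d, 0 < d & forall k', nbh k d k' ->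
  Omp k' /\ repr k' = (k'.1 - (rnd (k.1 - c.1))%:~R, k'.2 - (rnd (k.2 - c.2))%:~R).
Proof.
move=> [h1 h2]; have ws := w_small.
exists (Num.min (3 * w - dz (k.1 - c.1)) (3 * w - dz (k.2 - c.2))).
  by rewrite lt_min !subr_gt0 h1.
move=> k' [k1 k2]; move: k1 k2; rewrite !lt_min => /andP[k1 _] /andP[_ k2].
have e a a' b : `|a' - a| < 3 * w - dz (a - b) ->
    dz (a' - b) < 3 * w /\ rnd (a' - b) = rnd (a - b).
  move=> h; have h3 : `|a' - b - (rnd (a - b))%:~R| < 3 * w.
    have := ler_distD (a - b) (a' - b) (rnd (a - b))%:~R.
    rewrite [X in _ <= X + _](_ : _ = `|a' - a|); last by congr `|_|; ring.
    by move: h; rewrite /dz; lra.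
  by split; [exact: le_lt_trans (dz_le _ _) h3|apply: rnd_eq; lra].
by have [e1 e2] := e _ _ _ k1; have [e3 e4] := e _ _ _ k2; split; [split|rewrite /repr e2 e4].
Qed.

Lemma repr_box k : Omp k -> box c (3 * w) (repr k).
Proof.
move=> [/ltW h1 /ltW h2]; move: h1 h2; rewrite /dz => h1 h2.
by split; rewrite /= addrAC.
Qed.

Lemma al_repr k : al (repr k) = al k.
Proof.
case: hal => _ p _ _; rewrite -[RHS](periodic_int p (- rnd (k.1 - c.1)) (- rnd (k.2 - c.2))).
by rewrite !mulrNz.
Qed.

Lemma repr_per k : repr (k.1 + 1, k.2) = repr k /\ repr (k.1, k.2 + 1) = repr k.
Proof.
have e (x b : R) : x + 1 - (rnd (x + 1 - b))%:~R = x - (rnd (x - b))%:~R.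
  rewrite /rnd (_ : x + 1 - b + 1 / 2 = (x - b + 1 / 2) + 1%:~R); last by rewrite /=; ring.
  by rewrite floorDrz ?intr1 // floor1 intrD; ring.
by split; rewrite /repr /= e.
Qed.

Lemma free_patch : exists al', [/\ matching E al', forall k, mle dl (al' k - al k),
  forall k, box c w k -> disc (al' k) != 0 & forall k, sd k <= w -> al' k = al k].
Proof.
have [e [e' [e'0 e0 e'e me' [me Me]]]] := tolerance dl0.
have ws := w_small; have w3 : 0 <= 3 * w by rewrite mulr_ge0 // ltW.
case: (hal) => ac ap au atw.
have [be [bc bu bb]] := local_simple w3 e'0 mu1 ac au hmu.
(* On the cell stands the local correction, on the mirror cell its twisted copy. [Omp_disjoint]
   ensures that the two prescriptions never compete. *)
pose beta k := if `[< Omp k >] then be (repr k) else twist E (be (repr (opp2 k))).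
have bin k : Omp k -> beta k = be (repr k) by move=> h; rewrite /beta; case: asboolP.
have bout k : Omp (opp2 k) -> beta k = twist E (be (repr (opp2 k))).
  by move=> h; rewrite /beta; case: asboolP => // /Omp_disjoint.
have Omf_even k : Omf (opp2 k) = Omf k by rewrite /Omf opp2K; apply/propext; split; case; tauto.
have Omp_per k : Omp (k.1 + 1, k.2) = Omp k /\ Omp (k.1, k.2 + 1) = Omp k.
  have [a1 _] := shift1 k.1 c.1; have [b1 _] := shift1 k.2 c.2.
  by rewrite /Omp /= a1 b1.
have repr_oppper k : repr (opp2 (k.1 + 1, k.2)) = repr (opp2 k) /\
    repr (opp2 (k.1, k.2 + 1)) = repr (opp2 k).
  have [h1 _] := repr_per (opp2 (k.1 + 1, k.2)); have [_ h2] := repr_per (opp2 (k.1, k.2 + 1)).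
  by rewrite -h1 -h2 /opp2 /= !opprD !subrK.
have bcp k : Omp k -> tendsto_mx (nbh k) (fun k' => be (repr k')) (be (repr k)).
  move=> Ok; have [d d0 hd] := Omp_near Ok.
  apply: (@tendsto_comp _ _ _ (nbh k) (nbh (repr k)) repr) (bc (repr k)) => d' d'0.
  exists (Num.min d d'); first by rewrite lt_min d0.
  move=> k' hk'; have [|_ ->] := hd k'; first by apply: nbh_le hk'; rewrite ge_min lexx.
  have [h1 h2] : nbh k d' k' by apply: nbh_le hk'; rewrite ge_min lexx orbT.
  by split; rewrite /= opprB addrA subrK.
have pm := @patch_matching R m E hE al beta chif Omf e hal chif01 chif_cont chif_per.
have chif_even k : chif (opp2 k) = chif k by rewrite /chif opp2K addrC.
have Oopen k : Omf k -> exists2 d, 0 < d & forall k', nbh k d k' -> Omf k'.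
  case=> Ok; have [d d0 hd] := Omp_near Ok; exists d => // k' hk'.
    by left; case: (hd k' hk').
  by right; case: (hd _ (nbh_opp2 hk')).
have Oout k : ~ Omf k -> exists2 d, 0 < d & forall k', nbh k d k' -> Omf k' -> chif k' = 0.
  move=> nk; have far j : ~ Omp j -> exists2 d, 0 < d & forall k', nbh j d k' -> chip k' = 0.
    move=> nj; exists w => // k' [h1 h2]; have nj' : 3 * w <= dz (j.1 - c.1) \/ 3 * w <= dz (j.2 - c.2).
      have [a1|a1] := ltP (dz (j.1 - c.1)) (3 * w); last by left.
      by have [a2|a2] := ltP (dz (j.2 - c.2)) (3 * w); [case: nj|right].
    have st (x y b : R) : `|y - x| < w -> 3 * w <= dz (x - b) -> 2 * w <= dz (y - b).
      move=> xy hx; have := dz_lip (x - b) (y - b); rewrite opprB addrA subrK distrC.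
      by rewrite ler_norml (distrC x) => /andP[]; lra.
    case: nj' => hj; rewrite /chip; first by rewrite (bump0 w0 (st _ _ _ h1 hj)) mul0r.
    by rewrite (bump0 w0 (st _ _ _ h2 hj)) mulr0.
  have [d d0 hd] := far k (fun h => nk (or_introl h)).
  have [d' d'0 hd'] := far (opp2 k) (fun h => nk (or_intror h)).
  exists (Num.min d d'); first by rewrite lt_min d0.
  move=> k' hk' _; rewrite /chif hd ?hd' ?addr0 //.
    by apply: nbh_opp2; apply: nbh_le hk'; rewrite ge_min lexx orbT.
  by apply: nbh_le hk'; rewrite ge_min lexx.
have bcont k : Omf k -> tendsto_mx (nbh k) beta (beta k).
  case=> Ok; have [d d0 hd] := Omp_near Ok => i j; rewrite ?(bin _ Ok) ?(bout _ Ok).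
    apply: (@tendsto_ext _ _ _ (@nbh_le _ k) (fun k' => be (repr k') i j)); last exact: bcp.
    by exists d => // k' /hd [Ok' _]; rewrite bin.
  apply: (@tendsto_ext _ _ _ (@nbh_le _ k) (fun k' => twist E (be (repr (opp2 k'))) i j)).
    by exists d => // k' /nbh_opp2 /hd [Ok' _]; rewrite bout.
  have ht : tendsto_mx (nbh k) (fun k' => be (repr (opp2 k'))) (be (repr (opp2 k))).
    have hb := bcp (opp2 k) Ok; apply: tendsto_comp hb.
    by move=> d' d'0; exists d' => // k'; exact: nbh_opp2.
  exact: (twist_tendsto E (@nbh_le _ k) ht i j).
have bper k : Omf k -> beta (k.1 + 1, k.2) = beta k /\ beta (k.1, k.2 + 1) = beta k.
  move=> _; have [o1 o2] := Omp_per k; have [r1 r2] := repr_per k; have [q1 q2] := repr_oppper k.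
  by rewrite /beta o1 o2 r1 r2 q1 q2.
have bun k : Omf k -> beta k \is unitarymx.
  case=> Ok; first by rewrite (bin _ Ok); exact: bu.
  by rewrite (bout _ Ok); exact: (twist_unitary hE (bu _)).
have btw k : Omf k -> beta k = twist E (beta (opp2 k)).
  case=> Ok; last by rewrite (bout _ Ok) (bin _ Ok).
  have Ok' : Omp (opp2 (opp2 k)) by rewrite opp2K.
  by rewrite (bin _ Ok) (bout _ Ok') opp2K (twistK hE Etr s_sqr).
have bcl k : Omf k -> mle e (beta k - al k).
  case=> Ok.
    rewrite (bin _ Ok) -al_repr; have [h _] := bb _ (repr_box Ok).
    exact: mle_le e'e h.
  rewrite (bout _ Ok) [al k]atw -al_repr -twistB; have [h _] := bb _ (repr_box Ok).
  exact: mle_le me' (twist_mle hE h).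
exists (patch al beta chif Omf); split.
- exact: pm chif_even Omf_per Omf_even Oopen Oout bcont bper bun btw me bcl.
- move=> k; apply: mle_le Me _.
  exact: (patch_close hal chif01 bun (ltW e0) me bcl).
- move=> k [h1 h2].
  have sm (x : R) : `|x| <= w -> dz x <= w.
    by move=> hx; rewrite dz_small //; lra.
  have d1 := sm _ h1; have d2 := sm _ h2.
  have ww : w < 3 * w by have := w0; lra.
  have Ok : Omp k by split; [exact: le_lt_trans d1 ww|exact: le_lt_trans d2 ww].
  have ck : chif k = 1.
    by rewrite /chif (chip0 (Omp_disjoint Ok)) addr0 /chip !bump1 ?mulr1.
  rewrite (patch_one beta hal (or_introl Ok) ck) (bin _ Ok).
  have rk : repr k = k.
    have e1 (x : R) : `|x| <= w -> rnd x = 0 by move=> hx; apply: rnd_eq; rewrite subr0; lra.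
    by rewrite /repr !e1 // !subr0 -surjective_pairing.
  by have [_] := bb _ (repr_box Ok); rewrite rk.
- move=> k hk; rewrite patch_out // => -[]; first exact: Omp_far.
  by apply: Omp_far; rewrite sd_opp.
Qed.

End FreePatch.

(** * Gluing in the models at the high-symmetry points *)

Section HighSymPatch.
Variable R : realType.
Local Notation C := R[i].
Local Notation K2 := (R * R)%type.

Definition half_pt (b : bool) : R := b%:R / 2.
(** Modulo [Z^2] the high-symmetry points are the four pairs of values of [half_pt]. [hpar] picks
    the class of the nearest half-integer and [hoff] is the offset from that half-integer. *)
Definition hpar (x : R) : bool := (rnd (2 * x) %% 2 == 1)%Z.
Definition hoff (x : R) : R := x - (rnd (2 * x))%:~R / 2.

Lemma hoff_dz x : `|hoff x| = dz (2 * x) / 2.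
Proof.
rewrite /dz /hoff -[X in _ = _ / X](ger0_norm (ler0n R 2)) -normf_div; congr `|_|.
by rewrite mulrBl [2 * x]mulrC mulfK // pnatr_eq0.
Qed.

Lemma hoff_split x : exists q : int, x = half_pt (hpar x) + hoff x + q%:~R.
Proof.
exists (rnd (2 * x) %/ 2)%Z; rewrite /half_pt /hoff /hpar.
have e := divz_eq (rnd (2 * x)) 2; set N := rnd _ in e *.
have h : (N %% 2 == 1)%Z%:R = (N %% 2)%Z%:~R :> R.
  have : (N %% 2 = 0)%Z \/ (N %% 2 = 1)%Z by lia.
  by case=> ->.
rewrite h; have e2 : N%:~R = (N %/ 2)%Z%:~R * 2 + (N %% 2)%Z%:~R :> R.
  by rewrite {1}e intrD intrM.
by rewrite e2; field.
Qed.

Lemma rnd_near (x y : R) : `|y - x| < 1 / 2 - dz x -> rnd y = rnd x.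
Proof.
move=> h; apply: rnd_eq; have := ler_distD x y (rnd x)%:~R; rewrite -/(dz x); lra.
Qed.

Lemma rnd_add (x : R) (n : int) : rnd (x + n%:~R) = rnd x + n.
Proof. by rewrite /rnd addrAC floorDrz ?intr_int // intrKfloor. Qed.

Lemma rnd_opp (x : R) : dz x < 1 / 2 -> rnd (- x) = - rnd x.
Proof. by move=> h; apply: rnd_eq; rewrite mulrNz -opprD normrN. Qed.

Lemma hpar_add1 x : hpar (x + 1) = hpar x /\ hoff (x + 1) = hoff x.
Proof.
have e : rnd (2 * (x + 1)) = rnd (2 * x) + 2.
  by rewrite -rnd_add; congr rnd; rewrite mulrDr mulr1.
split; rewrite /hpar /hoff e; first by congr (_ == _); lia.
by rewrite intrD; field.
Qed.

(** [rnd] rounds ties upwards and is therefore odd only away from them. *)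
Lemma hpar_opp x : dz (2 * x) < 1 / 2 -> hpar (- x) = hpar x /\ hoff (- x) = - hoff x.
Proof.
move=> h; have e : rnd (2 * - x) = - rnd (2 * x) by rewrite mulrN rnd_opp.
split; rewrite /hpar /hoff e; last by rewrite mulrNz; ring.
by move: (rnd _) => N; apply/eqP/eqP; lia.
Qed.

Lemma hpar_near x y : `|y - x| < (1 / 2 - dz (2 * x)) / 2 ->
  hpar y = hpar x /\ hoff y - hoff x = y - x.
Proof.
move=> h; have e : rnd (2 * y) = rnd (2 * x).
  by apply: rnd_near; rewrite -mulrBr normrM ger0_norm //; lra.
by rewrite /hpar /hoff e; split=> //; ring.
Qed.

Variable m : nat.
Variable E : 'M[C]_m.
Hypothesis hE : E \is unitarymx.

Variables (al : K2 -> 'M[C]_m) (B : bool -> bool -> K2 -> 'M[C]_m) (e r : R).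
Hypothesis hal : matching E al.
Hypothesis e0 : 0 < e.
Hypothesis he : m%:R ^+ 2 * (e + e) <= 1.
Hypothesis r0 : 0 < r.
Hypothesis B_cont : forall b1 b2, fam_cont (B b1 b2).
Hypothesis B_unitary : forall b1 b2 k, B b1 b2 k \is unitarymx.
Hypothesis B_twist : forall b1 b2 k, B b1 b2 k = twist E (B b1 b2 (opp2 k)).
Hypothesis B_close : forall b1 b2 k, nbh (0, 0) r k ->
  mle e (B b1 b2 k - al (half_pt b1, half_pt b2)).

Definition hmodel (k : K2) : 'M[C]_m := B (hpar k.1) (hpar k.2) (hoff k.1, hoff k.2).

Lemma high_sym_patch : exists al' w, [/\ matching E al', 0 < w, w < r,
  forall k, mle ((1 + m%:R) * (e + e)) (al' k - al k) & forall k, sd k <= w -> al' k = hmodel k].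
Proof.
case: (hal) => ac ap au atw.
have [r1 r10 hr1] : exists2 d, 0 < d & forall k, nbh (0, 0) d k -> forall b : bool * bool,
    mle e (al (half_pt b.1 + k.1, half_pt b.2 + k.2) - al (half_pt b.1, half_pt b.2)).
  apply: (@near_forall R K2 (nbh (0, 0)) (@nbh_le _ _) (bool * bool)%type) => -[b1 b2] /=.
  have /(tendsto_mxP (@nbh_le _ _)) := ac (half_pt b1, half_pt b2) => /(_ e e0) [d d0 hd].
  exists d => // k [/= h1 h2]; apply: hd; move: h1 h2; rewrite !subr0 => h1 h2.
  by split; rewrite /= addrAC subrr add0r.
(* [3 w] stays below [r], where the models are close to the values of [al] at the centres, below
   [r1], where [al] itself is, and below [1 / 4], so that the neighbourhoods of different
   high-symmetry points are disjoint. *)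
pose w := Num.min (Num.min r r1 / 4) (1 / 16).
have w0 : 0 < w by rewrite !lt_min !divr_gt0 // lt_min r0.
have w16 : w <= 1 / 16 by rewrite ge_min lexx orbT.
have wr : 3 * w < r.
  have : w <= Num.min r r1 / 4 by rewrite ge_min lexx.
  have : Num.min r r1 <= r by rewrite ge_min lexx.
  by have := w0; lra.
have wr1 : 3 * w < r1.
  have : w <= Num.min r r1 / 4 by rewrite ge_min lexx.
  have : Num.min r r1 <= r1 by rewrite ge_min lexx orbT.
  by have := w0; lra.
pose Om (k : K2) := dz (2 * k.1) < 6 * w /\ dz (2 * k.2) < 6 * w.
pose chi (k : K2) := bump (2 * w) (2 * k.1) * bump (2 * w) (2 * k.2).
have ww0 : 0 < 2 * w by rewrite mulr_gt0.
have Ohalf k : Om k -> dz (2 * k.1) < 1 / 2 /\ dz (2 * k.2) < 1 / 2.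
  by move=> [h1 h2]; split; [move: h1|move: h2]; lra.
have dzper (x : R) : dz (2 * (x + 1)) = dz (2 * x) by rewrite mulrDr mulr1 -(dzD (2 * x) 2).
have bper (x : R) : bump (2 * w) (2 * (x + 1)) = bump (2 * w) (2 * x) by rewrite /bump dzper.
have al_half k : al k = al (half_pt (hpar k.1) + hoff k.1, half_pt (hpar k.2) + hoff k.2).
  have [q1 e1] := hoff_split k.1; have [q2 e2] := hoff_split k.2.
  rewrite {1}(surjective_pairing k) {1}e1 {1}e2.
  exact: (periodic_int ap q1 q2 (half_pt (hpar k.1) + hoff k.1, half_pt (hpar k.2) + hoff k.2)).
have near0 k d : Om k -> 3 * w < d -> nbh (0, 0) d (hoff k.1, hoff k.2).
  by move=> [h1 h2] hd; split; rewrite /= subr0 hoff_dz; lra.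
have chi_cont k : tendsto (nbh k) (fun k' => (chi k')%:C%C) (chi k)%:C%C.
  have ex k' : (chi k')%:C%C = (bump (2 * w) (2 * k'.1))%:C%C * (bump (2 * w) (2 * k'.2))%:C%C :> C.
    by rewrite /chi rmorphM.
  have bc (x y e' : R) : `|y - x| < e' * w -> `|bump (2 * w) (2 * y) - bump (2 * w) (2 * x)| < e'.
    move=> h; apply: le_lt_trans (bump_lip _ _ ww0) _; rewrite ltr_pdivrMr //.
    by rewrite -mulrBr normrM ger0_norm // mulrCA ltr_pM2l.
  rewrite ex; under eq_fun do rewrite ex.
  apply: (tendstoM (@nbh_le _ k)); apply: tendsto_real => e' e'0; exists (e' * w);
    by [rewrite mulr_gt0|move=> k' [h1 h2]; apply: bc].
have chi01 k : 0 <= chi k <= 1.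
  have /andP[a1 a2] := bump01 (2 * w) (2 * k.1); have /andP[b1 b2] := bump01 (2 * w) (2 * k.2).
  by rewrite /chi mulr_ge0 //= mulr_ile1.
have chi_per : periodic chi by move=> k; rewrite /chi /= !bper.
have chi_even k : chi (opp2 k) = chi k by rewrite /chi /= !mulrN !bumpN.
have Om_per : periodic Om by move=> k; rewrite /Om /= !dzper.
have Om_even k : Om (opp2 k) = Om k by rewrite /Om /= !mulrN !dzN.
have Om_open k : Om k -> exists2 d, 0 < d & forall k', nbh k d k' -> Om k'.
  move=> [h1 h2]; exists (Num.min (3 * w - dz (2 * k.1) / 2) (3 * w - dz (2 * k.2) / 2)).
    by rewrite lt_min; apply/andP; split; lra.
  move=> k' [k1 k2]; move: k1 k2; rewrite !lt_min => /andP[k1 _] /andP[_ k2].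
  have st (x y : R) : `|y - x| < 3 * w - dz (2 * x) / 2 -> dz (2 * y) < 6 * w.
    move=> h; have := dz_lip (2 * y) (2 * x); rewrite -mulrBr normrM (ger0_norm (ler0n R 2)).
    by rewrite ler_norml => /andP[_]; lra.
  by split; [exact: st k1|exact: st k2].
have Om_out k : ~ Om k -> exists2 d, 0 < d & forall k', nbh k d k' -> Om k' -> chi k' = 0.
  move=> nk; exists w => // k' [k1 k2] _.
  have st (x y : R) : `|y - x| < w -> 6 * w <= dz (2 * x) -> 2 * (2 * w) <= dz (2 * y).
    move=> h hx; have := dz_lip (2 * y) (2 * x); rewrite -mulrBr normrM (ger0_norm (ler0n R 2)).
    by rewrite ler_norml => /andP[h' _]; lra.
  have [h1|h1] := ltP (dz (2 * k.1)) (6 * w); last first.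
    by rewrite /chi (bump0 ww0 (st _ _ k1 h1)) mul0r.
  have [h2|h2] := ltP (dz (2 * k.2)) (6 * w); first by case: nk.
  by rewrite /chi (bump0 ww0 (st _ _ k2 h2)) mulr0.
have be_cont k : Om k -> tendsto_mx (nbh k) hmodel (hmodel k).
  move=> Ok; have [h1 h2] := Ohalf k Ok; move=> i j.
  pose d := Num.min ((1 / 2 - dz (2 * k.1)) / 2) ((1 / 2 - dz (2 * k.2)) / 2).
  have d0 : 0 < d by rewrite lt_min; apply/andP; split; lra.
  have hd k' : nbh k d k' -> [/\ hpar k'.1 = hpar k.1, hpar k'.2 = hpar k.2,
      hoff k'.1 - hoff k.1 = k'.1 - k.1 & hoff k'.2 - hoff k.2 = k'.2 - k.2].
    move=> [k1 k2]; move: k1 k2; rewrite !lt_min => /andP[k1 _] /andP[_ k2].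
    by have [a1 a2] := hpar_near k1; have [b1 b2] := hpar_near k2.
  apply: (@tendsto_ext _ _ _ (@nbh_le _ k)
    (fun k' => B (hpar k.1) (hpar k.2) (hoff k'.1, hoff k'.2) i j)).
    by exists d => // k' /hd [a1 a2 _ _]; rewrite /hmodel a1 a2.
  have hb := @B_cont (hpar k.1) (hpar k.2) (hoff k.1, hoff k.2).
  have hc : forall e', 0 < e' -> exists2 d', 0 < d' & forall k', nbh k d' k' ->
      nbh (hoff k.1, hoff k.2) e' (hoff k'.1, hoff k'.2).
    move=> e' e'0; exists (Num.min d e'); first by rewrite lt_min d0.
    move=> k' hk'; have [|_ _ a3 a4] := hd k'; first by apply: nbh_le hk'; rewrite ge_min lexx.
    have [b1 b2] : nbh k e' k' by apply: nbh_le hk'; rewrite ge_min lexx orbT.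
    by split; rewrite /= ?a3 ?a4.
  exact: (tendsto_comp hc hb i j).
have be_per k : Om k -> hmodel (k.1 + 1, k.2) = hmodel k /\ hmodel (k.1, k.2 + 1) = hmodel k.
  move=> _; have [a1 a2] := hpar_add1 k.1; have [b1 b2] := hpar_add1 k.2.
  by rewrite /hmodel /= a1 a2 b1 b2.
have be_unitary k : Om k -> hmodel k \is unitarymx by move=> _; exact: B_unitary.
have be_twist k : Om k -> hmodel k = twist E (hmodel (opp2 k)).
  move=> /Ohalf [h1 h2]; have [a1 a2] := hpar_opp h1; have [b1 b2] := hpar_opp h2.
  by rewrite /hmodel /= a1 a2 b1 b2; exact: B_twist.
have be_close k : Om k -> mle (e + e) (hmodel k - al k).
  move=> Ok; have h1 := B_close (hpar k.1) (hpar k.2) (near0 _ _ Ok wr).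
  have h2 := hr1 _ (near0 _ _ Ok wr1) (hpar k.1, hpar k.2).
  by rewrite (al_half k); exact: (mle_triangle h1 (mleBC h2)).
have ee0 : 0 <= e + e by rewrite addr_ge0 // ltW.
exists (patch al hmodel chi Om), w; split.
- exact: (patch_matching hE hal chi01 chi_cont chi_per chi_even Om_per Om_even Om_open Om_out
    be_cont be_per be_unitary be_twist he be_close).
- exact: w0.
- by move: wr; have := w0; lra.
- exact: (patch_close hal chi01 be_unitary ee0 he be_close).
- move=> k hk; have hk' : dz (2 * k.1) <= 2 * w /\ dz (2 * k.2) <= 2 * w.
    by move: hk; rewrite /sd ler_pdivrMr // ge_max (mulrC w) => /andP[].
  have [h1 h2] := hk'; apply: (patch_one _ hal).
    by split; [move: h1|move: h2]; have := w0; lra.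
  by rewrite /chi !bump1 ?mulr1.
Qed.

End HighSymPatch.

(** * Treating the cells one after another *)

Section Assembly.
Variable R : realType.
Local Notation C := R[i].
Local Notation K2 := (R * R)%type.
Variable m : nat.
Variables (E : 'M[C]_m) (s : C).
Hypothesis hE : E \is unitarymx.
Hypothesis Etr : E^T = s *: E.
Hypothesis s_sqr : s * s = 1.

Local Notation ubox := (box (1 / 2, 1 / 2) (1 / 2 : R)).

Definition mclose (A : 'M[C]_m) (d : R) (U : 'M[C]_m) := mle d (U - A).

Lemma mclose_le A d d' U : d <= d' -> mclose A d U -> mclose A d' U.
Proof. exact: mle_le. Qed.

Lemma mclose_id A : tendsto_mx (mclose A) (fun U => U) A.
Proof. by apply/(tendsto_mxP (@mclose_le A)) => e e0; exists e. Qed.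

Lemma disc_open A : disc A != 0 -> exists2 d, 0 < d & forall U, mclose A d U -> disc U != 0.
Proof.
move=> hA; have [d d0 hd] := tendsto_neq0 hA (tendsto_disc (@mclose_le A) (mclose_id A)).
exists d; first exact: d0.
move=> U hU; have h := hd U hU; rewrite -normc_gt0; apply: lt_trans h.
by apply: divr_gt0 => //; rewrite normc_gt0.
Qed.

Lemma shift_open A mu : A + mu%:M \in unitmx ->
  exists2 d, 0 < d & forall U, mclose A d U -> U + mu%:M \in unitmx.
Proof.
rewrite unitmxE unitfE => hA.
have ht : tendsto (mclose A) (fun U => \det (U + mu%:M)) (\det (A + mu%:M)).
  apply: (tendsto_det (@mclose_le A)); apply: (tendsto_mxD (@mclose_le A)) (tendsto_mx_cst _ _).
  exact: mclose_id.
have [d d0 hd] := tendsto_neq0 hA ht.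
exists d; first exact: d0.
move=> U hU; have h := hd U hU; rewrite unitmxE unitfE -normc_gt0; apply: lt_trans h.
by apply: divr_gt0 => //; rewrite normc_gt0.
Qed.

Lemma open_near (al : K2 -> 'M[C]_m) (Q : 'M[C]_m -> Prop) k : fam_cont al ->
  (exists2 d, 0 < d & forall U, mclose (al k) d U -> Q U) ->
  exists2 d, 0 < d & forall k' e, nbh k d k' -> e < d -> forall U, mclose (al k') e U -> Q U.
Proof.
move=> ac [d d0 hd]; have d2 : 0 < d / 2 by rewrite divr_gt0.
have /(tendsto_mxP (@nbh_le _ k)) /(_ _ d2) [d' d'0 hd'] := ac k.
exists (Num.min d' (d / 2)); first by rewrite lt_min d'0.
move=> k' e hk'; rewrite lt_min => /andP[_ ed] U hU; apply: hd.
have h1 : mle (d / 2) (al k' - al k) by apply: hd'; apply: nbh_le hk'; rewrite ge_min lexx.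
have := mle_triangle (mle_le (ltW ed) hU) h1; by rewrite -splitr.
Qed.

Definition kclosed (D : K2 -> Prop) :=
  forall k, ~ D k -> exists2 d, 0 < d & forall k', nbh k d k' -> ~ D k'.

(** The resulting [e] is the margin that later corrections must respect in order not to recreate
    degeneracies in [D]. *)
Lemma disc_stable (al : K2 -> 'M[C]_m) (D : K2 -> Prop) : fam_cont al -> kclosed D ->
  (forall k, ubox k -> D k -> disc (al k) != 0) ->
  exists2 e, 0 < e & forall k, ubox k -> D k -> forall U, mle e (U - al k) -> disc U != 0.
Proof.
move=> ac Dc hD.
apply: (@box_uniform _ _ _ (fun e k => D k -> forall U, mle e (U - al k) -> disc U != 0)).
move=> k hk; have [Dk|Dk] := pselect (D k); last first.
  by have [d d0 hd] := Dc k Dk; exists d => // k' e /hd.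
have [d d0 hd] := open_near (Q := fun U => disc U != 0) ac (disc_open (hD k hk Dk)).
by exists d => // k' e hk' _ ed _ U; exact: hd hk' ed U.
Qed.

(** A Lebesgue number for the Cayley charts. The same [e] limits the size of a cell and the total
    change of the family, so the [mu] of each cell can be fixed before any correction is made. *)
Lemma uniform_shift (al : K2 -> 'M[C]_m) : fam_cont al -> (forall k, al k \is unitarymx) ->
  exists2 e, 0 < e & forall k, ubox k -> exists2 mu, normc mu = 1 &
    forall k', nbh k e k' -> forall U, mle e (U - al k') -> U + mu%:M \in unitmx.
Proof.
move=> ac au.
apply: (@box_uniform _ _ _ (fun e k => exists2 mu, normc mu = 1 &
    forall k', nbh k e k' -> forall U, mle e (U - al k') -> U + mu%:M \in unitmx)).
move=> k hk; have [mu mu1 hmu] := exists_shift (al k).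
have [d d0 hd] := open_near (Q := fun U => U + mu%:M \in unitmx) ac (shift_open hmu).
exists (d / 2); first by rewrite divr_gt0.
move=> k' e hk' e0 ed; exists mu => // k'' hk'' U.
apply: hd; last by lra.
case: hk' hk'' => a1 a2 [b1 b2]; split.
  have := ler_distD k'.1 k''.1 k.1; lra.
have := ler_distD k'.2 k''.2 k.2; lra.
Qed.

Lemma box_closed c w : kclosed (box c w).
Proof.
move=> k nk.
have st (x y b : R) d : w < `|x - b| -> d = `|x - b| - w -> `|y - x| < d -> ~ `|y - b| <= w.
  by move=> h -> hy hb; have := ler_distD y x b; rewrite (distrC x y); lra.
have [h1|h1] := lerP `|k.1 - c.1| w; last first.
  exists (`|k.1 - c.1| - w); first by rewrite subr_gt0.
  by move=> k' [a1 _] [b1 _]; exact: st h1 erefl a1 b1.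
have [h2|h2] := lerP `|k.2 - c.2| w; first by case: nk.
exists (`|k.2 - c.2| - w); first by rewrite subr_gt0.
by move=> k' [_ a2] [_ b2]; exact: st h2 erefl a2 b2.
Qed.

Lemma kclosedU (D D' : K2 -> Prop) : kclosed D -> kclosed D' -> kclosed (fun k => D k \/ D' k).
Proof.
move=> hD hD' k nk; have [d d0 h] := hD k (fun x => nk (or_introl x)).
have [d' d'0 h'] := hD' k (fun x => nk (or_intror x)).
exists (Num.min d d'); first by rewrite lt_min d0.
move=> k' hk' []; first by apply: h; apply: nbh_le hk'; rewrite ge_min lexx.
by apply: h'; apply: nbh_le hk'; rewrite ge_min lexx orbT.
Qed.

(** [D] is the region already treated and [t] the budget still available. Each cell spends at most
    half of [t] and no more than the margin of [disc_stable] on [D]. *)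
Lemma process_boxes w (cs : seq K2) : 0 < w -> (forall c, c \in cs -> 4 * w <= sd c) ->
  forall al (D : K2 -> Prop) t, matching E al -> kclosed D -> 0 < t ->
  (forall k, ubox k -> D k -> disc (al k) != 0) ->
  (forall c, c \in cs -> exists2 mu, normc mu = 1 &
     forall k, box c (3 * w) k -> forall U, mle t (U - al k) -> U + mu%:M \in unitmx) ->
  exists al', [/\ matching E al', forall k, mle t (al' k - al k),
    forall k, sd k <= w -> al' k = al k
    & forall k, ubox k -> D k \/ (exists2 c, c \in cs & box c w k) -> disc (al' k) != 0].
Proof.
move=> w0; elim: cs => [|c cs IH] hcs al D t hal Dc t0 hD hmu.
  exists al; split=> // [k|k hk [|[c]]] //; last exact: hD.
  by rewrite subrr => i j; rewrite mxE normc0 ltW.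
case: (hal) => ac _ _ _.
have [e e0 he] := disc_stable ac Dc hD.
have dl0 : 0 < Num.min e (t / 2) by rewrite lt_min e0 divr_gt0.
have [mu mu1 hmu1] := hmu c (mem_head _ _).
have z0 k : mle t (al k - al k) by rewrite subrr => i j; rewrite mxE normc0 ltW.
have [al1 [m1 c1 d1 s1]] := free_patch hE Etr s_sqr hal w0 (hcs c (mem_head _ _)) dl0 mu1
  (fun k hk => hmu1 k hk _ (z0 k)).
have t2 : 0 < t / 2 by rewrite divr_gt0.
have c1t k : mle (t / 2) (al1 k - al k) by apply: mle_le (c1 k); rewrite ge_min lexx orbT.
have [|||al2 [m2 c2 s2 d2]] := IH _ al1 (fun k => D k \/ box c w k) (t / 2) m1
  (kclosedU Dc (@box_closed c w)) t2.
- by move=> c' hc'; apply: hcs; rewrite inE hc' orbT.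
- move=> k hk [Dk|]; last exact: d1.
  by apply: he hk Dk _ _; apply: mle_le (c1 k); rewrite ge_min lexx.
- move=> c' hc'; have [|mu' mu'1 hmu'] := hmu c'; first by rewrite inE hc' orbT.
  exists mu' => // k hk U hU; apply: hmu' hk _ _.
  by have := mle_triangle hU (c1t k); rewrite -splitr.
exists al2; split=> //.
- by move=> k; have := mle_triangle (c2 k) (c1t k); rewrite -splitr.
- by move=> k hk; rewrite s2 // s1.
- move=> k hk; case=> [Dk|[c']]; first by apply: d2 => //; left; left.
  rewrite inE => /orP[/eqP ->|hc'] hb; first by apply: d2 => //; left; right.
  by apply: d2 => //; right; exists c'.
Qed.

Lemma sd_lip (k k' : K2) r : `|k.1 - k'.1| <= r -> `|k.2 - k'.2| <= r -> sd k <= sd k' + r.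
Proof.
move=> h1 h2.
have st (x y : R) : `|x - y| <= r -> dz (2 * x) <= dz (2 * y) + 2 * r.
  move=> h; have := dz_lip (2 * x) (2 * y); rewrite -mulrBr normrM (ger0_norm (ler0n R 2)).
  by rewrite ler_norml => /andP[_]; lra.
rewrite {1}/sd ler_pdivrMr // ge_max.
have a1 : dz (2 * k'.1) <= sd k' * 2 by rewrite /sd divfK ?pnatr_eq0 // le_max lexx.
have a2 : dz (2 * k'.2) <= sd k' * 2 by rewrite /sd divfK ?pnatr_eq0 // le_max lexx orbT.
by have b1 := st _ _ h1; have b2 := st _ _ h2; apply/andP; split; lra.
Qed.

Lemma sd_shell_closed w w1 : kclosed (fun k => w <= sd k /\ sd k <= w1).
Proof.
move=> k nk; have lip k' d : nbh k d k' -> sd k' <= sd k + d /\ sd k <= sd k' + d.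
  move=> [a1 a2]; split; apply: sd_lip; rewrite 1?distrC ltW // distrC //.
have [h1|h1] := ltP (sd k) w.
  exists ((w - sd k) / 2); first by rewrite divr_gt0 // subr_gt0.
  by move=> k' /lip [b _] [b' _]; lra.
have [h2|h2] := ltP w1 (sd k); last by case: nk.
exists ((sd k - w1) / 2); first by rewrite divr_gt0 // subr_gt0.
by move=> k' /lip [_ b] [_ b']; lra.
Qed.

Lemma grid_cover n (x : R) : (0 < n)%N -> 0 <= x <= 1 ->
  exists a : 'I_n.+1, `|x - a%:R / n%:R| <= (n%:R)^-1 / 2.
Proof.
move=> n0 /andP[x0 x1]; have nr : 0 < n%:R :> R by rewrite ltr0n.
have y0 : 0 <= x * n%:R + 1 / 2 by rewrite addr_ge0 ?divr_ge0 ?mulr_ge0 ?(ltW nr).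
have /andP[t1 t2] := truncn_itv y0; set a := Num.truncn _ in t1 t2.
have an : (a < n.+1)%N.
  rewrite ltnNge; apply/negP => h; have : n.+1%:R <= a%:R :> R by rewrite ler_nat.
  rewrite -(natr1 n); have : x * n%:R <= n%:R by rewrite ler_piMl ?(ltW nr).
  lra.
exists (Ordinal an) => /=.
have -> : x - a%:R / n%:R = (x * n%:R - a%:R) / n%:R by field; rewrite gt_eqF.
rewrite normrM [X in _ * X]gtr0_norm ?invr_gt0 // mulrC ler_pM2l ?invr_gt0 //.
by move: t2; rewrite -(natr1 a) => t2; rewrite ler_norml; lra.
Qed.

Variables (al : K2 -> 'M[C]_m) (B : bool -> bool -> K2 -> 'M[C]_m) (e r dl : R).
Hypothesis hal : matching E al.
Hypothesis e0 : 0 < e.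
Hypothesis he : m%:R ^+ 2 * (e + e) <= 1.
Hypothesis hdl : (1 + m%:R) * (e + e) < dl.
Hypothesis r0 : 0 < r.
Hypothesis B_cont : forall b1 b2, fam_cont (B b1 b2).
Hypothesis B_unitary : forall b1 b2 k, B b1 b2 k \is unitarymx.
Hypothesis B_twist : forall b1 b2 k, B b1 b2 k = twist E (B b1 b2 (opp2 k)).
Hypothesis B_close : forall b1 b2 k, nbh (0, 0) r k ->
  mle e (B b1 b2 k - al (half_pt R b1, half_pt R b2)).
Hypothesis B_disc : forall b1 b2 k, nbh (0, 0) r k -> k != (0, 0) -> disc (B b1 b2 k) != 0.

(** On the shell [w <= sd k <= w1] the models are already non-degenerate, so [process_boxes] starts
    from it. The cells have to cover only [sd k > w1], and they do not disturb [sd k <= w]. *)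
Lemma generic_approx : exists al' w, [/\ matching E al', forall k, mle dl (al' k - al k),
  0 < w < r, forall k, sd k <= w -> al' k = hmodel B k
  & forall k, w <= sd k -> disc (al' k) != 0].
Proof.
have [al1 [w1 [m1 w10 w1r c1 s1]]] := high_sym_patch hE hal e0 he r0 B_cont B_unitary B_twist B_close.
case: (m1) => ac _ au _.
have [t0' t0'0 ht0] := uniform_shift ac au.
(* The cells may spend what the gluing of the models has left of [dl]. *)
pose t := Num.min (t0' / 2) (dl - (1 + m%:R) * (e + e)).
have t0 : 0 < t by rewrite lt_min divr_gt0 // subr_gt0.
have tt : t <= t0' by apply: le_trans (_ : t0' / 2 <= _); [rewrite ge_min lexx|lra].
(* The nodes are [2 w] apart. Because [5 w <= w1], a point with [sd k > w1] is within [w] of a node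
   [c] with [sd c >= 4 w]; because [3 w < t0'], the cell around that node fits into one chart. *)
pose n := (Num.truncn (3 / t0' + 5 / w1)).+1.
have n0 : (0 < n)%N by [].
have nr : 0 < n%:R :> R by rewrite ltr0n.
pose w : R := (n%:R)^-1 / 2.
have w0 : 0 < w by rewrite divr_gt0 // invr_gt0.
have hn : 3 / t0' + 5 / w1 < n%:R by exact: truncnS_gt.
have q1 : 0 < 3 / t0' by rewrite divr_gt0.
have q2 : 0 < 5 / w1 by rewrite divr_gt0.
have ninv : 2 * w = (n%:R)^-1 by rewrite /w mulrC divfK // pnatr_eq0.
have wt : 3 * w < t0'.
  have : 3 / t0' < n%:R by lra.
  rewrite ltr_pdivrMr // mulrC -ltr_pdivrMr // -ninv; have := w0; lra.
have ww1 : 5 * w <= w1.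
  have : 5 / w1 < n%:R by lra.
  rewrite ltr_pdivrMr // mulrC -ltr_pdivrMr // -ninv; have := w0; lra.
pose ctr (a : 'I_n.+1 * 'I_n.+1) : K2 := (a.1%:R / n%:R, a.2%:R / n%:R).
pose cs : seq K2 := [seq c <- [seq ctr a | a <- enum {: 'I_n.+1 * 'I_n.+1}] | 4 * w <= sd c].
have hcs c : c \in cs -> 4 * w <= sd c by rewrite mem_filter => /andP[].
have cbox c : c \in cs -> ubox c.
  rewrite mem_filter => /andP[_ /mapP [a _ ->]].
  have st (b : 'I_n.+1) : `|b%:R / n%:R - 1 / 2| <= 1 / 2 :> R.
    have h1 : 0 <= b%:R / n%:R :> R by rewrite divr_ge0.
    have h2 : b%:R / n%:R <= 1 :> R by rewrite ler_pdivrMr // mul1r ler_nat -ltnS.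
    by rewrite ler_norml; apply/andP; split; lra.
  by split; exact: st.
have D0 k : ubox k -> w <= sd k /\ sd k <= w1 -> disc (al1 k) != 0.
  move=> _ [k1 k2]; rewrite (s1 k k2); apply: B_disc.
    have hd (x : R) : dz (2 * x) / 2 <= sd k -> `|hoff x - 0| < r.
      by rewrite subr0 hoff_dz => h; apply: le_lt_trans h (le_lt_trans k2 w1r).
    by split; apply: hd; rewrite /sd ler_pM2r ?invr_gt0 // le_max lexx ?orbT.
  apply/eqP => -[/eqP h1 /eqP h2].
  have z (x : R) : hoff x == 0 -> dz (2 * x) = 0.
    rewrite -normr_eq0 hoff_dz mulf_eq0 invr_eq0 pnatr_eq0 orbF => /eqP //.
  by move: k1; rewrite /sd (z _ h1) (z _ h2) maxxx mul0r; have := w0; lra.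
have hmu c : c \in cs -> exists2 mu, normc mu = 1 &
    forall k, box c (3 * w) k -> forall U, mle t (U - al1 k) -> U + mu%:M \in unitmx.
  move=> /cbox hc; have [mu mu1 hmu] := ht0 c hc; exists mu => // k [h1 h2] U hU.
  apply: hmu (mle_le tt hU); split; [exact: le_lt_trans h1 wt|exact: le_lt_trans h2 wt].
have [al2 [m2 c2 s2 d2]] := process_boxes w0 hcs m1 (@sd_shell_closed w w1) t0 D0 hmu.
exists al2, w; split.
- exact: m2.
- move=> k; have := mle_triangle (c2 k) (c1 k); apply: mle_le.
  have : t <= dl - (1 + m%:R) * (e + e) by rewrite ge_min lexx orbT.
  by lra.
- by rewrite w0 /=; apply: le_lt_trans w1r; have := w0; lra.
- by move=> k hk; rewrite (s2 k hk) s1 // (le_trans hk) //; have := w0; lra.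
- have hu k : ubox k -> w <= sd k -> disc (al2 k) != 0.
    move=> hk h1; apply: d2 => //; have [h2|h2] := leP (sd k) w1; first by left.
    right; have u01 (x : R) : `|x - 1 / 2| <= 1 / 2 -> 0 <= x <= 1.
      by rewrite ler_norml => /andP[a1 a2]; apply/andP; split; lra.
    case: (hk) => /u01 k1 /u01 k2.
    have [a ha] := grid_cover n0 k1; have [b hb] := grid_cover n0 k2.
    exists (ctr (a, b)); last by [].
    rewrite mem_filter map_f ?mem_enum // andbT.
    have := sd_lip (k := k) (k' := ctr (a, b)) ha hb; rewrite -/w; have := w0; lra.
  move=> k hk; case: (m2) => _ ap _ _.
  have hp := periodic_int ap (- Num.floor k.1) (- Num.floor k.2) k.
  rewrite -hp; apply: hu.
    have st (x : R) : `|x + (- Num.floor x)%:~R - 1 / 2| <= 1 / 2.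
      have /andP[a1 a2] := floor_itv x; move: a2; rewrite intrD => a2.
      by rewrite mulrNz ler_norml; apply/andP; split; lra.
    by split; exact: st.
  have dper (x : R) (q : int) : dz (2 * (x + q%:~R)) = dz (2 * x).
    by rewrite mulrDr -(dzD (2 * x) (2 * q)) intrM.
  by rewrite /sd /= !dper.
Qed.

End Assembly.

(** * Generic approximation *)

Section GenericForms.
Variable R : realType.
Local Notation C := R[i].
Local Notation K2 := (R * R)%type.

Lemma sd_gt0 (k : K2) : (hoff k.1, hoff k.2) != (0, 0) -> 0 < sd k.
Proof.
move=> h; rewrite lt_neqAle divr_ge0 ?le_max ?dz_ge0 // andbT eq_sym.
apply: contraNneq h => s0; have h x : dz x / 2 <= sd k -> dz x = 0.
  by rewrite s0 => h; apply/eqP; rewrite eq_le dz_ge0 andbT; move: h; lra.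
have z x : dz (2 * x) / 2 <= sd k -> hoff x = 0.
  by move=> /h hx; apply/eqP; rewrite -normr_eq0 hoff_dz hx mul0r.
by rewrite !z // ler_pM2r ?invr_gt0 // le_max lexx ?orbT.
Qed.

Lemma hoff_le_sd (k : K2) r : sd k < r -> nbh (0, 0) r (hoff k.1, hoff k.2).
Proof.
by move=> h; split; rewrite /= subr0 hoff_dz (le_lt_trans _ h) // ler_pM2r ?invr_gt0 //
  le_max lexx ?orbT.
Qed.

Lemma hoff_eq0 (k : K2) : sd k = 0 -> hoff k.1 = 0 /\ hoff k.2 = 0.
Proof.
move=> h; have [/eqP[]//|h1] := boolP ((hoff k.1, hoff k.2) == (0, 0)).
by have := sd_gt0 h1; rewrite h ltxx.
Qed.

(** Here [k] and [-k] differ by a lattice vector, so the matching condition constrains a single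
    matrix. *)
Lemma half_pt_twist m (E : 'M[C]_m) al b1 b2 : matching E al ->
  al (half_pt R b1, half_pt R b2) = twist E (al (half_pt R b1, half_pt R b2)).
Proof.
case=> _ p _ tw; rewrite {1}tw; congr (twist E _); rewrite /opp2 /=.
rewrite -[RHS](periodic_int p (- (b1 : nat)%:Z) (- (b2 : nat)%:Z)) /=.
have hb (b : bool) : half_pt R b + (- (b : nat)%:Z)%:~R = - half_pt R b.
  by rewrite /half_pt mulrNz; change ((b : nat)%:Z%:~R) with ((b : nat)%:R : R); lra.
by rewrite !hb.
Qed.

(** [dl'] is also small enough for [null_homotopic_close], and the models use up strictly less than
    [dl'], which leaves a positive budget for the cells. *)
Lemma small_scale m (dl : R) : 0 < dl -> exists dl' e : R, [/\ 0 < dl', dl' <= dl,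
  m%:R ^+ 2 * dl' <= 1 & [/\ 0 < e, m%:R ^+ 2 * (e + e) <= 1 & (1 + m%:R) * (e + e) < dl']].
Proof.
move=> d0; pose dl' : R := Num.min dl (m%:R ^+ 2 + 1)^-1.
have M0 : 0 < m%:R ^+ 2 + 1 :> R by rewrite ltr_wpDl ?exprn_ge0.
have d'0 : 0 < dl' by rewrite lt_min d0 invr_gt0.
have [|e [_ [_ e0 _ _ [h1 h2]]]] := @tolerance R m (dl' / 2); first by rewrite divr_gt0.
exists dl', (e / 2); have ee : e / 2 + e / 2 = e by lra.
rewrite ee divr_gt0 //; split=> //; first by rewrite ge_min lexx.
  have h : dl' <= (m%:R ^+ 2 + 1)^-1 by rewrite ge_min lexx orbT.
  apply: le_trans (ler_wpM2l _ h) _; first by rewrite exprn_ge0.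
  by rewrite ler_pdivrMr // mul1r lerDl.
by split=> //; apply: le_lt_trans h2 _; lra.
Qed.

Lemma twist_id m (A : 'M[C]_m) : twist 1%:M A = A^T.
Proof. by rewrite /twist trmx1 map_mx1 mul1mx mulmx1. Qed.

Lemma bosonic_approx m (al : K2 -> 'M[C]_m) dl : matching 1%:M al -> null_homotopic 1%:M al ->
  0 < dl -> exists al', [/\ matching 1%:M al', null_homotopic 1%:M al',
    forall k, mle dl (al' k - al k) & forall k, simple_spec (al' k)].
Proof.
move=> hal hal0 dl0; have [dl' [e [d0 dd md [e0 he hd]]]] := small_scale m dl0.
have h1 : (1%:M : 'M[C]_m) \is unitarymx by apply/unitarymxP; rewrite adj1 mulmx1.
have hm b : exists A : 'M[C]_m, [/\ A \is unitarymx, A^T = A,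
    mle e (A - al (half_pt R b.1, half_pt R b.2)) & disc A != 0].
  apply: symmetric_model e0; first by case: hal.
  by rewrite -twist_id -half_pt_twist.
have [B hB] := choice hm.
have t1 : (1%:M : 'M[C]_m)^T = 1 *: 1%:M by rewrite trmx1 scale1r.
(* The bosonic models are constant, so any radius will do; here it is [1]. *)
have [] := @generic_approx R m 1%:M 1 h1 t1 (mulr1 1) al (fun b1 b2 _ => B (b1, b2)) e 1 dl'
  hal e0 he hd ltr01.
- by move=> b1 b2 k; exact: tendsto_mx_cst.
- by move=> b1 b2 k; case: (hB (b1, b2)).
- by move=> b1 b2 k; rewrite twist_id; case: (hB (b1, b2)).
- by move=> b1 b2 k _; case: (hB (b1, b2)).
- by move=> b1 b2 k _ _; case: (hB (b1, b2)).
move=> al' [w [m' c' w0 hw hw']]; exists al'; split=> //.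
- by have := null_homotopic_close h1 hal m' c' md hal0; apply.
- by move=> k; exact: mle_le dd (c' k).
- move=> k; apply: disc_simple_spec; first by case: m'.
  have [/hw -> |/ltW /hw' //] := leP (sd k) w.
  by case: (hB (hpar k.1, hpar k.2)).
Qed.

Lemma clustered_spec_le m a b (A : 'M[C]_m) : a <= b -> clustered_spec b A -> clustered_spec a A.
Proof.
move=> ab [V [d [h1 h2]]]; exists V, d; split=> // i j ij.
exact: le_trans ab (h2 _ _ ij).
Qed.

Lemma fermionic_approx h (al : K2 -> 'M[C]_(h + h)) dl : let J := Jblock R h in
  matching J al -> null_homotopic J al -> 0 < dl ->
  exists al', [/\ matching J al', null_homotopic J al', forall k, mle dl (al' k - al k)
    & [/\ forall k, sd k != 0 -> simple_spec (al' k), forall k, sd k = 0 -> double_spec (al' k)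
        & exists a r, [/\ 0 < a, 0 < r & forall k, sd k < r -> clustered_spec a (al' k)]]].
Proof.
move=> J hal hal0 dl0; have [dl' [e [d0 dd md [e0 he hd]]]] := small_scale (h + h) dl0.
have hJ : J \is unitarymx := Jblock_unitary R h.
have tJ : J^T = -1 *: J by rewrite scaleN1r; exact: Jblock_tr.
have s2 : -1 * -1 = 1 :> C by rewrite mulrNN mulr1.
have hm b := kramers_model (let: And4 _ _ u _ := hal in u (half_pt R b.1, half_pt R b.2))
  (half_pt_twist b.1 b.2 hal) e0.
have [B hB] := choice hm; have [a ha] := choice hB; have [r hr] := choice ha.
have [a0 a0p a0le] : exists2 g, 0 < g & forall b, g <= a b.
  by apply: finite_gap => b; case: (hr b) => -[].
have [r0 r0p r0le] : exists2 g, 0 < g & forall b, g <= r b.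
  by apply: finite_gap => b; case: (hr b) => -[].
have [] := @generic_approx R (h + h) J (-1) hJ tJ s2 al
  (fun b1 b2 => B (b1, b2)) e r0 dl' hal e0 he hd r0p.
- by move=> b1 b2; case: (hr (b1, b2)) => -[].
- by move=> b1 b2; case: (hr (b1, b2)) => -[].
- by move=> b1 b2; case: (hr (b1, b2)) => -[].
- move=> b1 b2 k /(nbh_le (r0le (b1, b2))) hk.
  by case: (hr (b1, b2)) => _ [_ /(_ k hk) []].
- move=> b1 b2 k /(nbh_le (r0le (b1, b2))) hk.
  by case: (hr (b1, b2)) => _ [_ _ /(_ k hk)].
move=> al' [w [m' c' /andP[w0 wr] hw hw']]; exists al'; split=> //.
- by have := null_homotopic_close hJ hal m' c' md hal0; apply.
- by move=> k; exact: mle_le dd (c' k).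
have hn k : sd k < w -> nbh (0, 0) (r (hpar k.1, hpar k.2)) (hoff k.1, hoff k.2).
  move=> hk; apply: (nbh_le (r0le _)); apply: hoff_le_sd; exact: lt_trans hk wr.
split.
- move=> k sk; apply: disc_simple_spec; first by case: m'.
  have [hk|/hw' //] := ltP (sd k) w; rewrite (hw k (ltW hk)).
  case: (hr (hpar k.1, hpar k.2)) => _ [_ _ /(_ _ (hn k hk)) h3]; apply: h3.
  apply: contraNneq sk => -[h1 h2].
  have z x : hoff x = 0 -> dz (2 * x) = 0.
    by move=> h0; have := hoff_dz x; rewrite h0 normr0; lra.
  by rewrite /sd !z // maxxx mul0r.
- move=> k sk; rewrite hw ?sk ?(ltW w0) // /hmodel.
  have [-> ->] := hoff_eq0 sk.
  by case: (hr (hpar k.1, hpar k.2)) => _ [].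
- exists a0, w; split=> // k hk; rewrite (hw k (ltW hk)).
  apply: clustered_spec_le (a0le (hpar k.1, hpar k.2)) _.
  by case: (hr (hpar k.1, hpar k.2)) => _ [_ /(_ _ (hn k hk)) [_ h2] _].
Qed.

End GenericForms.

(** * Transfer to the concrete matrices *)

Section Translation.
Local Notation R := Rdefinitions.R.
Local Notation C := R[i].
Implicit Types (m : nat) (z w : Defs.C) (A B : Mat).

Definition toC z : C := (z.1 +i* z.2)%C.
Definition ofC (x : C) : Defs.C := (Re x, Im x).

Lemma toC_inj : injective toC.
Proof. by move=> [a b] [c d] [-> ->]. Qed.

Lemma ofCK : cancel ofC toC.
Proof. by case. Qed.

Lemma toC_conj z : toC (Cconj z) = (toC z)^*.
Proof. by []. Qed.

Lemma toC_mul z w : toC (Cmul z w) = toC z * toC w.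
Proof. by []. Qed.

Lemma toC_sub z w : toC (Csub z w) = toC z - toC w.
Proof. by []. Qed.

Lemma toC_sum m f : toC (Csum m f) = \sum_(i < m) toC (f i).
Proof.
elim: m => [|m IH]; first by rewrite big_ord0.
by rewrite big_ord_recr -IH.
Qed.

Lemma CnormE z : Cnorm z = normc (toC z).
Proof. by rewrite /Cnorm RsqrtE !RpowE. Qed.

Variable m : nat.

Definition toM A : 'M[C]_m := \matrix_(i, j) toC (A i j).

(** Entries outside ['I_m] receive the default [C0]; [meq] never inspects them. *)
Definition ofM (M : 'M[C]_m) : Mat := fun i j =>
  if insub i is Some i' then if insub j is Some j' then ofC (M i' j') else Defs.C0 else Defs.C0.

Lemma ofME (M : 'M[C]_m) (i j : 'I_m) : toC (ofM M i j) = M i j.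
Proof. by rewrite /ofM !valK ofCK. Qed.

Lemma ofMK M : toM (ofM M) = M.
Proof. by apply/matrixP => i j; rewrite mxE ofME. Qed.

Lemma forall_ord (P : nat -> Prop) : (forall i, (i < m)%coq_nat -> P i) <-> forall i : 'I_m, P i.
Proof.
split=> [h i|h i /ssrnat.ltP im]; first by apply: h; apply/ssrnat.ltP.
exact: (h (Ordinal im)).
Qed.

Lemma forall_ord2 (P : nat -> nat -> Prop) :
  (forall i j, (i < m)%coq_nat -> (j < m)%coq_nat -> P i j) <-> forall i j : 'I_m, P i j.
Proof.
split=> [h i j|h i j /ssrnat.ltP im /ssrnat.ltP jm]; first by apply: h; apply/ssrnat.ltP.
exact: (h (Ordinal im) (Ordinal jm)).
Qed.

Lemma meqE A B : meq m A B <-> toM A = toM B.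
Proof.
rewrite /meq forall_ord2; split=> [h|/matrixP h] => [|i j].
  by apply/matrixP => i j; rewrite !mxE h.
by apply: toC_inj; have := h i j; rewrite !mxE.
Qed.

Lemma toM_mul A B : toM (mmul m A B) = toM A *m toM B.
Proof.
by apply/matrixP => i j; rewrite !mxE toC_sum; apply: eq_bigr => k _; rewrite !mxE toC_mul.
Qed.

Lemma toM_adj A : toM (madj A) = (toM A)^t*.
Proof. by apply/matrixP => i j; rewrite !mxE. Qed.

Lemma toM_tr A : toM (mtr A) = (toM A)^T.
Proof. by apply/matrixP => i j; rewrite !mxE. Qed.

Lemma toM_sub A B : toM (msub A B) = toM A - toM B.
Proof. by apply/matrixP => i j; rewrite !mxE. Qed.

Lemma eqb_ord (i j : 'I_m) : Nat.eqb i j = (i == j).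
Proof. by apply/idP/eqP => [/Nat.eqb_eq /val_inj //|->]; apply/Nat.eqb_eq. Qed.

Lemma toM_id : toM mId = 1%:M.
Proof. by apply/matrixP => i j; rewrite !mxE /mId eqb_ord; case: eqP. Qed.

Lemma unitaryE A : Defs.unitary m A <-> toM A \is unitarymx.
Proof.
rewrite /Defs.unitary meqE toM_mul toM_adj toM_id.
by split=> [/unitarymx_of_adj|/unitarymx_adjK].
Qed.

Lemma matching_eqE E al be : toM E \is unitarymx ->
  (meq m (mmul m E al) (mmul m (mtr be) E) <-> toM al = twist (toM E) (toM be)).
Proof.
move=> hE; rewrite meqE !toM_mul toM_tr /twist -mulmxA.
split=> [<-|->]; first by rewrite mulmxA (unitarymx_adjK hE) mul1mx.
by rewrite [LHS]mulmxA (unitarymx_mul_adj hE) mul1mx.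
Qed.

Lemma Rlt0P (x : R) : reflect (Rlt (IZR 0) x) (0 < x).
Proof. exact: RltP. Qed.

Lemma dist2E (k l : R2) : dist2 k l = normc ((k.1 - l.1) +i* (k.2 - l.2))%C.
Proof. by rewrite /dist2 RsqrtE !RpowE. Qed.

Lemma nbh_dist2 (k k' : R2) d : dist2 k k' < d -> nbh k d k'.
Proof.
rewrite dist2E /nbh (distrC k'.1) (distrC k'.2) => h.
by split; [apply: (le_lt_trans (le_normc_Re _) h)|apply: (le_lt_trans (le_normc_Im _) h)].
Qed.

Lemma dist2_nbh (k k' : R2) d : nbh k (d / 2) k' -> dist2 k k' < d.
Proof.
rewrite dist2E /nbh (distrC k'.1) (distrC k'.2) => -[h1 h2].
by apply: le_lt_trans (le_normc_ReIm _) _ => /=; lra.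
Qed.

Lemma fam_contE (al : R2 -> Mat) : fam_continuous m al <-> fam_cont (fun k => toM (al k)).
Proof.
split=> h k.
  move=> i j e e0; have [d [/Rlt0P d0 hd]] := h k e (Rlt0P _ e0).
  exists (d / 2); first by rewrite divr_gt0.
  move=> k' /dist2_nbh /RltP /hd /forall_ord2 /(_ i j) /RltP.
  by rewrite CnormE toC_sub !mxE.
move=> e /Rlt0P e0; have /(tendsto_mxP (@nbh_le _ _)) h' := h k.
have [|d d0 hd] := h' (e / 2); first by rewrite divr_gt0.
exists d; split; first exact/Rlt0P.
move=> k' /RltP /nbh_dist2 /hd hk; apply/forall_ord2 => i j; apply/RltP.
have := hk i j; rewrite CnormE toC_sub !mxE => /le_lt_trans; apply; lra.
Qed.

Lemma periodicE (al : R2 -> Mat) :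
  (forall k, meq m (al (Rplus (fst k) 1, snd k)) (al k) /\ meq m (al (fst k, Rplus (snd k) 1)) (al k))
  <-> periodic (fun k => toM (al k)).
Proof. by split=> h k; have [h1 h2] := h k; split; apply/meqE. Qed.

Lemma matchingE s (al : R2 -> Mat) : toM (eps s m) \is unitarymx ->
  matching_family s m al <-> matching (toM (eps s m)) (fun k => toM (al k)).
Proof.
move=> hE; split.
  move=> [h1 [h2 [h3 h4]]]; split.
  - by move/fam_contE: h1; apply.
  - by move/periodicE: h2; apply.
  - by move=> k; have /unitaryE := h3 k; apply.
  - by move=> k; have /(matching_eqE _ _ hE) := h4 k; apply.
move=> [h1 h2 h3 h4]; split; [|split; [|split]].
- by apply/fam_contE; apply: h1.
- by apply/periodicE; apply: h2.
- by move=> k; apply/unitaryE; apply: h3.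
- by move=> k; apply/(matching_eqE _ _ hE); apply: h4.
Qed.

Lemma null_homotopicE s (al : R2 -> Mat) : toM (eps s m) \is unitarymx ->
  equiv_null_homotopic s m al <-> null_homotopic (toM (eps s m)) (fun k => toM (al k)).
Proof.
move=> hE; have I (t : R) : 0 <= t <= 1 <-> (Rle 0 t /\ Rle t 1).
  by split=> [/andP[/RleP ? /RleP ?]//|[/RleP t0 /RleP t1]]; apply/andP.
split.
  move=> [H [h1 [h2 [h3 h4]]]]; exists (fun t k => toM (H t k)); split.
  - move=> t k /I t01 i j e e0; have [d [/Rlt0P d0 hd]] := h1 t k e t01 (Rlt0P _ e0).
    exists (d / 2); first by rewrite divr_gt0.
    move=> [t' k'] [/= /I t'01 tt /dist2_nbh /RltP kk].
    have tt' : Rlt (Rabs (Rminus t' t)) d by rewrite RabsE; apply/RltP; move: tt; lra.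
    have /forall_ord2 /(_ i j) /RltP := hd t' k' t'01 tt' kk.
    by rewrite CnormE toC_sub !mxE.
  - by move=> t /I t01; apply/(matchingE _ hE); exact: h2.
  - by move=> k; apply/meqE.
  - by move=> k; rewrite -toM_id; apply/meqE.
move=> [H [h1 h2 h3 h4]]; exists (fun t k => ofM (H t k)); split; [|split; [|split]].
- move=> t k e /I t01 /Rlt0P e0; have /(tendsto_mxP (@nbh2_le _ _)) h' := h1 t k t01.
  have [|d d0 hd] := h' (e / 2); first by rewrite divr_gt0.
  exists d; split; first exact/Rlt0P.
  move=> t' k' /I t'01 /RltP; rewrite RabsE => tt /RltP /nbh_dist2 kk.
  have hk := hd (t', k') (And3 t'01 tt kk); apply/forall_ord2 => i j; apply/RltP.
  have := hk i j; rewrite CnormE toC_sub !ofME !mxE => /le_lt_trans; apply; lra.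
- move=> t /I t01; apply/(matchingE _ hE).
  by have := h2 t t01; congr (matching _ _); apply/funext => k; rewrite ofMK.
- by move=> k; apply/meqE; rewrite ofMK h3.
- by move=> k; apply/meqE; rewrite ofMK h4 toM_id.
Qed.

Definition vec (d : 'rV[C]_m) (i : nat) : Defs.C := if insub i is Some i' then ofC (d 0 i') else Defs.C0.

Lemma vecE (d : 'rV[C]_m) (i : 'I_m) : toC (vec d i) = d 0 i.
Proof. by rewrite /vec valK ofCK. Qed.

Lemma eigenframe_spectrum A V d : eigenframe (toM A) V d -> is_spectrum m A (vec d).
Proof.
move=> [VV AV]; exists (fun i r => ofM V r i); split; apply/forall_ord2 => i j; apply: toC_inj.
  have /matrixP/(_ i j) := VV; rewrite !mxE toC_sum => h.
  transitivity ((i == j)%:R : C); last by rewrite eqb_ord; case: eqP.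
  rewrite -h; apply: eq_bigr => k _.
  by rewrite toC_mul toC_conj !ofME !mxE.
have /matrixP/(_ j i) := AV; rewrite mul_mx_diag !mxE => h.
rewrite toC_sum toC_mul ofME vecE mulrC -h; apply: eq_bigr => k _.
by rewrite toC_mul ofME mxE.
Qed.

Lemma simple_spectrumI A : simple_spec (toM A) -> simple_spectrum m A.
Proof.
move=> [V [d [/eigenframe_spectrum hd di]]]; exists (vec d); split=> //.
apply/forall_ord2 => i j hij; congr val; apply: di.
by rewrite -!vecE hij.
Qed.

Lemma doubly_degenerateI A : double_spec (toM A) -> doubly_degenerate m A.
Proof.
move=> [V [d [/eigenframe_spectrum hd di]]]; exists (vec d); split=> //.
apply/forall_ord => i; have [j [ji dj hl]] := di i.
exists j; split; first exact/ssrnat.ltP.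
split; first by move/val_inj/eqP; apply/negP.
split; first by apply: toC_inj; rewrite !vecE.
apply/forall_ord => l hli.
by have [|->|->] := hl l; [rewrite -!vecE hli|left|right].
Qed.

Lemma Nat_div2 n : Nat.div n 2 = n./2.
Proof.
apply/esym/(Nat.div_unique _ _ _ (odd n)); first by case: (odd n); apply/ssrnat.ltP.
by rewrite -{1}(odd_double_half n) multE plusE mul2n addnC.
Qed.

Lemma paired_clustersI A a : clustered_spec a (toM A) -> paired_clusters m A a.
Proof.
move=> [V [d [/eigenframe_spectrum hd di]]]; exists (vec d); split=> //.
apply/forall_ord2 => i j; rewrite !Nat_div2 => /eqP hij; apply/RleP.
by rewrite CnormE toC_sub !vecE; exact: di.
Qed.

Lemma vnormE v : vnorm m v = Num.sqrt (\sum_(i < m) normc (toC (v i)) ^+ 2).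
Proof.
rewrite /vnorm RsqrtE; congr Num.sqrt.
elim: m => [|n IH]; first by rewrite big_ord0.
by rewrite big_ord_recr -IH -RpowE -CnormE.
Qed.

Lemma vnorm_ge_coord (v : Vec) (i : 'I_m) : normc (toC (v i)) <= vnorm m v.
Proof.
rewrite vnormE -[X in X <= _](ger0_norm (normc_ge0 _)) -sqrtr_sqr ler_wsqrtr //.
by rewrite (bigD1 i) //= lerDl; apply: sumr_ge0 => j _; exact: sqr_ge0.
Qed.

Lemma vnorm_le (v : Vec) b : 0 <= b -> (forall i : 'I_m, normc (toC (v i)) <= b) -> vnorm m v <= m%:R * b.
Proof.
move=> b0 hv; rewrite vnormE -[X in _ <= X](ger0_norm (mulr_ge0 (ler0n _ m) b0)) -sqrtr_sqr.
apply: ler_wsqrtr; apply: le_trans (_ : \sum_(i < m) b ^+ 2 <= _).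
  by apply: ler_sum => i _; rewrite ler_pXn2r ?nnegrE ?normc_ge0.
rewrite sumr_const card_ord -[X in X <= _]mulr_natl exprMn ler_wpM2r ?exprn_ge0 //.
by rewrite -natrX ler_nat; case: (m) => // n; rewrite leq_pmulr.
Qed.

(** A crude comparison of operator norm and entrywise norm; [approx_sequence] absorbs the factor
    [m ^ 2]. *)
Lemma mle_operator_bound A (v : Vec) e : 0 <= e -> mle e (toM A) ->
  vnorm m (mapply m A v) <= m%:R * (m%:R * e) * vnorm m v.
Proof.
move=> e0 hA; have v0 : 0 <= vnorm m v by rewrite vnormE sqrtr_ge0.
rewrite -2!mulrA; apply: vnorm_le => [|i]; first by rewrite !mulr_ge0.
rewrite toC_sum; apply: le_trans (normc_sum _ _ _) _.
rewrite -[m in m%:R]card_ord mulr_natl -sumr_const; apply: ler_sum => j _.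
rewrite toC_mul normcM ler_pM ?normc_ge0 ?vnorm_ge_coord //.
by have := hA i j; rewrite mxE.
Qed.

End Translation.

(** * Generic form of the concrete families *)

Section GenericFamilies.
Local Notation R := Rdefinitions.R.
Local Notation C := R[i].

Lemma approx_sequence s m (al : R2 -> Mat) (P : (R2 -> Mat) -> Prop) :
  toM m (eps s m) \is unitarymx ->
  (forall dl : R, 0 < dl -> exists al' : R2 -> 'M[C]_m, [/\ matching (toM m (eps s m)) al',
     null_homotopic (toM m (eps s m)) al', forall k, mle dl (al' k - toM m (al k))
     & P (fun k => ofM (al' k))]) ->
  exists als : nat -> R2 -> Mat,
    (forall n, matching_family s m (als n) /\ equiv_null_homotopic s m (als n) /\ P (als n)) /\
    unif_conv m als al.
Proof.
(* This choice gives [m ^ 2 * dl n <= 1 / n.+1] for the operator norm; the [+ 1] covers [m = 0]. *)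
move=> hE happ; pose dl n : R := (n.+1%:R * (m%:R ^+ 2 + 1))^-1.
have M0 : 0 < m%:R ^+ 2 + 1 :> R by rewrite ltr_wpDl ?exprn_ge0.
have dl0 n : 0 < dl n by rewrite invr_gt0 mulr_gt0 // ltr0n.
have [als hals] := choice (fun n => happ (dl n) (dl0 n)).
have ofMals n : (fun k => toM m (ofM (als n k))) = als n.
  by apply/funext => k; rewrite ofMK.
exists (fun n k => ofM (als n k)); split.
  move=> n; have [h1 h2 h3 h4] := hals n; split; [|split].
  - by apply/(matchingE _ hE); rewrite ofMals; exact: h1.
  - by apply/(null_homotopicE _ hE); rewrite ofMals; exact: h2.
  - exact: h4.
move=> e /Rlt0P e0; exists (Num.truncn (e^-1)).+1 => n /ssrnat.leP hn k v.
have [_ _ h3 _] := hals n.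
have v0 : 0 <= vnorm m v by rewrite vnormE sqrtr_ge0.
have hA : mle (dl n) (toM m (msub (ofM (als n k)) (al k))) by rewrite toM_sub ofMK; exact: h3.
apply/RleP; apply: le_trans (mle_operator_bound v (ltW (dl0 n)) hA) _.
apply: (ler_wpM2r v0); rewrite mulrA -expr2.
have hn1 : e^-1 < n.+1%:R.
  by apply: lt_le_trans (truncnS_gt _) _; rewrite ler_nat; apply: leq_trans hn _.
apply: le_trans (_ : (n.+1%:R)^-1 <= _); last first.
  by rewrite -[e]invrK lef_pV2 ?posrE ?invr_gt0 ?ltr0n // ltW.
rewrite /dl invfM mulrCA ler_piMr ?invr_ge0 // ler_pdivrMr // mul1r lerDl //.
Qed.

Lemma IZR_int (a : Z) : exists z : int, IZR a = z%:~R.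
Proof.
case: a => [|p|p]; first by exists 0; rewrite mulr0z.
  by exists (nat_of_pos p)%:Z; rewrite IZRposE INRE.
exists (- (nat_of_pos p)%:Z); rewrite mulrNz -[X in - X]INRE -IZRposE.
by rewrite -RoppE -opp_IZR.
Qed.

Lemma int_IZR (z : int) : exists a : Z, IZR a = z%:~R.
Proof.
case: z => n; first by exists (Z.of_nat n); rewrite -INR_IZR_INZ INRE.
by exists (Z.opp (Z.of_nat n.+1)); rewrite opp_IZR -INR_IZR_INZ INRE NegzE mulrNz.
Qed.

Lemma dz_eq0 (x : R) : dz x = 0 <-> exists a : Z, x = IZR a.
Proof.
split=> [/eqP|[a ->]]; last first.
  have [z ->] := IZR_int a; apply/eqP; rewrite eq_le dz_ge0 andbT.
  by have := dz_le (z%:~R : R) z; rewrite subrr normr0.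
rewrite normr_eq0 subr_eq0 => /eqP hx; have [a ha] := int_IZR (rnd x).
by exists a; rewrite ha -hx.
Qed.

Lemma high_symE (k : R2) : high_sym k <-> sd k = 0.
Proof.
have -> : (sd k = 0) <-> dz (2 * k.1) = 0 /\ dz (2 * k.2) = 0.
  split=> [h|[h1 h2]]; last by rewrite /sd h1 h2 maxxx mul0r.
  have z x : dz x / 2 <= sd k -> dz x = 0.
    by rewrite h => hx; apply/eqP; rewrite eq_le dz_ge0 andbT; move: hx; lra.
  by split; apply: z; rewrite /sd ler_pM2r ?invr_gt0 // le_max lexx ?orbT.
by rewrite !dz_eq0; split=> [[a [b [ha hb]]]|[[a ha] [b hb]]];
  [split; [exists a|exists b]|exists a, b].
Qed.

Lemma high_sym_ball (k ks : R2) r : high_sym ks -> Rlt (dist2 k ks) r -> sd k < r.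
Proof.
move=> /high_symE hs /RltP; rewrite dist2E => h.
apply: le_lt_trans h; rewrite -[X in _ <= X]add0r -hs; apply: sd_lip.
  exact: le_normc_Re (_ +i* _)%C.
exact: le_normc_Im (_ +i* _)%C.
Qed.

Lemma toM_Jmat h : toM (h + h) (Jmat (h + h)) = Jblock R h.
Proof.
have dE : Nat.div (h + h) 2 = h by rewrite Nat_div2 addnn doubleK.
have ltbE a b : Nat.ltb a b = (a < b)%N.
  by apply/idP/idP => [/Nat.ltb_lt /ssrnat.ltP|/ssrnat.ltP /Nat.ltb_lt].
have eqbE a b : Nat.eqb a b = (a == b).
  by apply/idP/eqP => [/Nat.eqb_eq|/Nat.eqb_eq].
apply/matrixP => i j; rewrite [LHS]mxE /Jmat dE !ltbE !eqbE.
case: (fintype.split_ordP i) => i' ->; case: (fintype.split_ordP j) => j' ->.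
- rewrite block_mxEul mxE /= !plusE.
  have -> : (j' == i' + h :> nat)%N = false by apply/eqP; have := ltn_ord j'; lia.
  by have -> : (i' == j' + h :> nat)%N = false by apply/eqP; have := ltn_ord i'; lia.
- by rewrite block_mxEur mxE /= plusE addnC eqn_add2r eq_sym val_eqE; case: (i' == j').
- rewrite block_mxEdl !mxE /= plusE (addnC h) eqn_add2r val_eqE.
  by case: (i' == j') => //; rewrite oppr0.
- by rewrite block_mxEdr mxE.
Qed.

Lemma bosonic_generic m (al : R2 -> Mat) :
  matching_family Bosonic m al -> equiv_null_homotopic Bosonic m al ->
  exists als : nat -> R2 -> Mat,
    (forall n, matching_family Bosonic m (als n) /\ generic_form Bosonic m (als n)) /\
    unif_conv m als al.
Proof.
have E1 : toM m (eps Bosonic m) = 1%:M by exact: toM_id.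
have hE : toM m (eps Bosonic m) \is unitarymx.
  by rewrite E1; apply/unitarymxP; rewrite adj1 mulmx1.
move=> /(matchingE _ hE) h1 /(null_homotopicE _ hE) h2.
apply: (@approx_sequence Bosonic m al (fun be => forall k, simple_spectrum m (be k)) hE).
move: h1 h2; rewrite E1 => h1 h2 dl dl0.
have [al' [m' n' c' s']] := bosonic_approx h1 h2 dl0.
exists al'; split=> // k; apply: simple_spectrumI; rewrite ofMK; exact: s'.
Qed.

Lemma fermionic_generic h (al : R2 -> Mat) : let m := (h + h)%N in
  matching_family Fermionic m al -> equiv_null_homotopic Fermionic m al ->
  exists als : nat -> R2 -> Mat,
    (forall n, matching_family Fermionic m (als n) /\ generic_form Fermionic m (als n)) /\
    unif_conv m als al.
Proof.
move=> m; have EJ : toM m (eps Fermionic m) = Jblock R h by exact: toM_Jmat.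
have hE : toM m (eps Fermionic m) \is unitarymx by rewrite EJ; exact: Jblock_unitary.
move=> /(matchingE _ hE) h1 /(null_homotopicE _ hE) h2.
pose P (be : R2 -> Mat) := (forall k, ~ high_sym k -> simple_spectrum m (be k)) /\
  (forall k, high_sym k -> doubly_degenerate m (be k)) /\
  (exists a r : R, Rlt (IZR 0) a /\ Rlt (IZR 0) r /\
     forall k ks, high_sym ks -> Rlt (dist2 k ks) r -> paired_clusters m (be k) a).
apply: (@approx_sequence Fermionic m al P hE).
move: h1 h2; rewrite EJ => h1 h2 dl dl0.
have [al' [m' n' c' [s1 s2 [a [r [a0 r0 s3]]]]]] := fermionic_approx h1 h2 dl0.
exists al'; split=> //; split; [|split].
- move=> k hk; apply: simple_spectrumI; rewrite ofMK; apply: s1.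
  by apply/eqP => /high_symE.
- by move=> k /high_symE hk; apply: doubly_degenerateI; rewrite ofMK; exact: s2.
- exists a, r; split; first exact/Rlt0P; split; first exact/Rlt0P.
  move=> k ks hs hk; apply: paired_clustersI; rewrite ofMK; apply: s3.
  exact: high_sym_ball hs hk.
Qed.

End GenericFamilies.

End GenericPosition.

Theorem theorem4p2 :
  forall (s : sym) (m : nat), (1 <= m)%nat ->
    (s = Fermionic -> Nat.Even m) ->
    forall al : R2 -> Mat,
      matching_family s m al ->
      equiv_null_homotopic s m al ->
      exists als : nat -> R2 -> Mat,
        (forall n, matching_family s m (als n) /\ generic_form s m (als n)) /\
        unif_conv m als al.
Proof.
  intros s m _ hm al.
  destruct s as [|]; [apply GenericPosition.bosonic_generic|].
  destruct (hm eq_refl) as [h ->].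
  (* The block form of [J] lives in size [h + h]. *)
  replace (2 * h)%nat with (h + h)%nat by (simpl; rewrite Nat.add_0_r; reflexivity).
  apply GenericPosition.fermionic_generic.
Qed.
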